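(* Let $M$ be a compact homogeneous space of a connected Lie group $G$ with invariant measure $\mu$ and vector fields $V_1,\dots,V_d$, with semigroup $P_t$, carré du champ $\Gamma$ and heat kernel $p(t,x_0,x)$, as described in the context. Assume there is a constant $K>0$ such that $$\Gamma(P_tf,P_tf)(x)\le K\,P_t(\Gamma(f,f))(x)$$ for all $f\in C_0^\infty(M)$, all $0\le t\le1$ and all $x\in M$. Let $U:M\to\mathbb R$ be a smooth function, $D$ a constant and $x_0\in M$ a point such that $$|U(x)+\varepsilon^2\log p(\varepsilon^2,x_0,x)|\le D$$ for all $x\in M$ and all $0<\varepsilon\le1$. Then there exist constants $R,c>0$ (with $R>1$) such that, for $\varepsilon(t)=\frac{c}{\sqrt{\log(R+t)}}$, $$\operatorname{var}_{\varepsilon(t)}(f)\le K(R+t)\,\Bigl\langle\tfrac12\Gamma(f,f)\Bigr\rangle_{\varepsilon(t)}$$ for all $f\in C_0^\infty(M)$ and all $t\ge0$.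
   Context: Setting: $G$ is a finite-dimensional connected Lie group acting transitively on the compact space $M$ from the right, $(g,x)\mapsto\hat\pi(g,x)$; $\mu$ is a measure on $M$ invariant under this action. Left-invariant vector fields on $G$ generating (as a Lie algebra) the whole Lie algebra of $G$ are given; $V_1,\dots,V_d$ denote the fundamental vector fields on $M$ they induce, i.e. the field induced by $A\in\mathfrak g$ is $(Vf)(x)=\frac{d}{ds}\big|_{s=0}f(\hat\pi(\exp(sA),x))$. $\Gamma(f,g)=\sum_{i=1}^d(V_if)(V_ig)$; $P_tf(x)=\mathbf Ef(X^x_t)$ where $dX^x_t=\sum_{i=1}^dV_i(X^x_t)\circ dB^i_t$, $X^x_0=x$, with $B$ a $d$-dimensional Brownian motion; $p(t,x_0,\cdot)$ is the (smooth, positive) density of the law of $X^{x_0}_t$ with respect to $\mu$. $C_0^\infty(M)$ denotes the smooth (compactly supported) real functions on $M$. For $\varepsilon>0$, $\mu_\varepsilon=Z_\varepsilon^{-1}\exp(-U/\varepsilon^2)\mu$ with $Z_\varepsilon=\int_M\exp(-U/\varepsilon^2)d\mu$ (a probability measure), $\langle f\rangle_\varepsilon=\int_Mf\,d\mu_\varepsilon$ and $\operatorname{var}_\varepsilon(f)=\langle(f-\langle f\rangle_\varepsilon)^2\rangle_\varepsilon$. *)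

(* Defs.v *)
From HB Require Import structures.
From mathcomp Require Import all_boot all_order all_algebra.
From mathcomp Require Import all_classical all_reals all_analysis.
Import Order.TTheory GRing.Theory Num.Theory.
Import numFieldNormedType.Exports.
Set Implicit Arguments.
Unset Strict Implicit.
Unset Printing Implicit Defensive.
Local Open Scope classical_set_scope.
Local Open Scope ring_scope.

(* E is meant to be finite dimensional and U open: then existence and
   continuity on U of all iterated directional derivatives of order <= k is
   the usual C^k. *)
Fixpoint Ck_on (R : realType) (E F : normedModType R) (k : nat) (U : set E)
    (f : E -> F) : Prop :=
  (forall u, U u -> {for u, continuous f}) /\
  if k is k'.+1 then
    forall v, (forall u, U u -> derivable f u v) /\ Ck_on k' U ('D_v f)
  else True.

Definition smooth_on (R : realType) (E F : normedModType R) (U : set E)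
  (f : E -> F) : Prop := forall k, Ck_on k U f.

Record chart (M E : Type) := Chart {
  chart_dom : set M ;
  chart_cod : set E ;
  chart_to : M -> E ;
  chart_from : E -> M }.

Definition is_chart (R : realType) (M : topologicalType) (E : normedModType R)
    (c : chart M E) : Prop :=
  [/\ open (chart_dom c), open (chart_cod c),
      forall x, chart_dom c x -> [/\ chart_cod c (chart_to c x),
        chart_from c (chart_to c x) = x & {for x, continuous (chart_to c)}] &
      forall u, chart_cod c u -> [/\ chart_dom c (chart_from c u),
        chart_to c (chart_from c u) = u & {for u, continuous (chart_from c)}]].

Record is_manifold (R : realType) (n : nat) (M : topologicalType)
    (A : set (chart M 'rV[R]_n)) : Prop := IsManifold {
  manifold_hausdorff : hausdorff_space M ;
  manifold_second_countable : @second_countable M ;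
  manifold_chart : forall c, A c -> is_chart c ;
  manifold_cover : forall x, exists2 c, A c & chart_dom c x ;
  manifold_transition : forall c c', A c -> A c' ->
    smooth_on (chart_cod c `&` chart_from c @^-1` chart_dom c')
              (chart_to c' \o chart_from c) }.

Definition std_atlas (E : Type) : set (chart E E) :=
  [set Chart setT setT id id].

Definition prod_chart (M E N F : Type) (c : chart M E) (c' : chart N F) :
    chart (M * N) (E * F) :=
  Chart (chart_dom c `*` chart_dom c') (chart_cod c `*` chart_cod c')
        (fun z => (chart_to c z.1, chart_to c' z.2))
        (fun w => (chart_from c w.1, chart_from c' w.2)).

Definition prod_atlas (M E N F : Type) (A : set (chart M E))
    (B : set (chart N F)) : set (chart (M * N) (E * F)) :=
  [set prod_chart z.1 z.2 | z in A `*` B].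

(* W is meant to be open. *)
Definition smooth_map_on (R : realType) (M N : topologicalType)
    (E F : normedModType R) (A : set (chart M E)) (B : set (chart N F))
    (W : set M) (f : M -> N) : Prop :=
  (forall x, W x -> {for x, continuous f}) /\
  forall c c', A c -> B c' ->
    smooth_on (chart_cod c `&` chart_from c @^-1` (W `&` f @^-1` chart_dom c'))
              (chart_to c' \o f \o chart_from c).

Definition smooth_map (R : realType) (M N : topologicalType)
    (E F : normedModType R) (A : set (chart M E)) (B : set (chart N F))
    (f : M -> N) : Prop := smooth_map_on A B setT f.

(* When M is compact these are also the compactly supported smooth functions. *)
Definition smooth_fun (R : realType) (M : topologicalType)
    (E : normedModType R) (A : set (chart M E)) (f : M -> R) : Prop :=
  smooth_map A (@std_atlas R) f.

#[short(type="groupTopologicalType")]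
HB.structure Definition GroupTopological := {G of Group G & Topological G}.

Record is_lie_group (R : realType) (n : nat) (G : groupTopologicalType)
    (A : set (chart G 'rV[R]_n)) : Prop := IsLieGroup {
  lie_group_manifold : is_manifold A ;
  lie_group_mul : smooth_map (prod_atlas A A) A (fun z => (z.1 * z.2)%g) ;
  lie_group_inv : smooth_map A A (fun g : G => (g^-1)%g) }.

(* A vector field is a derivation of the algebra of smooth functions, here an
   operator whose values on non-smooth functions are irrelevant. *)
Definition vfield (R : realType) (G : Type) := (G -> R) -> (G -> R).

Record left_invariant (R : realType) (n : nat) (G : groupTopologicalType)
    (A : set (chart G 'rV[R]_n)) (X : vfield R G) : Prop := LeftInvariant {
  vfield_smooth : forall f, smooth_fun A f -> smooth_fun A (X f) ;
  vfield_linear : forall (a : R) f g, smooth_fun A f -> smooth_fun A g ->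
    X (fun h => a * f h + g h) = (fun h => a * X f h + X g h) ;
  vfield_leibniz : forall f g, smooth_fun A f -> smooth_fun A g ->
    X (fun h => f h * g h) = (fun h => X f h * g h + f h * X g h) ;
  vfield_left_invariant : forall (k : G) f, smooth_fun A f ->
    X (fun h => f (k * h)%g) = (fun h => X f (k * h)%g) }.

Inductive lie_span (R : realType) (n : nat) (G : groupTopologicalType)
    (A : set (chart G 'rV[R]_n)) (I : Type) (X : I -> vfield R G) :
    vfield R G -> Prop :=
| lie_span_gen i : lie_span A X (X i)
| lie_span_zero : lie_span A X (fun _ _ => 0)
| lie_span_lin (a : R) Y Z : lie_span A X Y -> lie_span A X Z ->
    lie_span A X (fun f h => a * Y f h + Z f h)
| lie_span_bracket Y Z : lie_span A X Y -> lie_span A X Z ->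
    lie_span A X (fun f h => Y (Z f) h - Z (Y f) h)
| lie_span_ext Y Z : (forall f, smooth_fun A f -> Y f = Z f) ->
    lie_span A X Y -> lie_span A X Z.

(* gamma s = exp (s X): the one-parameter subgroup with velocity X at 1. *)
Record is_exp (R : realType) (n : nat) (G : groupTopologicalType)
    (A : set (chart G 'rV[R]_n)) (X : vfield R G) (gamma : R -> G) : Prop :=
  IsExp {
  exp_smooth : smooth_map (@std_atlas R) A gamma ;
  exp_morph : forall s t, gamma (s + t) = (gamma s * gamma t)%g ;
  exp_velocity : forall f, smooth_fun A f ->
    derive1 (fun s => f (gamma s)) 0 = X f 1%g }.

(* The carrier is pointed, i.e. nonempty, as g_sigma_algebraType requires. *)
Definition borel (M : ptopologicalType) := g_sigma_algebraType (@open M).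

Record is_homogeneous_space (R : realType) (n m : nat)
    (G : groupTopologicalType) (AG : set (chart G 'rV[R]_n))
    (M : ptopologicalType) (AM : set (chart M 'rV[R]_m))
    (act : G -> M -> M) : Prop := IsHomogeneousSpace {
  homogeneous_manifold : is_manifold AM ;
  act_smooth : smooth_map (prod_atlas AG AM) AM (fun z => act z.1 z.2) ;
  act_one : forall x, act 1%g x = x ;
  act_mul : forall g h x, act (g * h)%g x = act h (act g x) ;
  act_transitive : forall x y, exists g, act g x = y }.

Definition invariant_measure (R : realType) (G : Type) (M : ptopologicalType)
    (act : G -> M -> M) (mu : {measure set (borel M) -> \bar R}) : Prop :=
  forall g (C : set (borel M)), measurable C -> mu (act g @^-1` C) = mu C.

Definition fundamental (R : realType) (G M : Type) (act : G -> M -> M)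
    (gamma : R -> G) (f : M -> R) (x : M) : R :=
  derive1 (fun s => f (act (gamma s) x)) 0.

Definition carre_du_champ (R : realType) (M : Type) (d : nat)
    (V : 'I_d -> (M -> R) -> (M -> R)) (f g : M -> R) (x : M) : R :=
  \sum_(i < d) V i f x * V i g x.

Section processes.
Context (R : realType) (disp : measure_display) (T : measurableType disp)
  (P : probability T R) (F : R -> set (set T)).

Record filtration : Prop := Filtration {
  filtration_sigma : forall t, 0 <= t -> sigma_algebra setT (F t) ;
  filtration_measurable : forall t, 0 <= t -> F t `<=` measurable ;
  filtration_mono : forall s t, 0 <= s -> s <= t -> F s `<=` F t }.

Definition adapted (disp' : measure_display) (S : measurableType disp')
    (Y : R -> T -> S) : Prop :=
  forall t, 0 <= t -> forall C, measurable C -> F t (Y t @^-1` C).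

Definition continuous_paths (S : topologicalType) (Y : R -> T -> S) : Prop :=
  forall w, {within `[0, +oo[, continuous (fun t => Y t w)}.

(* The increments clause says that (B^i_t - B^i_s)_i is independent of F_s with
   law N(0, (t - s) I_d); normal_prob takes the standard deviation. *)
Record brownian_motion (d : nat) (B : 'I_d -> R -> T -> R) : Prop :=
  BrownianMotion {
  brownian_adapted : forall i, adapted (B i) ;
  brownian_continuous : forall i, continuous_paths (B i) ;
  brownian_start : forall i w, B i 0 w = 0 ;
  brownian_increments : forall s t, 0 <= s -> s < t ->
    forall C, F s C -> forall D : 'I_d -> set R, (forall i, measurable (D i)) ->
    (P (C `&` \bigcap_i ((fun w => (B i t w - B i s w)%R) @^-1` D i)) =
     P C * \prod_(i < d) normal_prob 0%R (Num.sqrt (t - s)%R) (D i))%E }.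

Record martingale (Y : R -> T -> R) : Prop := Martingale {
  martingale_adapted : adapted Y ;
  martingale_integrable : forall t, 0 <= t ->
    P.-integrable setT (fun w => (Y t w)%:E) ;
  martingale_eq : forall s t, 0 <= s -> s <= t -> forall C, F s C ->
    \int[P]_(w in C) Y t w = \int[P]_(w in C) Y s w }.

(* Localizing times may be taken finite, upon replacing tau_k by min tau_k k. *)
Definition local_martingale (Y : R -> T -> R) : Prop :=
  exists tau : nat -> T -> R,
  [/\ forall k w, 0 <= tau k w <= tau k.+1 w,
      forall k t, 0 <= t -> F t [set w | tau k w <= t],
      forall w, (fun k => tau k w) @ \oo --> +oo &
      forall k, martingale (fun t w => Y (Num.min t (tau k w)) w)].

Definition continuous_semimartingale (Y : R -> T -> R) : Prop :=
  exists N A : R -> T -> R,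
  [/\ local_martingale N /\ continuous_paths N,
      adapted A /\ continuous_paths A,
      forall w, N 0 w = 0 /\ A 0 w = 0,
      forall t w, 0 <= t -> bounded_variation 0 t (fun s => A s w) &
      {ae P, forall w, forall t, 0 <= t -> Y t w = Y 0 w + N t w + A t w}].

(* The partition 0 < s_1 < ... < s_k = t is encoded by s = [:: s_1; ...; s_k],
   as in itv_partition. *)
Definition stratonovich_sum (H B : R -> T -> R) (s : seq R) (w : T) : R :=
  \sum_(k < size s)
    (H (nth 0 (0 :: s) k) w + H (nth 0 (0 :: s) k.+1) w) / 2 *
    (B (nth 0 (0 :: s) k.+1) w - B (nth 0 (0 :: s) k) w).

Definition mesh_lt (s : seq R) (delta : R) : Prop :=
  forall k, (k < size s)%N -> nth 0 (0 :: s) k.+1 - nth 0 (0 :: s) k < delta.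

(* J is the Stratonovich integral of H against B on [0, t]: the limit in
   probability of the trapezoidal sums as the mesh tends to 0. *)
Definition stratonovich_integral (H B : R -> T -> R) (t : R) (J : T -> R) :
    Prop :=
  measurable_fun setT J /\
  forall e eta : R, 0 < e -> 0 < eta -> exists2 delta : R, 0 < delta &
    forall s, itv_partition 0 t s -> mesh_lt s delta ->
      (P [set w | (e <= `|stratonovich_sum H B s w - J w|)%R] <= eta%:E)%E.

(* X solves dX = sum_i V_i(X) o dB^i on the manifold M, with X_0 = x: as usual,
   the equation is tested against all smooth functions f, each f(X) being
   required to be a semimartingale. *)
Record sde_solution (d m : nat) (M : ptopologicalType)
    (AM : set (chart M 'rV[R]_m)) (V : 'I_d -> (M -> R) -> (M -> R))
    (B : 'I_d -> R -> T -> R) (x : M) (X : R -> T -> M) : Prop :=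
  SdeSolution {
  sde_start : forall w, X 0 w = x ;
  sde_adapted : adapted (X : R -> T -> borel M) ;
  sde_continuous : continuous_paths X ;
  sde_semimartingale : forall f, smooth_fun AM f ->
    continuous_semimartingale (fun t w => f (X t w)) ;
  sde_eq : forall f, smooth_fun AM f -> forall t, 0 <= t ->
    exists2 J : 'I_d -> T -> R,
      forall i, stratonovich_integral (fun s w => V i f (X s w)) (B i) t (J i) &
      {ae P, forall w, f (X t w) = f x + \sum_(i < d) J i w} }.

Definition semigroup (M : Type) (X : M -> R -> T -> M) (t : R) (f : M -> R)
    (x : M) : R := \int[P]_w f (X x t w).

(* Smoothness is joint, on ]0, +oo[ x M x M. *)
Record heat_kernel (m : nat) (M : ptopologicalType)
    (AM : set (chart M 'rV[R]_m)) (mu : {measure set (borel M) -> \bar R})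
    (X : M -> R -> T -> M) (p : R -> M -> M -> R) : Prop := HeatKernel {
  kernel_smooth : smooth_map_on
    (prod_atlas (@std_atlas R) (prod_atlas AM AM)) (@std_atlas R)
    [set z | 0 < z.1] (fun z => p z.1 z.2.1 z.2.2) ;
  kernel_pos : forall t x y, 0 < t -> 0 < p t x y ;
  kernel_density : forall t x, 0 < t ->
    forall C : set (borel M), measurable C ->
    P (X x t @^-1` C) = (\int[mu]_(y in C) (p t x y)%:E)%E }.

End processes.

Section gibbs.
Context (R : realType) (M : ptopologicalType)
  (mu : {measure set (borel M) -> \bar R}) (U : M -> R) (eps : R).

(* The probability measure mu_eps = Z_eps^-1 exp(- U / eps^2) mu is handled
   through its density with respect to mu. *)
Definition partition_function : R := \int[mu]_x expR (- U x / eps ^+ 2).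

Definition gibbs_density (x : M) : R :=
  partition_function^-1 * expR (- U x / eps ^+ 2).

Definition gibbs_mean (f : M -> R) : R := \int[mu]_x (f x * gibbs_density x).

Definition gibbs_var (f : M -> R) : R :=
  gibbs_mean (fun x => (f x - gibbs_mean f) ^+ 2).

End gibbs.

(* Main.v *)
Require Import Defs.
From HB Require Import structures.
From mathcomp Require Import all_boot all_order all_algebra.
From mathcomp Require Import all_classical all_reals all_analysis.
From mathcomp Require Import measurable_realfun.
From mathcomp Require Import ring lra.
Import Order.TTheory GRing.Theory Num.Theory.
Import numFieldNormedType.Exports.
Set Implicit Arguments.
Unset Strict Implicit.
Unset Printing Implicit Defensive.
Local Open Scope classical_set_scope.
Local Open Scope ring_scope.

(* Since the constants r and c may depend on everything but f and t, it is enough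
   to prove a Poincare inequality var_mu(f) <= C * mu(Gamma(f, f)): the Gibbs
   weight has oscillation at most 2 sup|U| / eps(t)^2, so passing from mu to
   mu_eps costs a factor (r + t)^(1/2) when c^2 = 4 (sup|U| + 1), and a large r
   absorbs the remaining constants. The heat kernel only serves to show that mu
   is finite and nonzero.

   For g in G let N(g) be the least C such that
   ||f(x g) - f(x)||_2 <= C mu(Gamma(f, f))^(1/2) for all smooth f. By invariance
   of mu, N is subadditive and N(g^-1) = N(g); moreover N(gamma_i(s)) <= |s|.
   Call a tangent vector at 1 good if it is the velocity of a smooth curve along
   which N is bounded. Good vectors form a linear subspace, invariant under
   conjugation by curves of this kind, hence closed under brackets; by the
   generation hypothesis every vector is good, and multiplying n such curves gives a
   local submersion, so N is bounded near 1. As G is connected, N is bounded on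
   compact sets. Finally a compact subset of G moves any point of M to any other
   (Baire), and averaging over it bounds the variance of f. *)

(** * Differential calculus with directional derivatives *)

(** Boundedness of N along a curve, rather than an estimate linear in the parameter, is what
    survives brackets: a commutator of two flows at time t moves points by t^2 only, so N may be of
    order |t|^(1/2) along a direction that only a bracket reaches. Nothing is lost, since in the end
    only the boundedness of N on compact sets is used. The bracket itself appears as the derivative
    at 0 of the velocities of conjugated curves, and it stays good because a linear subspace of a
    finite-dimensional space is closed.

    The averaging has to turn a bound on ||f(x g) - f(x)||_2 with g fixed into a bound on the
    variance, which involves pairs (x, z) joined by an element h that depends on both. A
    left-invariant average over h g, with g in a compact neighbourhood of 1, would make this
    dependence disappear. It is replaced by sums over finite covers by small translates, invariant
    up to a constant that does not depend on the size of the translates; this leaves the oscillation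
    of f on a translate free to tend to 0. *)

(* Finite dimensionality, as a choice of coordinates. *)
Record frame (R : realType) (E : normedModType R) := Frame {
  frame_dim : nat ;
  frame_vec : 'I_frame_dim -> E ;
  frame_coord : 'I_frame_dim -> {linear E -> R^o} ;
  frame_coord_continuous : forall i, continuous (frame_coord i) ;
  frame_sum : forall u, u = \sum_i frame_coord i u *: frame_vec i }.

Arguments frame_vec {R E}.
Arguments frame_coord {R E}.
Arguments frame_coord_continuous {R E}.

Section mean_value.
Context {R : realType} {E F : normedModType R}.

Lemma line_quotient (f : E -> F) (e p : E) (t : R) :
  (fun h : R => h^-1 *: (f ((h *: 1 + t) *: e + p) - f (t *: e + p))) =
  (fun h : R => h^-1 *: (f (h *: e + (t *: e + p)) - f (t *: e + p))).
Proof.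
apply/funext => h; rewrite (_ : h *: 1 = h); last exact: mulr1.
by rewrite scalerDl addrA.
Qed.

Lemma is_derive_line (f : E -> F) (e p : E) (t : R) :
  derivable f (t *: e + p) e ->
  is_derive t 1 (fun s => f (s *: e + p)) ('D_e f (t *: e + p)).
Proof.
move=> df; apply: DeriveDef; first by rewrite /derivable line_quotient.
by rewrite /derive line_quotient.
Qed.

Lemma is_derive_along (f : E -> F) (e p : E) :
  derivable f p e -> is_derive (0 : R) 1 (fun s => f (s *: e + p)) ('D_e f p).
Proof.
move=> df; have := @is_derive_line f e p 0; rewrite scale0r add0r; exact.
Qed.

Lemma line_derivable (f : E -> F) (e p : E) :
  derivable (fun s : R => f (s *: e + p)) 0 1 -> derivable f p e.
Proof.
by rewrite /derivable line_quotient scale0r add0r.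
Qed.

Lemma derive_along (f : E -> F) (e p : E) :
  'D_1 (fun s : R => f (s *: e + p)) 0 = 'D_e f p.
Proof. by rewrite /derive line_quotient scale0r add0r. Qed.

End mean_value.

Section strict.
Context {R : realType} {E : normedModType R}.

(** The mean value theorem for [fun s => f (s *: e + p)] between 0 and [a]; [L] is a candidate
    derivative whose error is at most [eps] along the segment. The sign of [a] decides the
    orientation of the segment. *)
Lemma line_mean_value (f : E -> R) (e p : E) (a L eps : R) :
  (forall t, `|t| <= `|a| -> derivable f (t *: e + p) e /\
     `|'D_e f (t *: e + p) - L| <= eps) ->
  `|f (a *: e + p) - f p - a * L| <= eps * `|a|.
Proof.
move=> H; pose g (s : R) := f (s *: e + p).
have dg t : `|t| <= `|a| -> is_derive t (1 : R) g ('D_e f (t *: e + p)).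
  by move=> /H[df _]; exact: is_derive_line.
have cg t : `|t| <= `|a| -> {for t, continuous g}.
  by move=> /dg[dgt _]; apply: differentiable_continuous; apply/derivable1_diffP.
have cont (u v : R) : (forall t, u <= t <= v -> `|t| <= `|a|) ->
    {within `[u, v], continuous g}.
  move=> uv; apply: continuous_in_subspaceT => x /[!inE] /=; rewrite in_itv /=.
  by move=> /uv/cg.
have [a0|a0] := leP 0 a.
  have le t : 0 <= t <= a -> `|t| <= `|a| by case/andP => ? ?; rewrite !ger0_norm.
  have [c] := @MVT_segment R g (fun t => 'D_e f (t *: e + p)) 0 a a0
    (fun x xa => dg x (le x (subset_itv_oo_cc xa))) (cont _ _ le).
  rewrite in_itv /= => /le/H[_ Hc]; rewrite subr0 {1 2}/g scale0r add0r => ->.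
  by rewrite mulrC -mulrBr normrM mulrC ler_wpM2r.
have le t : a <= t <= 0 -> `|t| <= `|a|.
  by case/andP => ? ?; rewrite !ler0_norm ?lerN2 ?(ltW a0).
have [c] := @MVT_segment R g (fun t => 'D_e f (t *: e + p)) a 0 (ltW a0)
    (fun x xa => dg x (le x (subset_itv_oo_cc xa))) (cont _ _ le).
rewrite in_itv /= => /le/H[_ Hc]; rewrite sub0r {1 2}/g scale0r add0r.
move=> /(congr1 -%R); rewrite opprB => ->.
by rewrite mulrN opprK mulrC -mulrBr normrM mulrC ler_wpM2r.
Qed.

Lemma frame_bound (b : frame E) : exists2 C : R, 0 < C &
  forall i u, `|frame_coord b i u| <= C * `|u| /\ `|frame_vec b i| <= C.
Proof.
have cC i : exists2 c : R, 0 < c & (forall u, `|frame_coord b i u| <= c * `|u|).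
  exact: linear_lipschitz (frame_coord_continuous b i).
pose c i := sval (cid2 (cC i)).
have c0 i : 0 < c i by rewrite /c; case: cid2.
have cP i u : `|frame_coord b i u| <= c i * `|u| by rewrite /c; case: cid2.
exists (1 + \sum_i (c i + `|frame_vec b i|)).
  by rewrite ltr_wpDr // sumr_ge0 // => i _; rewrite addr_ge0 // ltW.
have le i : c i + `|frame_vec b i| <= 1 + \sum_i (c i + `|frame_vec b i|).
  rewrite (bigD1 i) //= addrCA ler_wpDr // addr_ge0 // sumr_ge0 // => j _.
  by rewrite addr_ge0 // ltW.
move=> i u; split.
  apply: le_trans (cP i u) _; rewrite ler_wpM2r //.
  by apply: le_trans (le i); rewrite lerDl.
by apply: le_trans (le i); rewrite lerDr ltW.
Qed.

(** The segment from [y] to [x] is replaced by a path along the frame vectors, one coordinate at a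
    time, and [line_mean_value] controls each leg. Both end points move near [u]: the contraction
    argument, the mixed differences and the Lipschitz bounds rely on this two-point form. *)
Lemma strict_differentiability (b : frame E) (U : set E) (f : E -> R) (u : E) :
  nbhs u U ->
  (forall x, U x -> forall i, derivable f x (frame_vec b i)) ->
  (forall i, {for u, continuous ('D_(frame_vec b i) f)}) ->
  forall eps, 0 < eps -> exists2 d : R, 0 < d &
    forall x y, `|x - u| < d -> `|y - u| < d ->
    `|f x - f y - \sum_i frame_coord b i (x - y) * 'D_(frame_vec b i) f u|
      <= eps * `|x - y|.
Proof.
move=> nU df cf eps e0.
have [C C0 CP] := frame_bound b; set N := frame_dim b in CP *.
(* Each of the [N] legs costs at most eps' C |h|; the [+ 1] keeps the denominator positive when
   [N = 0]. *)
pose eps' := eps / (N%:R * C + 1).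
have N0 : 0 < N%:R * C + 1 by rewrite ltr_wpDl // mulr_ge0 // ltW.
have e'0 : 0 < eps' by rewrite divr_gt0.
have : \forall x \near u, U x /\ forall i : 'I_N, `|'D_(frame_vec b i) f x - 'D_(frame_vec b i) f u| <= eps'.
  near=> x; split; first by near: x.
  near: x; apply: filter_forall => i.
  by have /cvgrPdistC_le := cf i; exact.
move=> /nbhs_normP[/= r r0 rP].
(* Every point of the path stays within (K - 1)|h| of [y], and |h| < 2r/(3K), so its distance to [u]
   is less than r/(3K) + 2r/3 - 2r/(3K) < r. *)
pose K := 1 + N%:R * (C * C).
have K1 : 1 <= K by rewrite lerDl !mulr_ge0 // ltW.
have K0 : 0 < K by exact: lt_le_trans K1.
exists (r / (3 * K)); first by rewrite divr_gt0 ?mulr_gt0.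
move=> x y xu yu; set h := x - y.
have hn : `|h| < 2 * (r / (3 * K)).
  have -> : h = (x - u) - (y - u) by rewrite opprB addrA subrK.
  by rewrite (le_lt_trans (ler_normB _ _)) // mulr_natl mulr2n ltrD.
pose s k := \sum_(i < N | (i < k)%N) frame_coord b i h *: frame_vec b i.
have sn (t : R) (i : 'I_N) : `|t| <= `|frame_coord b i h| ->
    `|t *: frame_vec b i + (s i + y) - u| < r.
  move=> ti.
  have : `|t *: frame_vec b i + s i| <= N%:R * (C * C) * `|h|.
    apply: le_trans (_ : \sum_(j < N) (C * C) * `|h| <= _); last first.
      by rewrite sumr_const card_ord -[X in X <= _]mulr_natl [X in X <= _]mulrA.
    rewrite (bigD1 i) //= (le_trans (ler_normD _ _)) // lerD //.
      rewrite normrZ [C * C]mulrC -mulrA mulrC ler_pM //.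
        by have [_ ->] := CP i 0.
      by apply: le_trans ti _; have [] := CP i h.
    rewrite /s [X in _ <= X](bigID (fun j : 'I_N => (j < i)%N)) /=.
    apply: ler_wpDr; first by apply: sumr_ge0 => j _; rewrite !mulr_ge0 // ltW.
    rewrite (le_trans (ler_norm_sum _ _ _)) //.
    rewrite [X in _ <= X](eq_bigl (fun j : 'I_N => (j < i)%N)); last first.
      by move=> j; rewrite -val_eqE /= neq_ltn; case: (j < i)%N; rewrite ?andbF ?andbT.
    apply: ler_sum => j _; rewrite normrZ [C * C]mulrC -mulrA mulrC ler_pM //.
      by have [_ ->] := CP j 0.
    by have [] := CP j h.
  rewrite addrA -[_ + y - u]addrA => le; rewrite (le_lt_trans (ler_normD _ _)) //.
  have le2 : N%:R * (C * C) * `|h| <= (K - 1) * (2 * (r / (3 * K))).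
    by rewrite /K addrC addKr ler_wpM2l ?mulr_ge0 // ltW.
  have e2 : (K - 1) * (2 * (r / (3 * K))) = r * (2 / 3) - 2 * (r / (3 * K)).
    by field; rewrite gt_eqF.
  have p0 : 0 < r / (3 * K) by rewrite divr_gt0 ?mulr_gt0.
  have r0' := r0.
  rewrite e2 in le2; have := le_trans le le2; move: yu p0 r0'.
  by move: (r / (3 * K)) `|y - u| `|_ + _| => A B D; lra.
have step (i : 'I_N) : `|f (s i.+1 + y) - f (s i + y) -
    frame_coord b i h * 'D_(frame_vec b i) f u| <= eps' * (C * `|h|).
  have -> : s i.+1 + y = frame_coord b i h *: frame_vec b i + (s i + y).
    rewrite addrA; congr (_ + _); rewrite {1}/s (bigD1 i) ?leqnn //=; congr (_ + _).
    apply: eq_bigl => j; rewrite ltnS -val_eqE /=.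
    by case: ltngtP => //= ->.
  apply: le_trans (line_mean_value (eps := eps') _) _ => [t ti|].
    have [|Ux ex] := rP (t *: frame_vec b i + (s i + y)).
      by rewrite /ball_ /= distrC sn.
    by split; [exact: df|exact: ex].
  by rewrite (ler_wpM2l (ltW e'0)) //; have [] := CP i h.
have -> : f x - f y = \sum_(i < N) (f (s i.+1 + y) - f (s i + y)).
  rewrite -(big_mkord xpredT (fun k => f (s k.+1 + y) - f (s k + y))) telescope_sumr //.
  have -> : s 0%N = 0 by rewrite /s big_pred0.
  have -> : s N = h.
    by rewrite [RHS](frame_sum b) /s; apply: eq_bigl => j; rewrite ltn_ord.
  by rewrite add0r subrK.
rewrite -sumrB (le_trans (ler_norm_sum _ _ _)) //.
apply: le_trans (_ : \sum_(i < N) eps' * (C * `|h|) <= _).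
  by apply: ler_sum => i _; exact: step.
rewrite sumr_const card_ord -[X in X <= _]mulr_natl.
have -> : N%:R * (eps' * (C * `|h|)) = (N%:R * C) / (N%:R * C + 1) * (eps * `|h|).
  by rewrite /eps'; field; rewrite gt_eqF.
rewrite ler_piMl ?mulr_ge0 ?(ltW e0) //.
by rewrite ler_pdivrMr // mul1r lerDl.
Unshelve. all: by end_near. Qed.

End strict.

(** * Calculus of maps of class C^k *)

Section Ck.
Context {R : realType}.
Implicit Types E F H : normedModType R.

Lemma Ck_onS E F k (U : set E) (f : E -> F) : Ck_on k.+1 U f -> Ck_on k U f.
Proof.
elim: k f => [|k IH] f [cf df]; first by split.
by split=> // v; have [dv /IH] := df v.
Qed.

Lemma Ck_on_le E F j k (U : set E) (f : E -> F) :
  (j <= k)%N -> Ck_on k U f -> Ck_on j U f.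
Proof.
move=> /subnKC <-; elim: (k - j)%N => [|i IH]; first by rewrite addn0.
by rewrite addnS => /Ck_onS.
Qed.

Lemma Ck_on_sub E F k (U V : set E) (f : E -> F) :
  V `<=` U -> Ck_on k U f -> Ck_on k V f.
Proof.
move=> VU; elim: k f => [|k IH] f [cf df]; (split; first by move=> u /VU/cf) => // v.
by have [dv /IH] := df v; split => // u /VU; exact: dv.
Qed.

(** The sets [V] need not be neighbourhoods: derivatives are taken in the whole of [E], so [Ck_on]
    is a condition at each point separately. *)
Lemma Ck_on_cover E F k (U : set E) (f : E -> F) :
  (forall u, U u -> exists2 V, V u & Ck_on k V f) -> Ck_on k U f.
Proof.
elim: k f => [|k IH] f H; split => //.
- by move=> u /H[V Vu [cf _]]; exact: cf.
- by move=> u /H[V Vu [cf _]]; exact: cf.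
- move=> v; split; first by move=> u /H[V Vu [_ /(_ v)[dv _]]]; exact: dv.
  by apply: IH => u /H[V Vu [_ /(_ v)[_ dv]]]; exists V.
Qed.

Lemma Ck_on_eq E F k (U : set E) (f g : E -> F) :
  open U -> (forall u, U u -> f u = g u) -> Ck_on k U f -> Ck_on k U g.
Proof.
move=> oU; have nU u : U u -> nbhs u U by move=> Uu; exact: open_nbhs_nbhs.
have nfg (f' g' : E -> F) u : (forall u, U u -> f' u = g' u) -> U u -> {near u, f' =1 g'}.
  by move=> fg' Uu; near=> x; apply: fg'; near: x; exact: nU.
have cfg (f' g' : E -> F) : (forall u, U u -> f' u = g' u) ->
    (forall u, U u -> {for u, continuous f'}) -> forall u, U u -> {for u, continuous g'}.
  move=> fg' cf u Uu; have := cf u Uu; rewrite /prop_for /continuous_at (fg' u Uu).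
  by apply: cvg_trans; apply: near_eq_cvg; apply: nfg Uu => x Ux; rewrite fg'.
elim: k f g => [|k IH] f g fg [cf df]; (split; first exact: cfg fg cf) => //.
move=> v; have [dv ddv] := df v; split.
  by move=> u Uu; apply: near_eq_derivable (dv u Uu); exact: nfg fg Uu.
by apply: IH ddv => u Uu; apply: near_eq_derive; exact: nfg fg Uu.
Unshelve. all: by end_near. Qed.

Lemma Ck_on_cst E F k (U : set E) (a : F) : Ck_on k U (fun=> a).
Proof.
elim: k a => [|k IH] a; (split; first by move=> u _; exact: cst_continuous) => // v.
split; first by move=> u _; exact: derivable_cst.
have -> : 'D_v (fun=> a) = (fun=> 0) :> (E -> F); last exact: IH.
by apply/funext => u; exact: derive_cst.
Qed.

Lemma is_derive_linear_comp E F H (g : E -> F) (L : {linear F -> H}) u v :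
  continuous L -> derivable g u v ->
  is_derive u v (L \o g) (L ('D_v g u)).
Proof.
move=> cL dg; pose q (h : R) := h^-1 *: ((g \o shift u) (h *: v) - g u).
have Lq : (fun h : R => h^-1 *: (((L \o g) \o shift u) (h *: v) - (L \o g) u)) = L \o q.
  by apply/funext => h /=; rewrite /q linearZ /= (linearB L).
have ql : q h @[h --> 0^'] --> 'D_v g u by exact: dg.
have : (L \o q) h @[h --> 0^'] --> L ('D_v g u).
  exact: cvg_comp ql (cL _).
move=> cLq; apply: DeriveDef.
  by rewrite /derivable Lq; apply/cvg_ex; exists (L ('D_v g u)).
by rewrite /derive Lq; exact: cvg_lim cLq.
Qed.

Lemma Ck_on_linear_comp E F H k (U : set E) (g : E -> F) (L : {linear F -> H}) :
  open U -> continuous L -> Ck_on k U g -> Ck_on k U (L \o g).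
Proof.
move=> oU cL; elim: k g => [|k IH] g [cg dg]; split => //.
- by move=> u /cg cgu; apply: continuous_comp => //; exact: cL.
- by move=> u /cg cgu; apply: continuous_comp => //; exact: cL.
- move=> v; have [dv ddv] := dg v; split.
    by move=> u Uu; have [] := is_derive_linear_comp cL (dv u Uu).
  apply: Ck_on_eq (IH _ ddv) => // u Uu.
  by have [_ ->] := is_derive_linear_comp cL (dv u Uu).
Qed.

Lemma Ck_on_id E k (U : set E) : Ck_on k U id.
Proof.
case: k => [|k]; (split; first by move=> u _; exact: cvg_id) => // v; split; first by move=> u _; exact: derivable_id.
have -> : 'D_v id = (fun=> v) :> (E -> E); last exact: Ck_on_cst.
by apply/funext => u; exact: derive_id.
Qed.

Lemma Ck_on_linear E F k (L : {linear E -> F}) :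
  continuous L -> Ck_on k setT L.
Proof.
move=> cL; have : Ck_on k setT (L \o id).
  by apply: Ck_on_linear_comp => //; [exact: openT|exact: Ck_on_id].
by [].
Qed.

Lemma Ck_on_add E F k (U : set E) (f g : E -> F) : open U ->
  Ck_on k U f -> Ck_on k U g -> Ck_on k U (fun u => f u + g u).
Proof.
move=> oU; elim: k f g => [|k IH] f g [cf df] [cg dg]; split => //.
- by move=> u Uu; apply: continuousD; [exact: cf|exact: cg].
- by move=> u Uu; apply: continuousD; [exact: cf|exact: cg].
- move=> v; have [dvf ddf] := df v; have [dvg ddg] := dg v; split.
    by move=> u Uu; apply: derivableD; [exact: dvf|exact: dvg].
  apply: Ck_on_eq (IH _ _ ddf ddg) => // u Uu.
  by rewrite -deriveD //; [exact: dvf|exact: dvg].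
Qed.

Lemma Ck_on_sum E F k (U : set E) n (f : 'I_n -> E -> F) : open U ->
  (forall i, Ck_on k U (f i)) -> Ck_on k U (fun u => \sum_i f i u).
Proof.
move=> oU; elim: n f => [|n IH] f H.
  apply: Ck_on_eq (Ck_on_cst k U 0) => // u _; by rewrite big_ord0.
apply: Ck_on_eq (Ck_on_add oU (IH _ (fun i => H (lift ord0 i))) (H ord0)) => // u _.
by rewrite big_ord_recl addrC.
Qed.

Lemma Ck_on_mul E k (U : set E) (f g : E -> R) : open U ->
  Ck_on k U f -> Ck_on k U g -> Ck_on k U (fun u => f u * g u).
Proof.
move=> oU; elim: k f g => [|k IH] f g; move=> Cf Cg; have [cf df] := Cf; have [cg dg] := Cg; split => //.
- by move=> u Uu; apply: continuousM; [exact: cf|exact: cg].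
- by move=> u Uu; apply: continuousM; [exact: cf|exact: cg].
- move=> v; have [dvf ddf] := df v; have [dvg ddg] := dg v; split.
    by move=> u Uu; apply: derivableM; [exact: dvf|exact: dvg].
  have Cf' := Ck_onS Cf; have Cg' := Ck_onS Cg.
  apply: Ck_on_eq (Ck_on_add oU (IH _ _ Cf' ddg) (IH _ _ Cg' ddf)) => // u Uu.
  by rewrite -[_ + _]/(f u *: 'D_v g u + g u *: 'D_v f u) -deriveM //; [exact: dvf|exact: dvg].
Qed.

Lemma scalel_packed F (e : F) : exists2 L : {linear R^o -> F},
  continuous L & forall r, L r = r *: e.
Proof.
have sx_lin : linear ( *:%R ^~ e : R^o -> _).
  by move=> u y z; rewrite scalerDl scalerA.
pose sxlM := GRing.isLinear.Build _ _ _ _ _ sx_lin.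
pose sxL : {linear _ -> _} := HB.pack ( *:%R ^~ e) sxlM.
by exists sxL => //; exact: scalel_continuous.
Qed.

Lemma Ck_on_coord E F (b : frame F) k (U : set E) (g : E -> F) : open U ->
  Ck_on k U g <-> forall i, Ck_on k U (fun u => frame_coord b i (g u)).
Proof.
move=> oU; split=> H.
  by move=> i; exact: (Ck_on_linear_comp oU (frame_coord_continuous b i) H).
have : Ck_on k U (fun u => \sum_i frame_coord b i (g u) *: frame_vec b i).
  apply: Ck_on_sum => // i; have [L cL LE] := scalel_packed (frame_vec b i).
  by apply: Ck_on_eq (Ck_on_linear_comp oU cL (H i)) => // u _ /=; rewrite LE.
by apply: Ck_on_eq => // u _; rewrite -frame_sum.
Qed.

End Ck.

(** Matrices as a complete space, for the fixed point theorem behind [local_surjectivity] and the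
    Baire theorem behind [baire_manifold]. *)
HB.instance Definition _ (R : realType) (m n : nat) :=
  Uniform_isComplete.Build 'M[R]_(m, n) cauchy_cvg.

Section C1.
Context {R : realType}.
Implicit Types E F H : normedModType R.

Lemma frame_linear E (b : frame E) (c : 'I_(frame_dim b) -> R) :
  exists2 L : {linear E -> R^o}, continuous L &
    forall v, L v = \sum_i frame_coord b i v * c i.
Proof.
pose L0 v : R^o := \sum_i frame_coord b i v * c i.
have lin : linear L0.
  move=> a x y; rewrite /L0 scaler_sumr -big_split /=; apply: eq_bigr => i _.
  by rewrite linearP mulrDl -scalerAl.
pose L : {linear E -> R^o} := HB.pack L0 (GRing.isLinear.Build _ _ _ _ _ lin).
exists L => // v.
have [c0 _] : Ck_on 0 setT (fun v : E => \sum_i frame_coord b i v * c i).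
  apply: Ck_on_sum => [|i]; first exact: openT.
  apply: Ck_on_mul; [exact: openT| |exact: Ck_on_cst].
  exact: Ck_on_linear (frame_coord_continuous b i).
exact: c0.
Qed.

Lemma C1_strict E (b : frame E) (U : set E) (f : E -> R) (u : E) :
  open U -> U u -> Ck_on 1 U f -> forall eps, 0 < eps ->
  exists2 d : R, 0 < d &
    forall x y, `|x - u| < d -> `|y - u| < d ->
    `|f x - f y - \sum_i frame_coord b i (x - y) * 'D_(frame_vec b i) f u|
      <= eps * `|x - y|.
Proof.
move=> oU Uu [_ C1]; apply: (strict_differentiability (U := U)).
- exact: open_nbhs_nbhs.
- by move=> x Ux i; have [d _] := C1 (frame_vec b i); exact: d.
- by move=> i; have [_ [c _]] := C1 (frame_vec b i); exact: c.
Qed.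

(** [C1_strict] with one end point fixed at [u] says that the linear form built from the partial
    derivatives is a differential. This turns directional information into [differentiable], hence
    gives a chain rule. *)
Lemma C1_differentiable E (b : frame E) (U : set E) (f : E -> R) (u : E) :
  open U -> U u -> Ck_on 1 U f -> differentiable f u /\
  forall v, 'D_v f u = \sum_i frame_coord b i v * 'D_(frame_vec b i) f u.
Proof.
move=> oU Uu Cf; have st := C1_strict b oU Uu Cf.
have [L cL LE] := frame_linear (fun i => 'D_(frame_vec b i) f u).
have eqn : f \o shift u = cst (f u) + L +o_ 0 id.
  apply/eqaddoP => eps e0; have [d d0 dP] := st eps e0.
  near=> x; have := dP (x + u) u; rewrite subrr normr0 addrK -LE.
  rewrite -[(_ - (_ + _)) _]/(f (x + u) - (f u + L x)) opprD addrA; apply => //.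
have dE := diff_unique cL eqn.
have df : differentiable f u by apply/diff_locallyP; rewrite dE.
by split => // v; rewrite deriveE // dE LE.
Unshelve. all: by end_near. Qed.

(** On the line through [u] in the direction [v] the map [g] depends on one real variable, for which
    derivable and differentiable agree; so [g] is only required to be derivable along [v]. *)
Lemma is_derive_comp E F H (f : F -> H) (g : E -> F) u v :
  differentiable f (g u) -> derivable g u v ->
  is_derive u v (f \o g) ('d f (g u) ('D_v g u)).
Proof.
move=> df dg; have [dl DE] := is_derive_along dg.
have dl' : differentiable (fun s : R => g (s *: v + u)) 0 by apply/derivable1_diffP.
have df' : differentiable f ((fun s : R => g (s *: v + u)) 0) by rewrite scale0r add0r.
have dc := differentiable_comp dl' df'.
have dd : derivable (f \o g) u v.
  by apply: line_derivable; apply/derivable1_diffP; exact: dc.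
apply: DeriveDef => //; rewrite -derive_along deriveE //.
have -> : (fun s : R => (f \o g) (s *: v + u)) = f \o (fun s : R => g (s *: v + u)) by [].
by rewrite -DE (deriveE _ dl') diff_comp //= scale0r add0r.
Qed.

Lemma derive_comp_frame E F (b : frame F) (U : set F) (f : F -> R) (g : E -> F) u v :
  open U -> U (g u) -> Ck_on 1 U f -> derivable g u v ->
  is_derive u v (f \o g)
    (\sum_i frame_coord b i ('D_v g u) * 'D_(frame_vec b i) f (g u)).
Proof.
move=> oU Ugu Cf dg; have [df Df] := C1_differentiable b oU Ugu Cf.
have [d DE] := is_derive_comp df dg; apply: DeriveDef => //.
by rewrite DE -deriveE // Df.
Qed.

Lemma Ck_on_comp_real E F (b : frame F) k (U : set E) (V : set F)
    (f : F -> R) (g : E -> F) : open U -> open V ->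
  (forall u, U u -> V (g u)) -> Ck_on k V f -> Ck_on k U g -> Ck_on k U (f \o g).
Proof.
move=> oU oV UV; elim: k f => [|k IH] f Cf Cg.
  split => // u Uu; apply: continuous_comp; first by case: Cg => c _; exact: c.
  by case: Cf => c _; apply: c; exact: UV.
have C1f : Ck_on 1 V f by exact: Ck_on_le Cf.
split.
  move=> u Uu; apply: continuous_comp; first by case: Cg => c _; exact: c.
  by case: Cf => c _; apply: c; exact: UV.
move=> v; have Dfg u : U u -> is_derive u v (f \o g) _ := fun Uu =>
  derive_comp_frame b oV (UV _ Uu) C1f ((Cg.2 v).1 u Uu).
split; first by move=> u /Dfg[].
pose S u := \sum_i frame_coord b i ('D_v g u) * ('D_(frame_vec b i) f \o g) u.
have CS : Ck_on k U S.
  apply: Ck_on_sum => // i; apply: Ck_on_mul => //.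
    exact: (Ck_on_linear_comp oU (frame_coord_continuous b i) (Cg.2 v).2).
  by apply: IH; [exact: (Cf.2 _).2|exact: Ck_onS].
by apply: Ck_on_eq CS => // u /Dfg[_ ->].
Qed.

Lemma Ck_on_comp E F H (b : frame F) (c : frame H) k (U : set E) (V : set F)
    (f : F -> H) (g : E -> F) : open U -> open V ->
  (forall u, U u -> V (g u)) -> Ck_on k V f -> Ck_on k U g -> Ck_on k U (f \o g).
Proof.
move=> oU oV UV Cf Cg; have [_] := Ck_on_coord c k (f \o g) oU; apply => i.
have [/(_ Cf i) Cfi _] := Ck_on_coord c k f oV.
exact: (Ck_on_comp_real b oU oV UV Cfi Cg).
Qed.

Lemma is_derive_translate E F (f : E -> F) c x w :
  derivable f (x + c) w -> is_derive x w (fun y => f (y + c)) ('D_w f (x + c)).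
Proof.
have q : (fun h : R => h^-1 *: (((fun y => f (y + c)) \o shift x) (h *: w) - f (x + c))) =
    (fun h : R => h^-1 *: ((f \o shift (x + c)) (h *: w) - f (x + c))).
  by apply/funext => h /=; rewrite addrA.
by move=> df; apply: DeriveDef; [rewrite /derivable q|rewrite /derive q].
Qed.

End C1.

(** * Symmetry of second derivatives *)

Section second_order.
Context {R : realType}.
Implicit Types E F H : normedModType R.

(** The second difference is the increment of [G x = f (x + t *: v) - f x] along [t *: w]. The
    derivative of [G] along [w] is a difference of ['D_w f], which strict differentiability at [u]
    compares with [t * 'D_v ('D_w f) u] on the whole segment. *)
Lemma mixed_difference E (b : frame E) (U : set E) (f : E -> R) u v w :
  open U -> U u -> Ck_on 2 U f -> forall eps, 0 < eps ->
  exists2 d : R, 0 < d & forall t, 0 < t -> t < d ->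
   `|f (t *: w + u + t *: v) - f (t *: w + u) - (f (u + t *: v) - f u) -
     t * (t * 'D_v ('D_w f) u)| <= eps * t ^+ 2.
Proof.
move=> oU Uu Cf eps e0.
have nv : 0 < `|v| + 1 by rewrite ltr_wpDl.
have [d d0 dP] := C1_strict b oU Uu (Cf.2 w).2 (divr_gt0 e0 nv).
have [_ DL] := C1_differentiable b oU Uu (Cf.2 w).2.
have /nbhs_normP[r /= r0 rU] : nbhs u U by exact: open_nbhs_nbhs.
pose N := `|v| + `|w| + 1; have N0 : 0 < N by rewrite ltr_wpDl ?addr_ge0.
exists (Num.min d r / N) => [|t t0]; first by rewrite divr_gt0 // lt_min d0.
rewrite ltr_pdivlMr // lt_min => /andP[tN tN'].
(* The flag [y] tells whether the shift [t *: v] is present, so that both ends of the difference are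
   treated at once. *)
have small s (y : bool) : `|s| <= t -> `|s *: w + u + (if y then t else 0) *: v - u| < Num.min d r.
  move=> st; rewrite addrAC addrK.
  apply: le_lt_trans (_ : t * N < _); last by rewrite lt_min tN.
  rewrite (le_trans (ler_normD _ _)) // !normrZ /N !mulrDr mulr1.
  have le1 : `|s| * `|w| <= t * `|w| by rewrite ler_wpM2r.
  have le2 : `|if y then t else 0| * `|v| <= t * `|v|.
    by rewrite ler_wpM2r //; case: (y); rewrite ?normr0 ?(gtr0_norm t0) ?(ltW t0).
  by apply: le_trans (lerD le1 le2) _; rewrite addrC lerDl ltW.
have smallU s y : `|s| <= t -> U (s *: w + u + (if y then t else 0) *: v).
  by move=> /(small s y) lt; apply: rU; rewrite /ball_ /= distrC (lt_le_trans lt) // ge_min lexx orbT.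
pose G x := f (x + t *: v) - f x.
have dG s : `|s| <= t -> is_derive (s *: w + u) w G
    ('D_w f (s *: w + u + t *: v) - 'D_w f (s *: w + u)).
  move=> st; have U1 := smallU s true st; have := smallU s false st.
  rewrite scale0r addr0 => U0; apply: is_deriveB.
    by apply: is_derive_translate; exact: (Cf.2 w).1.
  by apply: derivableP; exact: (Cf.2 w).1.
have -> : eps * t ^+ 2 = eps * t * `|t| by rewrite gtr0_norm // expr2 mulrA.
apply: (@line_mean_value R E G w u t (t * 'D_v ('D_w f) u) (eps * t)) => s.
rewrite (gtr0_norm t0) => st.
have [dGs ->] := dG s st; split => //.
have := dP (s *: w + u + t *: v) (s *: w + u).
have -> : s *: w + u + t *: v - (s *: w + u) = t *: v by rewrite addrC addKr.
rewrite -DL => H; apply: le_trans (_ : eps / (`|v| + 1) * `|t *: v| <= _).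
  have -> : t * 'D_v ('D_w f) u = 'D_(t *: v) ('D_w f) u.
    by rewrite !DL mulr_sumr; apply: eq_bigr => i _; rewrite linearZ mulrA.
  apply: H.
    by rewrite (lt_le_trans (small s true st)) // ge_min lexx.
  by have := small s false st; rewrite scale0r addr0 lt_min => /andP[].
rewrite normrZ (gtr0_norm t0).
have -> : eps / (`|v| + 1) * (t * `|v|) = eps * t * (`|v| / (`|v| + 1)).
  by field; rewrite gt_eqF.
rewrite ler_piMr ?mulr_ge0 ?(ltW e0) ?(ltW t0) //.
by rewrite ler_pdivrMr // mul1r lerDl.
Qed.

(** The second difference is symmetric in [v] and [w], and [mixed_difference] compares it, divided
    by [t ^+ 2], with each of the two mixed derivatives. *)
Lemma schwarz E (b : frame E) (U : set E) (f : E -> R) u v w :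
  open U -> U u -> Ck_on 2 U f -> 'D_v ('D_w f) u = 'D_w ('D_v f) u.
Proof.
move=> oU Uu Cf; apply/eqP; rewrite -subr_eq0 -normr_le0; apply/ler_addgt0Pl => e e0.
rewrite addr0; have e20 : 0 < e / 2 by rewrite divr_gt0.
have [d1 d10 H1] := mixed_difference b v w oU Uu Cf e20.
have [d2 d20 H2] := mixed_difference b w v oU Uu Cf e20.
have [t t0] : exists2 t, 0 < t & t < Num.min d1 d2.
  exists (Num.min d1 d2 / 2); first by rewrite divr_gt0 // lt_min d10.
  by rewrite ltr_pdivrMr // ltr_pMr ?lt_min ?d10 // ltr1n.
rewrite lt_min => /andP[/(H1 t t0) {}H1 /(H2 t t0) {}H2].
have c1 : t *: w + u + t *: v = t *: v + u + t *: w by rewrite addrAC -[RHS]addrA [t *: w + _]addrC addrAC -addrA.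
move: H1 H2; rewrite c1 ![u + _]addrC => H1 H2.
have t20 : 0 < t ^+ 2 by rewrite exprn_gt0.
rewrite -(ler_pM2l t20) -[X in X * `|_|](gtr0_norm t20) -normrM.
move: H1 H2; move: ('D_v ('D_w f) u) ('D_w ('D_v f) u) => p q.
move: (f (t *: v + u + _)) (f (t *: w + u)) (f (t *: v + u)) (f u) => a1 a2 a3 a4.
have -> : t ^+ 2 * (p - q) = t * (t * p) - t * (t * q) by ring.
have -> : t ^+ 2 * e = e / 2 * t ^+ 2 + e / 2 * t ^+ 2 by field.
move: (t * (t * p)) (t * (t * q)) (e / 2 * t ^+ 2) => a5 a6 a7.
rewrite !ler_norml => /andP[l1 l2] /andP[l3 l4].
by apply/andP; split; lra.
Qed.

End second_order.

(** * Frames of row vectors, of the real line and of products *)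

Section frames.
Context {R : realType}.

Lemma pack_linear (E : normedModType R) (f : E -> R) :
  linear_for *%R f -> continuous f ->
  exists2 L : {linear E -> R^o}, continuous L & forall u, L u = f u.
Proof.
move=> lf cf; pose f' : E -> R^o := f.
have lf' : linear f' by [].
pose L : {linear E -> R^o} := HB.pack f' (GRing.isLinear.Build _ _ _ _ _ lf').
by exists L.
Qed.

(** The dimension is a field of [frame]; the equality [en] lets later computations read vectors and
    coordinates with indices in ['I_n]. *)
Lemma make_frame (E : normedModType R) (n : nat) (e : 'I_n -> E) (c : 'I_n -> E -> R) :
  (forall i, linear_for *%R (c i)) -> (forall i, continuous (c i)) ->
  (forall u, u = \sum_i c i u *: e i) ->
  {b : frame E | exists en : frame_dim b = n,
     (forall i, frame_vec b i = e (cast_ord en i)) /\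
     (forall i u, frame_coord b i u = c (cast_ord en i) u)}.
Proof.
move=> lc cc sc; pose L i := sval (cid2 (pack_linear (lc i) (cc i))).
have cL i : continuous (L i) by rewrite /L; case: cid2.
have LE i u : L i u = c i u by rewrite /L; case: cid2.
have sL u : u = \sum_i L i u *: e i.
  by rewrite [LHS]sc; apply: eq_bigr => i _; rewrite LE.
exists (Frame cL sL), erefl; split => [i|i u] /=; rewrite cast_ord_id //.
Qed.

Lemma linear_coord_rV n (i : 'I_n) : linear_for *%R (fun u : 'rV[R]_n => u 0 i).
Proof. by move=> a u v; rewrite !mxE. Qed.

Definition frame_rV n : frame 'rV[R]_n :=
  sval (make_frame (@linear_coord_rV n) (fun i => @coord_continuous _ _ _ 0 i)
    (@row_sum_delta R n)).

Lemma frame_rVE n : exists en : frame_dim (frame_rV n) = n,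
  (forall i, frame_vec (frame_rV n) i = 'e_(cast_ord en i)) /\
  (forall i u, frame_coord (frame_rV n) i u = u 0 (cast_ord en i)).
Proof. exact: (svalP (make_frame _ _ _)). Qed.

Lemma real_sum1 (u : R) : u = \sum_(i < 1) u *: (1 : R^o).
Proof. by rewrite big_ord_recl big_ord0 addr0 [RHS]mulr1. Qed.

Definition frame_R : frame R :=
  sval (@make_frame R 1 (fun=> 1) (fun=> id) (fun _ _ _ _ => erefl)
    (fun _ _ => cvg_id) real_sum1).

Definition frame_prod (E F : normedModType R) (b : frame E) (c : frame F) :
  frame (E * F)%type.
Proof.
pose e (i : 'I_(frame_dim b + frame_dim c)) : E * F :=
  match fintype.split i with inl j => (frame_vec b j, 0) | inr j => (0, frame_vec c j) end.
pose d (i : 'I_(frame_dim b + frame_dim c)) (u : E * F) : R :=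
  match fintype.split i with inl j => frame_coord b j u.1 | inr j => frame_coord c j u.2 end.
apply: (sval (@make_frame (E * F)%type _ e d _ _ _)).
- by move=> i a u v; rewrite /d; case: fintype.split => j; rewrite /= linearP.
- move=> i; rewrite /d; case: fintype.split => j u.
    apply: (continuous_comp (g := frame_coord b j)); first exact: cvg_fst.
    exact: frame_coord_continuous.
  apply: (continuous_comp (g := frame_coord c j)); first exact: cvg_snd.
  exact: frame_coord_continuous.
- move=> u; rewrite big_split_ord /=.
  have -> : \sum_i d (lshift _ i) u *: e (lshift _ i) = (u.1, 0).
    rewrite [in RHS](frame_sum b u.1).
    rewrite (eq_bigr (fun i => (frame_coord b i u.1 *: frame_vec b i, 0))); last first.
      move=> i _; rewrite /d /e; case: split_ordP => j /eqP; last by rewrite eq_lrshift.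
      by rewrite eq_lshift => /eqP <-; congr pair; exact: scaler0.
    by elim/big_rec2: _ => // i x y _ ->; congr pair; exact: add0r.
  have -> : \sum_i d (rshift _ i) u *: e (rshift _ i) = (0, u.2).
    rewrite [in RHS](frame_sum c u.2).
    rewrite (eq_bigr (fun i => (0, frame_coord c i u.2 *: frame_vec c i))); last first.
      move=> i _; rewrite /d /e; case: split_ordP => j /eqP; first by rewrite eq_rlshift.
      by rewrite eq_rshift => /eqP <-; congr pair; exact: scaler0.
    by elim/big_rec2: _ => // i x y _ ->; congr pair; exact: add0r.
  by case: u => x y /=; congr pair; rewrite ?addr0 ?add0r.
Defined.

End frames.

(** * Maps into products and row vectors; local surjectivity *)

Section pairs.
Context {R : realType}.
Implicit Types E F H : normedModType R.

Lemma Ck_on_pair E F H k (U : set E) (f : E -> F) (g : E -> H) : open U ->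
  Ck_on k U f -> Ck_on k U g -> Ck_on k U (fun u => (f u, g u)).
Proof.
move=> oU; elim: k f g => [|k IH] f g [cf df] [cg dg].
  split => // u Uu; apply: cvg_pair; [exact: cf|exact: cg].
split; first by move=> u Uu; apply: cvg_pair; [exact: cf|exact: cg].
move=> v; have [dvf ddf] := df v; have [dvg ddg] := dg v.
have q u : (fun h : R => h^-1 *: (((fun u => (f u, g u)) \o shift u) (h *: v) - (f u, g u))) =
  (fun h : R => (h^-1 *: ((f \o shift u) (h *: v) - f u), h^-1 *: ((g \o shift u) (h *: v) - g u))).
  by apply/funext.
have cv u : U u -> h^-1 *: (((fun u => (f u, g u)) \o shift u) (h *: v) - (f u, g u)) @[h --> 0^'] --> ('D_v f u, 'D_v g u).
  by move=> Uu; rewrite q; apply: cvg_pair; [exact: dvf|exact: dvg].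
split; first by move=> u /cv c; apply/cvg_ex; exists ('D_v f u, 'D_v g u).
apply: Ck_on_eq (IH _ _ ddf ddg) => // u /cv c.
by rewrite /derive; apply/esym; exact: cvg_lim c.
Qed.

Lemma fst_packed E F : exists2 L : {linear (E * F)%type -> E}, continuous L &
  forall u, L u = u.1.
Proof.
have l : linear (fst : E * F -> E) by [].
pose L : {linear (E * F)%type -> E} := HB.pack (fst : E * F -> E) (GRing.isLinear.Build _ _ _ _ _ l).
exists L => // u.
exact: cvg_fst.
Qed.

Lemma snd_packed E F : exists2 L : {linear (E * F)%type -> F}, continuous L &
  forall u, L u = u.2.
Proof.
have l : linear (snd : E * F -> F) by [].
pose L : {linear (E * F)%type -> F} := HB.pack (snd : E * F -> F) (GRing.isLinear.Build _ _ _ _ _ l).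
exists L => // u.
exact: cvg_snd.
Qed.

Lemma Ck_on_fst E F k (U : set (E * F)) : Ck_on k U fst.
Proof.
have [L cL LE] := @fst_packed E F.
have -> : fst = L by apply/funext => u; rewrite LE.
by apply: Ck_on_sub (Ck_on_linear k cL).
Qed.

Lemma Ck_on_snd E F k (U : set (E * F)) : Ck_on k U snd.
Proof.
have [L cL LE] := @snd_packed E F.
have -> : snd = L by apply/funext => u; rewrite LE.
by apply: Ck_on_sub (Ck_on_linear k cL).
Qed.

Lemma rV_norm_le n (u : 'rV[R]_n) (C : R) : 0 <= C ->
  (forall i, `|u 0 i| <= C) -> `|u| <= C.
Proof.
move=> C0 uC; rewrite [leLHS]/Num.Def.normr/= mx_normrE.
by apply: bigmax_le => // -[i j] _ /=; rewrite ord1.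
Qed.

Lemma rV_coord_le n (u : 'rV[R]_n) i : `|u 0 i| <= `|u|.
Proof.
rewrite [leRHS]/Num.Def.normr/= mx_normrE.
exact: (@le_bigmax _ _ _ _ (fun ij : 'I_1 * 'I_n => `|u ij.1 ij.2|) (0, i)).
Qed.

Lemma C1_strict_rV E (b : frame E) n (U : set E) (f : E -> 'rV[R]_n) (u : E) :
  open U -> U u -> Ck_on 1 U f -> forall eps, 0 < eps ->
  exists2 d : R, 0 < d &
    forall x y, `|x - u| < d -> `|y - u| < d ->
    `|f x - f y - 'D_(x - y) f u| <= eps * `|x - y|.
Proof.
move=> oU Uu Cf eps e0.
have Cfi i : Ck_on 1 U (fun x => f x 0 i).
  have [L cL LE] := pack_linear (@linear_coord_rV R n i) (@coord_continuous _ _ _ 0 i).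
  have -> : (fun x => f x 0 i) = L \o f by apply/funext => x /=; rewrite LE.
  exact: Ck_on_linear_comp.
have st i : exists d : R, 0 < d /\ forall x y, `|x - u| < d -> `|y - u| < d ->
    `|f x 0 i - f y 0 i - 'D_(x - y) (fun x => f x 0 i) u| <= eps * `|x - y|.
  have [d d0 dP] := C1_strict b oU Uu (Cfi i) e0.
  exists d; split=> // x y xu yu.
  by have [_ ->] := C1_differentiable b oU Uu (Cfi i); exact: dP.
have [d dP] := choice st.
exists (\big[Num.min/1]_i d i).
  by apply: lt_bigmin => // i _; have [] := dP i.
move=> x y xu yu; apply: rV_norm_le; first by rewrite mulr_ge0 // ltW.
move=> i; have [_ dPi] := dP i; rewrite derive_mx; last exact: (Cf.2 _).1.
rewrite !mxE; apply: dPi; [apply: lt_le_trans xu _|apply: lt_le_trans yu _].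
  exact: bigmin_le.
exact: bigmin_le.
Qed.

Lemma C1_lipschitz E (b : frame E) n (U : set E) (f : E -> 'rV[R]_n) (u : E) :
  open U -> U u -> Ck_on 1 U f ->
  exists2 C : R, 0 < C & exists2 d : R, 0 < d &
    forall x y, `|x - u| < d -> `|y - u| < d -> `|f x - f y| <= C * `|x - y|.
Proof.
move=> oU Uu Cf; have [d d0 dP] := C1_strict_rV b oU Uu Cf ltr01.
have [B B0 BP] := frame_bound b.
have Dle v : `|'D_v f u| <= (\sum_i B * `|'D_(frame_vec b i) f u|) * `|v|.
  have Cfi i : Ck_on 1 U (fun x => f x 0 i).
    have [L cL LE] := pack_linear (@linear_coord_rV R n i) (@coord_continuous _ _ _ 0 i).
    have -> : (fun x => f x 0 i) = L \o f by apply/funext => x /=; rewrite LE.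
    exact: Ck_on_linear_comp.
  apply: rV_norm_le; first by rewrite mulr_ge0 // sumr_ge0 // => i _; rewrite mulr_ge0 // ltW.
  move=> i; rewrite derive_mx; last exact: (Cf.2 _).1.
  rewrite mxE; have [_ ->] := C1_differentiable b oU Uu (Cfi i).
  rewrite (le_trans (ler_norm_sum _ _ _)) // mulr_suml; apply: ler_sum => j _.
  rewrite normrM mulrAC ler_pM //; first by have [] := BP j v.
  have := rV_coord_le ('D_(frame_vec b j) f u) i.
  by rewrite derive_mx ?mxE //; exact: (Cf.2 _).1.
exists (1 + \sum_i B * `|'D_(frame_vec b i) f u|).
  by rewrite ltr_pwDl // sumr_ge0 // => i _; rewrite mulr_ge0 // ltW.
exists d => // x y xu yu; rewrite -[f x - f y](subrK ('D_(x - y) f u)).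
by rewrite (le_trans (ler_normD _ _)) // mulrDl lerD //; exact: dP.
Qed.

(** The surjective half of the inverse function theorem, with derivative normalised to the identity.
    Strict differentiability makes [x - f x] a contraction of ratio 1/2 near [u], and a fixed point
    of [x - f x + y] solves [f x = y]. *)
Lemma local_surjectivity n (U : set 'rV[R]_n) (f : 'rV[R]_n -> 'rV[R]_n) u :
  open U -> U u -> Ck_on 1 U f -> (forall i, 'D_('e_i) f u = 'e_i) ->
  forall r, 0 < r -> nbhs (f u) (f @` [set x | `|x - u| < r]).
Proof.
move=> oU Uu Cf De r r0.
have DE v : 'D_v f u = v.
  have [en [eE cE]] := @frame_rVE R n.
  apply/rowP => i.
  have Cfi : Ck_on 1 U (fun x => f x 0 i).
    have [L cL LE] := pack_linear (@linear_coord_rV R n i) (@coord_continuous _ _ _ 0 i).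
    have -> : (fun x => f x 0 i) = L \o f by apply/funext => x /=; rewrite LE.
    exact: Ck_on_linear_comp.
  have dc w : 'D_w f u 0 i = 'D_w (fun x => f x 0 i) u.
    by rewrite derive_mx ?mxE //; exact: (Cf.2 _).1.
  rewrite dc; have [_ ->] := C1_differentiable (frame_rV n) oU Uu Cfi.
  rewrite [in RHS](frame_sum (frame_rV n) v) summxE; apply: eq_bigr => j _.
  by rewrite !mxE -dc eE De.
have h0 : 0 < 2^-1 :> R by rewrite invr_gt0.
have [d d0 dP] := C1_strict_rV (frame_rV n) oU Uu Cf h0.
pose s := Num.min d r / 2.
have s0 : 0 < s by rewrite divr_gt0 // lt_min d0.
have sd x : `|x - u| <= s -> `|x - u| < d /\ `|x - u| < r.
  move=> xs; apply/andP; rewrite -lt_min; apply: le_lt_trans xs _.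
  by rewrite ltr_pdivrMr // ltr_pMr ?lt_min ?d0 // ltr1n.
have con x y : `|x - u| <= s -> `|y - u| <= s -> `|x - f x - (y - f y)| <= 2^-1 * `|x - y|.
  move=> /sd[xd _] /sd[yd _]; have := dP x y xd yd; rewrite DE distrC.
  suff -> : x - f x - (y - f y) = x - y - (f x - f y) by [].
  by rewrite !opprD !opprK addrACA.
have [_] := nbhs_normP (f u) (f @` [set x | `|x - u| < r]); apply.
(* For |y - f u| < s/2 the map [T] preserves the closed ball of radius [s]: the contraction
   contributes at most s/2, and [y - f u] the other half. *)
exists (s / 2); first by rewrite /= divr_gt0.
move=> y; rewrite /ball_ /= => ys.
pose B : set 'rV[R]_n := [set x | `|x - u| <= s].
pose T x := x - f x + y.
have TB : {homo T : x / B x >-> B x}.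
  move=> x; rewrite /B /T /= => xs.
  have -> : x - f x + y - u = (x - f x - (u - f u)) + (y - f u).
    rewrite opprB -[LHS]addrA -[RHS]addrA; congr (_ + _).
    by rewrite [RHS]addrC subrKA.
  rewrite (le_trans (ler_normD _ _)) // [s]splitr lerD //; last by rewrite distrC ltW.
  have us : `|u - u| <= s by rewrite subrr normr0 ltW.
  by apply: le_trans (con _ _ xs us) _; rewrite mulrC ler_wpM2r.
have ctr : is_contraction (mkfun_fun TB).
  have h1 : 0 <= 2^-1 :> R by rewrite ltW.
  exists (NngNum h1); split => /=; first by rewrite invf_lt1 // ltr1n.
  move=> -[x z] /= [xB zB]; rewrite /mkfun /T opprD addrACA subrr addr0; exact: con.
have clB : closed B.
  have -> : B = closed_ball_ Num.Def.normr u s by apply/seteqP; split => x; rewrite /B /= distrC.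
  exact: closed_closed_ball_.
have [|x Bx xE] := banach_fixed_point ctr clB.
  by exists u; rewrite /B /= subrr normr0 ltW.
exists x; first by have [] := sd x Bx.
move: xE; rewrite /mkfun_fun /= /mkfun /T => /eqP; rewrite -addrA addrC -subr_eq subrr.
by rewrite eq_sym addrC subr_eq0 => /eqP.
Qed.

End pairs.

(** * Smooth maps between manifolds *)

Section open_preimage.
Lemma open_preimage_on (M N : topologicalType) (W : set M) (f : M -> N) (D : set N) :
  open W -> open D -> (forall x, W x -> {for x, continuous f}) ->
  open (W `&` f @^-1` D).
Proof.
move=> oW oD cf; rewrite openE => x [Wx Dfx]; apply: filterI.
  exact: open_nbhs_nbhs.
by apply: (cf x Wx); exact: open_nbhs_nbhs.
Qed.

Lemma open_setX (M N : topologicalType) (A : set M) (B : set N) :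
  open A -> open B -> open (A `*` B).
Proof.
move=> oA oB; rewrite openE => -[x y] [/= Ax By].
by exists (A, B) => //=; split; exact: open_nbhs_nbhs.
Qed.
End open_preimage.

Section atlases.
Context {R : realType}.

(** The part of [is_manifold] that smoothness arguments use, with charts in an arbitrary normed
    module: it passes to products and holds for a normed space with its identity chart, so that
    functions of several variables need no separate treatment. *)
Record atlas_ok (M : topologicalType) (E : normedModType R)
    (A : set (chart M E)) : Prop := AtlasOk {
  atlas_chart : forall c, A c -> is_chart c ;
  atlas_cover : forall x, exists2 c, A c & chart_dom c x ;
  atlas_transition : forall c c', A c -> A c' ->
    smooth_on (chart_cod c `&` chart_from c @^-1` chart_dom c')
              (chart_to c' \o chart_from c) }.

Implicit Types (M N P : topologicalType) (E F H : normedModType R).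

Lemma manifold_atlas_ok n M (A : set (chart M 'rV[R]_n)) :
  is_manifold A -> atlas_ok A.
Proof. by case=> _ _ h1 h2 h3; split. Qed.

Lemma std_atlas_ok E : atlas_ok (@std_atlas E).
Proof.
split=> [c ->|x|c c' -> ->].
- by split; [exact: openT|exact: openT| |] => x _; split => //; exact: cvg_id.
- by exists (Chart setT setT id id).
- by move=> k; exact: Ck_on_id.
Qed.

Lemma is_chart_prod M N E F (c : chart M E) (c' : chart N F) :
  is_chart c -> is_chart c' -> is_chart (prod_chart c c').
Proof.
move=> [od oc tc fc] [od' oc' tc' fc']; split.
- exact: open_setX.
- exact: open_setX.
- move=> [x y] /= [/tc[h1 h2 h3] /tc'[h1' h2' h3']]; split => //=; first by rewrite h2 h2'.
  apply: cvg_pair.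
    by apply: (@continuous_comp _ _ _ fst (chart_to c) (x, y)) => //; exact: cvg_fst.
  by apply: (@continuous_comp _ _ _ snd (chart_to c') (x, y)) => //; exact: cvg_snd.
- move=> [x y] /= [/fc[h1 h2 h3] /fc'[h1' h2' h3']]; split => //=; first by rewrite h2 h2'.
  apply: cvg_pair.
    by apply: (@continuous_comp _ _ _ fst (chart_from c) (x, y)) => //; exact: cvg_fst.
  by apply: (@continuous_comp _ _ _ snd (chart_from c') (x, y)) => //; exact: cvg_snd.
Qed.

Lemma chart_preimage_open M E (c : chart M E) (W : set M) :
  is_chart c -> open W -> open (chart_cod c `&` chart_from c @^-1` W).
Proof.
by move=> [_ oc _ fc] oW; apply: open_preimage_on => // u /fc[].
Qed.

Lemma prod_atlas_ok M N E F (bE : frame E) (bF : frame F)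
    (A : set (chart M E)) (B : set (chart N F)) :
  atlas_ok A -> atlas_ok B -> atlas_ok (prod_atlas A B).
Proof.
move=> [ac acov atr] [bc bcov btr]; split.
- by move=> _ [[c c'] [/= /ac hc /bc hc'] <-]; exact: is_chart_prod.
- move=> [x y]; have [c Ac cx] := acov x; have [c' Bc' cy] := bcov y.
  by exists (prod_chart c c') => //; exists (c, c').
- move=> _ _ [[c d] [/= Ac Bd] <-] [[c' d'] [/= Ac' Bd'] <-] k /=.
  have oU : open (chart_cod c `&` chart_from c @^-1` chart_dom c').
    by apply: chart_preimage_open; [exact: ac|case: (ac _ Ac')].
  have oV : open (chart_cod d `&` chart_from d @^-1` chart_dom d').
    by apply: chart_preimage_open; [exact: bc|case: (bc _ Bd')].
  apply: (@Ck_on_sub _ _ _ _ ((chart_cod c `&` chart_from c @^-1` chart_dom c') `*`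
     (chart_cod d `&` chart_from d @^-1` chart_dom d'))).
    by move=> [x y] [] /= [? ?] [? ?]; split.
  have oUV := open_setX oU oV.
  apply: Ck_on_pair => //.
    exact: (Ck_on_comp bE bE oUV oU (fun u Su => proj1 Su) (atr _ _ Ac Ac' k) (Ck_on_fst k _)).
  exact: (Ck_on_comp bF bF oUV oV (fun u Su => proj2 Su) (btr _ _ Bd Bd' k) (Ck_on_snd k _)).
Qed.

(** Around each point a chart [c'] of the intermediate space is inserted, and the domain is shrunk
    to the points that [g] sends into it. *)
Lemma smooth_comp M N P E F H (bF : frame F) (bH : frame H)
    (A : set (chart M E)) (B : set (chart N F)) (C : set (chart P H))
    (W : set M) (V : set N) (f : N -> P) (g : M -> N) :
  atlas_ok A -> atlas_ok B -> atlas_ok C -> open W -> open V ->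
  (forall x, W x -> V (g x)) ->
  smooth_map_on A B W g -> smooth_map_on B C V f -> smooth_map_on A C W (f \o g).
Proof.
move=> [ac acov atr] [bc bcov btr] [cc _ _] oW oV WV [cg sg] [cf sf].
have cfg x : W x -> {for x, continuous (f \o g)}.
  by move=> Wx; apply: continuous_comp; [exact: cg|apply: cf; exact: WV].
split => // c c'' Ac Cc'' k.
have od'' : open (chart_dom c'') by case: (cc _ Cc'').
apply: Ck_on_cover => u [cu [Wx Dx]].
have [c' Bc' c'y] := bcov (g (chart_from c u)).
have od' : open (chart_dom c') by case: (bc _ Bc').
pose S' := chart_cod c `&` chart_from c @^-1`
  ((W `&` (f \o g) @^-1` chart_dom c'') `&` (W `&` g @^-1` chart_dom c')).
have oS' : open S'.
  apply: chart_preimage_open; first exact: ac.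
  by apply: openI; exact: open_preimage_on.
have oV' : open (chart_cod c' `&` chart_from c' @^-1` (V `&` f @^-1` chart_dom c'')).
  apply: chart_preimage_open; first exact: bc.
  exact: open_preimage_on.
exists S'; first by split => //; split.
have Cg : Ck_on k S' (chart_to c' \o g \o chart_from c).
  by apply: Ck_on_sub (sg _ _ Ac Bc' k) => v [? [[? ?] [? ?]]]; split.
apply: Ck_on_eq (Ck_on_comp bF bH oS' oV' _ (sf _ _ Bc' Cc'' k) Cg) => //.
  move=> v [cv [[Wv Dv] [_ c'v]]] /=.
  by have [_ _ /(_ _ c'v)[_ -> _] _] := bc _ Bc'.
move=> v [cv [[Wv Dv] [_ c'v]]] /=.
have [_ _ /(_ _ c'v)[cc' ccK _] _] := bc _ Bc'.
by split => //; rewrite /= ccK; split => //; exact: WV.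
Qed.

Lemma smooth_sub M N E F (A : set (chart M E)) (B : set (chart N F)) W W' f :
  W' `<=` W -> smooth_map_on A B W f -> smooth_map_on A B W' f.
Proof.
move=> WW [cf sf]; split => [x /WW/cf //|c c' Ac Bc' k].
by apply: Ck_on_sub (sf _ _ Ac Bc' k) => u [cu [/WW Wu Du]].
Qed.

Lemma smooth_eq M N E F (A : set (chart M E)) (B : set (chart N F)) W f g :
  atlas_ok A -> atlas_ok B -> open W -> (forall x, W x -> f x = g x) ->
  smooth_map_on A B W f -> smooth_map_on A B W g.
Proof.
move=> [ac _ _] [bc _ _] oW fg [cf sf].
have cg x : W x -> {for x, continuous g}.
  move=> Wx; have := cf x Wx; rewrite /prop_for /continuous_at (fg x Wx).
  apply: cvg_trans; apply: near_eq_cvg; near=> y; rewrite fg //.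
  by near: y; exact: open_nbhs_nbhs.
split => // c c' Ac Bc' k.
have od' : open (chart_dom c') by case: (bc _ Bc').
have -> : chart_cod c `&` chart_from c @^-1` (W `&` g @^-1` chart_dom c') =
   chart_cod c `&` chart_from c @^-1` (W `&` f @^-1` chart_dom c').
  by apply/seteqP; split => u [cu [Wu Du]]; split => //; split => //; move: Du; rewrite /= fg.
apply: Ck_on_eq (sf _ _ Ac Bc' k).
  by apply: chart_preimage_open; [exact: ac|exact: open_preimage_on].
by move=> u [_ [/fg /= -> _]].
Unshelve. all: by end_near. Qed.

Lemma smooth_cst M N E F (A : set (chart M E)) (B : set (chart N F)) W y :
  smooth_map_on A B W (fun=> y).
Proof.
split => [x _|c c' _ _ k]; first exact: cst_continuous.
exact: Ck_on_cst.
Qed.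

Lemma smooth_id M E (A : set (chart M E)) W : atlas_ok A -> smooth_map_on A A W id.
Proof.
move=> [_ _ atr]; split => [x _|c c' Ac Ac' k]; first exact: cvg_id.
by apply: Ck_on_sub (atr _ _ Ac Ac' k) => u [? [? ?]].
Qed.

Lemma smooth_pair M N P E F H (A : set (chart M E)) (B : set (chart N F))
    (C : set (chart P H)) W f g : atlas_ok A -> atlas_ok B -> atlas_ok C -> open W ->
  smooth_map_on A B W f -> smooth_map_on A C W g ->
  smooth_map_on A (prod_atlas B C) W (fun x => (f x, g x)).
Proof.
move=> [ac _ _] [bc _ _] [cc _ _] oW [cf sf] [cg sg].
have cfg x : W x -> {for x, continuous (fun x => (f x, g x))}.
  by move=> Wx; apply: cvg_pair; [exact: cf|exact: cg].
split => // c _ Ac [[c1 c2] [/= Bc1 Cc2] <-] k.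
have od1 : open (chart_dom c1) by case: (bc _ Bc1).
have od2 : open (chart_dom c2) by case: (cc _ Cc2).
have oS : open (chart_cod c `&` chart_from c @^-1`
    (W `&` (fun x => (f x, g x)) @^-1` chart_dom (prod_chart c1 c2))).
  apply: chart_preimage_open; first exact: ac.
  by apply: open_preimage_on => //; exact: open_setX.
apply: Ck_on_pair => //.
  by apply: Ck_on_sub (sf _ _ Ac Bc1 k) => u [cu [Wu [/= ? ?]]].
by apply: Ck_on_sub (sg _ _ Ac Cc2 k) => u [cu [Wu [/= ? ?]]].
Qed.

Lemma smooth_std E F U (f : E -> F) :
  smooth_map_on (@std_atlas E) (@std_atlas F) U f <-> smooth_on U f.
Proof.
split=> [[cf /(_ _ _ erefl erefl) /= sf] k|sf].
  by apply: Ck_on_sub (sf k).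
split; first by case: (sf 0%N).
by move=> _ _ -> -> k; apply: Ck_on_sub (sf k) => u [? []].
Qed.

Lemma smooth_fst M N E F (bE : frame E) (A : set (chart M E)) (B : set (chart N F)) W :
  atlas_ok A -> atlas_ok B -> smooth_map_on (prod_atlas A B) A W fst.
Proof.
move=> [ac acov atr] [bc _ _]; split => [x _|_ c'' [[c c'] [/= Ac Bc'] <-] Ac'' k].
  exact: cvg_fst.
have oU : open (chart_cod c `&` chart_from c @^-1` chart_dom c'').
  by apply: chart_preimage_open; [exact: ac|case: (ac _ Ac'')].
have oc' : open (chart_cod c') by case: (bc _ Bc').
have oUV := open_setX oU oc'.
apply: (@Ck_on_sub _ _ _ _ ((chart_cod c `&` chart_from c @^-1` chart_dom c'') `*` chart_cod c')).
  by move=> [x y] [] /= [? ?] [? ?]; split.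
exact: (Ck_on_comp bE bE oUV oU (fun u Su => proj1 Su) (atr _ _ Ac Ac'' k) (Ck_on_fst k _)).
Qed.

Lemma smooth_snd M N E F (bF : frame F) (A : set (chart M E)) (B : set (chart N F)) W :
  atlas_ok A -> atlas_ok B -> smooth_map_on (prod_atlas A B) B W snd.
Proof.
move=> [ac _ _] [bc bcov btr]; split => [x _|_ c'' [[c c'] [/= Ac Bc'] <-] Bc'' k].
  exact: cvg_snd.
have oU : open (chart_cod c' `&` chart_from c' @^-1` chart_dom c'').
  by apply: chart_preimage_open; [exact: bc|case: (bc _ Bc'')].
have oc : open (chart_cod c) by case: (ac _ Ac).
have oUV := open_setX oc oU.
apply: (@Ck_on_sub _ _ _ _ (chart_cod c `*` (chart_cod c' `&` chart_from c' @^-1` chart_dom c''))).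
  by move=> [x y] [] /= [? ?] [? ?]; split.
exact: (Ck_on_comp bF bF oUV oU (fun u Su => proj2 Su) (btr _ _ Bc' Bc'' k) (Ck_on_snd k _)).
Qed.

Lemma smooth_chart_to M E (A : set (chart M E)) c : atlas_ok A -> A c ->
  smooth_map_on A (@std_atlas E) (chart_dom c) (chart_to c).
Proof.
move=> [ac acov atr] Ac; have [_ _ tc _] := ac _ Ac.
split => [x /tc[]//|c' _ Ac' -> k].
by apply: Ck_on_sub (atr _ _ Ac' Ac k) => u [? []].
Qed.

Lemma smooth_chart_from M E (A : set (chart M E)) c : atlas_ok A -> A c ->
  smooth_map_on (@std_atlas E) A (chart_cod c) (chart_from c).
Proof.
move=> [ac acov atr] Ac; have [_ _ _ fc] := ac _ Ac.
split => [x /fc[]//|_ c' -> Ac' k].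
by apply: Ck_on_sub (atr _ _ Ac Ac' k) => u [? []].
Qed.

Lemma smooth_cover M N E F (A : set (chart M E)) (B : set (chart N F)) W f :
  (forall x, W x -> exists2 V, V x & smooth_map_on A B V f) ->
  smooth_map_on A B W f.
Proof.
move=> H; split => [x /H[V Vx [cf _]]|c c' Ac Bc' k]; first exact: cf.
apply: Ck_on_cover => u [cu [/H[V Vu [_ sf]] Du]].
by exists (chart_cod c `&` chart_from c @^-1` (V `&` f @^-1` chart_dom c')) => //; exact: sf.
Qed.

End atlases.

Section derivative_linearity.
Context {R : realType}.
Implicit Types E F : normedModType R.

Lemma derive_linear E (b : frame E) (U : set E) (f : E -> R) (u : E) (a : R) v w :
  open U -> U u -> Ck_on 1 U f -> 'D_(a *: v + w) f u = a * 'D_v f u + 'D_w f u.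
Proof.
move=> oU Uu Cf; have [_ DE] := C1_differentiable b oU Uu Cf.
rewrite !DE mulr_sumr -big_split /=; apply: eq_bigr => i _.
by rewrite linearP mulrDl -scalerAl.
Qed.

Lemma Ck_on_rV E n k (U : set E) (f : E -> 'rV[R]_n) i : open U -> Ck_on k U f ->
  Ck_on k U (fun x => f x 0 i).
Proof.
move=> oU Cf.
have [L cL LE] := pack_linear (@linear_coord_rV R n i) (@coord_continuous _ _ _ 0 i).
have -> : (fun x => f x 0 i) = L \o f by apply/funext => x /=; rewrite LE.
exact: Ck_on_linear_comp.
Qed.

Lemma derive_linear_rV E (b : frame E) n (U : set E) (f : E -> 'rV[R]_n) (u : E) (a : R) v w :
  open U -> U u -> Ck_on 1 U f -> 'D_(a *: v + w) f u = a *: 'D_v f u + 'D_w f u.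
Proof.
move=> oU Uu Cf; apply/rowP => i.
have d x : derivable f u x by exact: (Cf.2 _).1.
by rewrite !mxE !derive_mx // !mxE (derive_linear b _ _ _ oU Uu (Ck_on_rV i oU Cf)).
Qed.

(** The hypothesis is additivity of the derivative at the origin on the two axis directions. When a
    variable occurs twice in an expression, as in a product of two curves, this is the product
    rule. *)
Lemma derive_diagonal F (q : R * R -> F) :
  'D_((1, 0) + (0, 1)) q (0, 0) = 'D_(1, 0) q (0, 0) + 'D_(0, 1) q (0, 0) ->
  'D_1 (fun t : R => q (t, t)) 0 =
    'D_1 (fun t : R => q (t, 0)) 0 + 'D_1 (fun t : R => q (0, t)) 0.
Proof.
have line (v : R * R) : 'D_v q (0, 0) = 'D_1 (fun t : R => q (t *: v)) 0.
  have qE : (fun t : R => q (t *: v + (0, 0))) = (fun t : R => q (t *: v)).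
    by apply/funext => t; congr q; rewrite [RHS]surjective_pairing; congr pair; exact: addr0.
  by rewrite -derive_along qE.
rewrite !line => E.
have -> : (fun t : R => q (t, t)) = (fun t : R => q (t *: ((1, 0) + (0, 1)))).
  apply/funext => t; congr q; congr pair; apply/esym; last first.
    by rewrite /= add0r [LHS]mulr1.
  by rewrite /= addr0 [LHS]mulr1.
have -> : (fun t : R => q (t, 0)) = (fun t : R => q (t *: (1, 0))).
  by apply/funext => t; congr q; congr pair; apply/esym; [exact: mulr1|exact: mulr0].
have -> : (fun t : R => q (0, t)) = (fun t : R => q (t *: (0, 1))).
  by apply/funext => t; congr q; congr pair; apply/esym; [exact: mulr0|exact: mulr1].
exact: E.
Qed.

End derivative_linearity.

Section partial.
Context {R : realType}.
Implicit Types (M N : topologicalType) (E F : normedModType R).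

Lemma smooth_of_charts M E F (A : set (chart M E)) W (f : M -> F) :
  atlas_ok A -> open W ->
  (forall c, A c -> smooth_on (chart_cod c `&` chart_from c @^-1` W) (f \o chart_from c)) ->
  smooth_map_on A (@std_atlas F) W f.
Proof.
move=> [ac acov _] oW H; split; last first.
  by move=> c c' Ac -> k; apply: Ck_on_sub (H _ Ac k) => u [cu [Wu _]].
move=> x Wx; have [c Ac cx] := acov x; have [od _ /(_ _ cx)[cc ccK ct] fc] := ac _ Ac.
have [cf _] := H _ Ac 0%N.
have cc' : (chart_cod c `&` chart_from c @^-1` W) (chart_to c x) by split; rewrite // /= ccK.
have : {for x, continuous ((f \o chart_from c) \o chart_to c)}.
  by apply: continuous_comp => //; exact: cf.
rewrite /prop_for /continuous_at /= ccK; apply: cvg_trans; apply: near_eq_cvg.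
near=> y; have cy : chart_dom c y by near: y; exact: open_nbhs_nbhs.
by have [_ _ /(_ _ cy)[_ fromK _] _] := ac _ Ac; rewrite /= fromK.
Unshelve. all: by end_near. Qed.

(** In a chart of [M] this is the derivative along [(0, v)] of a function smooth in both variables,
    hence again smooth in both, and then restricted to the slice [u = u0]. One derivative is spent,
    whence [k.+1] in the proof. *)
Lemma smooth_partial M E F (bE : frame E) (bF : frame F) (A : set (chart M E))
    (W : set M) (V : set F) (Phi : M * F -> R) (u0 v : F) :
  atlas_ok A -> open W -> open V -> V u0 ->
  smooth_map_on (prod_atlas A (@std_atlas F)) (@std_atlas R) (W `*` V) Phi ->
  smooth_map_on A (@std_atlas R) W (fun x => 'D_v (fun u => Phi (x, u)) u0).
Proof.
move=> okA oW oV Vu0 [cP sP]; apply: smooth_of_charts => // c Ac k.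
have [ac _ _] := okA.
pose S := chart_cod c `&` chart_from c @^-1` W.
have oS : open S by apply: chart_preimage_open => //; exact: ac.
pose Psi (z : E * F) := Phi (chart_from c z.1, z.2).
have CP : Ck_on k.+1 (S `*` V) Psi.
  have Ad : prod_atlas A (@std_atlas F) (prod_chart c (Chart setT setT id id)).
    by exists (c, Chart setT setT id id).
  by apply: Ck_on_sub (sP _ _ Ad erefl k.+1) => z [[cz Wz] Vz]; split.
have oSV := open_setX oS oV.
have [_ /(_ (0, v))[_ CD]] := CP.
have pc : Ck_on k S (fun a : E => (a, u0)).
  by apply: Ck_on_pair => //; [exact: Ck_on_id|exact: Ck_on_cst].
have H := Ck_on_comp (frame_prod bE bF) frame_R oS oSV 
  (fun a Sa => conj Sa Vu0 : (S `*` V) (a, u0)) CD pc.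
apply: Ck_on_eq oS _ H => a Sa /=.
have q : (fun h : R => h^-1 *: ((Psi \o shift (a, u0)) (h *: (0, v)) - Psi (a, u0))) =
    (fun h : R => h^-1 *: (((fun u => Phi (chart_from c a, u)) \o shift u0) (h *: v) -
      Phi (chart_from c a, u0))).
  by apply/funext => h; rewrite /Psi /= scaler0 add0r.
by rewrite /derive q.
Qed.

End partial.

(** * Left-invariant fields *)

Section lie_group.
Context (R : realType) (n : nat) (G : groupTopologicalType)
  (AG : set (chart G 'rV[R]_n)) (G_lie : is_lie_group AG).

Lemma lie_atlas_ok : atlas_ok AG.
Proof. exact: manifold_atlas_ok (lie_group_manifold G_lie). Qed.

Let okG := lie_atlas_ok.
Let bn := @frame_rV R n.

Lemma smooth_mul (M : topologicalType) (E : normedModType R) (A : set (chart M E)) W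
    (f g : M -> G) : atlas_ok A -> open W ->
  smooth_map_on A AG W f -> smooth_map_on A AG W g ->
  smooth_map_on A AG W (fun x => (f x * g x)%g).
Proof.
move=> okA oW sf sg.
have sfg := smooth_pair okA okG okG oW sf sg.
have := smooth_comp (frame_prod bn bn) bn okA (prod_atlas_ok bn bn okG okG) okG oW openT
  (fun _ _ => I) sfg (lie_group_mul G_lie).
exact.
Qed.

Lemma smooth_inv (M : topologicalType) (E : normedModType R) (A : set (chart M E)) W
    (f : M -> G) : atlas_ok A -> open W ->
  smooth_map_on A AG W f -> smooth_map_on A AG W (fun x => (f x)^-1%g).
Proof.
move=> okA oW sf.
exact: (smooth_comp bn bn okA okG okG oW openT (fun _ _ => I) sf (lie_group_inv G_lie)).
Qed.

Lemma smooth_fun_comp (M : topologicalType) (E : normedModType R) (A : set (chart M E)) W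
    (f : G -> R) (g : M -> G) : atlas_ok A -> open W -> smooth_fun AG f ->
  smooth_map_on A AG W g -> smooth_map_on A (@std_atlas R) W (f \o g).
Proof.
move=> okA oW sf sg.
exact: (smooth_comp bn frame_R okA okG (std_atlas_ok _) oW openT (fun _ _ => I) sg sf).
Qed.

Lemma smooth_translate f (h : G) : smooth_fun AG f -> smooth_fun AG (fun g => f (h * g)%g).
Proof.
move=> sf; apply: (smooth_fun_comp (g := fun g => (h * g)%g) okG openT sf).
by apply: smooth_mul; [exact: okG|exact: openT|exact: smooth_cst|exact: smooth_id].
Qed.

Context (c : chart G 'rV[R]_n) (Ac : AG c) (c1 : chart_dom c 1%g).

Let u0 := chart_to c 1%g.
Let e := chart_from c.

Lemma unit_chart : [/\ open (chart_dom c), open (chart_cod c), chart_cod c u0 &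
  e u0 = 1%g].
Proof.
by have [od oc /(_ _ c1)[? ? _] _] := atlas_chart okG Ac; split.
Qed.

(** The left-invariant field whose value at 1 has coordinates [v] in the chart [c]. *)
Definition left_field (v : 'rV[R]_n) : vfield R G :=
  fun f h => 'D_v (fun u => f (h * e u)%g) u0.

Lemma left_field_kernel_smooth f : smooth_fun AG f ->
  smooth_map_on (prod_atlas AG (@std_atlas 'rV[R]_n)) (@std_atlas R)
    (setT `*` chart_cod c) (fun z => f (z.1 * e z.2)%g).
Proof.
have [_ oc _ _] := unit_chart.
have oW : open ([set: G] `*` chart_cod c) by apply: open_setX => //; exact: openT.
have okP := prod_atlas_ok bn bn okG (std_atlas_ok 'rV[R]_n).
move=> sf; apply: (smooth_fun_comp (g := fun z => (z.1 * e z.2)%g) okP oW sf).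
have s1 := @smooth_fst _ _ _ _ _ bn _ _ (setT `*` chart_cod c) okG (std_atlas_ok 'rV[R]_n).
have s2 := @smooth_snd _ _ _ _ _ bn _ _ (setT `*` chart_cod c) okG (std_atlas_ok 'rV[R]_n).
have s3 := smooth_comp bn bn okP (std_atlas_ok _) okG oW oc (fun x Wx => proj2 Wx) s2
  (smooth_chart_from okG Ac).
exact: (smooth_mul okP oW s1 s3).
Qed.

Lemma left_field_Ck f h k : smooth_fun AG f ->
  Ck_on k (chart_cod c) (fun u => f (h * e u)%g).
Proof.
have [_ oc _ _] := unit_chart => sf; move: k; apply/smooth_std.
apply: (smooth_fun_comp (g := fun u => (h * e u)%g) (std_atlas_ok _) oc sf).
by apply: smooth_mul => //; [exact: std_atlas_ok|exact: smooth_cst|exact: smooth_chart_from].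
Qed.

Lemma left_field_derivable f h v : smooth_fun AG f ->
  derivable (fun u => f (h * e u)%g) u0 v.
Proof.
have [_ oc cu0 _] := unit_chart.
by move=> /(left_field_Ck h 1)[_ /(_ v)[d _]]; exact: d.
Qed.

Lemma left_field_linear f h a v w : smooth_fun AG f ->
  left_field (a *: v + w) f h = a * left_field v f h + left_field w f h.
Proof.
have [_ oc cu0 _] := unit_chart.
by move=> /(left_field_Ck h 1) Cf; exact: (derive_linear bn a v w oc cu0 Cf).
Qed.

Lemma left_invariant_left_field v : left_invariant AG (left_field v).
Proof.
have [_ oc cu0 eu0] := unit_chart; split.
- move=> f sf.
  exact: (smooth_partial bn bn v okG openT oc cu0 (left_field_kernel_smooth sf)).
- move=> a f g sf sg; apply/funext => h; rewrite /left_field.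
  have df : derivable (fun u => f (h * e u)%g) u0 v by exact: left_field_derivable.
  have dg : derivable (fun u => g (h * e u)%g) u0 v by exact: left_field_derivable.
  have := deriveD (derivableZ (k := a) df) dg; rewrite deriveZ //; exact.
- move=> f g sf sg; apply/funext => h; rewrite /left_field.
  have df : derivable (fun u => f (h * e u)%g) u0 v by exact: left_field_derivable.
  have dg : derivable (fun u => g (h * e u)%g) u0 v by exact: left_field_derivable.
  have := deriveM df dg; rewrite eu0 mulg1 => E.
  rewrite -[LHS]/('D_v ((fun u => f (h * e u)%g) * (fun u => g (h * e u)%g)) u0) E.
  by rewrite addrC; congr (_ + _); exact: mulrC.
- move=> k f sf; apply/funext => h; rewrite /left_field.
  by congr ('D_v _ u0); apply/funext => u; rewrite mulgA.
Qed.

Definition velocity (eta : R -> G) : 'rV[R]_n := 'D_1 (chart_to c \o eta) 0.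

Lemma curve_chart_Ck (W : set R) eta k : open W -> W 0 -> eta 0 = 1%g ->
  smooth_map_on (@std_atlas R) AG W eta ->
  exists2 W', open W' /\ W' 0 & (forall t, W' t -> W t /\ chart_dom c (eta t)) /\
     Ck_on k W' (chart_to c \o eta).
Proof.
have [od oc cu0 eu0] := unit_chart.
move=> oW W0 e0 se; exists (W `&` eta @^-1` chart_dom c).
  split; last by split; rewrite //= e0.
  by apply: open_preimage_on => //; case: se.
split => //; move: k; apply/smooth_std.
apply: (smooth_comp bn bn (std_atlas_ok _) okG (std_atlas_ok _) _ od _ _ (smooth_chart_to okG Ac)).
- by apply: open_preimage_on => //; case: se.
- by move=> t [].
- by apply: smooth_sub se => t [].
Qed.

(** Close to 0 the curve stays in the chart domain, where it factors through its coordinates; by the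
    chain rule only its velocity at 0 matters. Any smooth curve through 1 can thus stand in for a
    one-parameter subgroup. *)
Lemma left_field_curve (W : set R) eta f h : open W -> W 0 -> eta 0 = 1%g ->
  smooth_map_on (@std_atlas R) AG W eta -> smooth_fun AG f ->
  is_derive (0 : R) 1 (fun t => f (h * eta t)%g) (left_field (velocity eta) f h).
Proof.
have [od oc cu0 eu0] := unit_chart.
move=> oW W0 e0 se sf; have [W' [oW' W'0] [W'P Ck]] := curve_chart_Ck 1 oW W0 e0 se.
have dk : derivable (chart_to c \o eta) 0 1 by exact: (Ck.2 1).1.
have cu0' : chart_cod c ((chart_to c \o eta) 0) by rewrite /= e0.
have := derive_comp_frame bn oc cu0' (left_field_Ck h 1 sf) dk.
have [_ <-] := C1_differentiable bn oc cu0' (left_field_Ck h 1 sf).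
rewrite [(chart_to c \o eta) 0]/= e0; apply: near_eq_is_derive.
near=> t; have [_ ct] : W t /\ chart_dom c (eta t).
  by apply: W'P; near: t; exact: open_nbhs_nbhs.
by have [_ _ /(_ _ ct)[_ E _] _] := atlas_chart okG Ac; rewrite /= /e E.
Unshelve. all: by end_near. Qed.

Lemma is_exp_unit X gamma : is_exp AG X gamma -> gamma 0 = 1%g.
Proof.
by move=> [_ gm _]; have := gm 0 0; rewrite addr0 => /(congr1 (fun g => (gamma 0)^-1 * g)%g); rewrite mulKg mulVg.
Qed.

(** The abstract derivation is reached through its one-parameter subgroup: left invariance moves the
    base point [h] to 1, and [exp_velocity] evaluates the field there. Fields can then be handled as
    tangent vectors. *)
Lemma generator_left_field X gamma f : left_invariant AG X -> is_exp AG X gamma ->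
  smooth_fun AG f -> X f = left_field (velocity gamma) f.
Proof.
move=> lX eX sf; apply/funext => h.
have [sg gm gv] := eX; have g0 := is_exp_unit eX.
have := vfield_left_invariant lX h sf => /(congr1 (fun F => F 1%g)); rewrite mulg1 => <-.
rewrite -(gv _ (smooth_translate h sf)) derive1E.
by have [_ ->] := left_field_curve h openT I g0 sg sf.
Qed.

End lie_group.

Section axes.
Context {R : realType} {F : normedModType R}.

Lemma derive_snd (q : R * R -> F) (t : R) :
  'D_(0, 1) q (t, 0) = 'D_1 (fun s : R => q (t, s)) 0.
Proof.
have E : (fun s : R => q (s *: (0, 1) + (t, 0))) = (fun s : R => q (t, s)).
  apply/funext => s; congr q; congr pair; rewrite /= ?addr0; last exact: mulr1.
  by rewrite [X in X + _](_ : _ = 0) ?add0r //; exact: mulr0.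
by rewrite -derive_along E.
Qed.

Lemma derive_fst (q : R * R -> F) (s : R) :
  'D_(1, 0) q (0, s) = 'D_1 (fun t : R => q (t, s)) 0.
Proof.
have E : (fun t : R => q (t *: (1, 0) + (0, s))) = (fun t : R => q (t, s)).
  apply/funext => t; congr q; congr pair; rewrite /= ?addr0; first exact: mulr1.
  by rewrite [X in X + _](_ : _ = 0) ?add0r //; exact: mulr0.
by rewrite -derive_along E.
Qed.

End axes.

(** * Linear subspaces of row vectors *)

Section subspaces.
Context {R : realType}.

(* A subspace of ['rV_n] given as a predicate is the kernel of a matrix: take the
   cokernel of a matrix of maximal rank with rows in the subspace. *)
Lemma subspace_kernel n (S : 'rV[R]_n -> Prop) : S 0 ->
  (forall a v w, S v -> S w -> S (a *: v + w)) ->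
  exists m (K : 'M[R]_(n, m)), forall v, S v <-> v *m K = 0.
Proof.
move=> S0 Sl.
pose Q r := `[< exists k (B : 'M[R]_(k, n)), (forall i, S (row i B)) /\ \rank B = r >].
have Q0 : exists r, Q r.
  exists 0%N; apply/asboolP; exists 0%N, 0; split; first by case.
  by rewrite mxrank0.
have Qn r : Q r -> (r <= n)%N.
  by move=> /asboolP[k [B [_ <-]]]; exact: rank_leq_col.
case: (ex_maxnP Q0 Qn) => r /asboolP[k [B [SB rB]]] rmax.
have Ssum (I : finType) (F : I -> 'rV[R]_n) : (forall i, S (F i)) -> S (\sum_i F i).
  by move=> SF; elim/big_ind: _ => // v w Sv Sw; rewrite -[v]scale1r; exact: Sl.
have Ssub v : (v <= B)%MS -> S v.
  case/submxP => D ->; rewrite mulmx_sum_row; apply: Ssum => i.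
  by rewrite -[_ *: _]addr0; exact: Sl.
exists n, (cokermx B) => v; split; last by move/eqP; rewrite -submxE => /Ssub.
move=> Sv; apply/eqP; rewrite -submxE; apply/negPn/negP => nvB.
have : Q (\rank (col_mx B v)).
  apply/asboolP; exists (k + 1)%N, (col_mx B v); split => // i.
  case: (split_ordP i) => j ->; first by rewrite rowKu.
  by rewrite rowKd ord1 row_id.
move/rmax; rewrite -rB => le.
have BB : (B <= col_mx B v)%MS by rewrite -addsmxE addsmxSl.
have E : (B == col_mx B v)%MS by rewrite -(mxrank_leqif_eq BB).2 eqn_leq le mxrankS.
by move: nvB; rewrite (eqmxP E) -addsmxE addsmxSr.
Qed.

Lemma mulmx_packed n m (K : 'M[R]_(n, m)) j : exists2 L : {linear 'rV[R]_n -> R^o},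
  continuous L & forall v, L v = (v *m K) 0 j.
Proof.
have [en [eE cE]] := @frame_rVE R n.
have [L cL LE] := frame_linear (fun i => K (cast_ord en i) j).
exists L => // v; rewrite LE mxE [RHS](reindex (cast_ord en)) /=; last first.
  by exists (cast_ord (esym en)) => i _; rewrite (cast_ordK, cast_ordKV).
by apply: eq_bigr => i _; rewrite cE.
Qed.

End subspaces.

(** * Directions along which the displacement is bounded *)

Section good_directions.
Context (R : realType) (n : nat) (G : groupTopologicalType)
  (AG : set (chart G 'rV[R]_n)) (G_lie : is_lie_group AG).
Context (c : chart G 'rV[R]_n) (Ac : AG c) (c1 : chart_dom c 1%g).
(* [bd C g] abstracts the property N(g) <= C. *)
Context (bd : R -> G -> Prop).
Context (bd_mul : forall C C' g h, bd C g -> bd C' h -> bd (C + C') (g * h)%g)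
  (bd_one : bd 0 1%g).

Let okG := lie_atlas_ok G_lie.
Let bn := @frame_rV R n.
Let b2 := frame_prod (@frame_R R) (@frame_R R).
Local Notation vel := (velocity c).

Definition disk (d : R) : set R := [set t | `|t| < d].

Lemma open_disk d : open (disk d).
Proof.
rewrite (_ : disk d = ball_ Num.Def.normr 0 d); last first.
  by apply/seteqP; split => t; rewrite /disk /ball_ /= sub0r normrN.
exact: ball_open.
Qed.

Lemma disk0 d : 0 < d -> disk d 0. Proof. by rewrite /disk /= normr0. Qed.

Definition good (y : 'rV[R]_n) : Prop := exists d C eta,
  [/\ 0 < d, smooth_map_on (@std_atlas R) AG (disk d) eta, eta 0 = 1%g,
      vel eta = y & forall t, disk d t -> bd C (eta t)].

Lemma smooth_read (E : normedModType R) (W : set E) (g : E -> G) : open W ->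
  smooth_map_on (@std_atlas E) AG W g ->
  open (W `&` g @^-1` chart_dom c) /\
  smooth_on (W `&` g @^-1` chart_dom c) (chart_to c \o g).
Proof.
have [od _ _ _] := unit_chart G_lie Ac c1.
move=> oW sg; have oS : open (W `&` g @^-1` chart_dom c).
  by apply: open_preimage_on => //; case: sg.
split => //; apply/smooth_std.
apply: (smooth_comp bn bn (std_atlas_ok _) okG (std_atlas_ok _) oS od _ _ (smooth_chart_to okG Ac)).
  by move=> x [].
by apply: smooth_sub sg => x [].
Qed.

Lemma smooth_precomp (M : topologicalType) (E F : normedModType R) (bF : frame F)
    (A : set (chart M E)) (L : M -> F) (W : set F) (g : F -> G) :
  atlas_ok A -> smooth_map A (@std_atlas F) L -> open W ->
  smooth_map_on (@std_atlas F) AG W g ->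
  open (L @^-1` W) /\ smooth_map_on A AG (L @^-1` W) (g \o L).
Proof.
move=> okA sL oW sg; have oLW : open (L @^-1` W).
  rewrite -[L @^-1` W]setTI; apply: open_preimage_on => //; first exact: openT.
  by case: sL.
split => //; apply: (smooth_comp bF bn okA (std_atlas_ok _) okG oLW oW _ _ sg) => //.
by apply: smooth_sub sL.
Qed.

Lemma smooth_fst2 : smooth_map (@std_atlas (R * R)%type) (@std_atlas R) fst.
Proof. by apply/smooth_std => k; exact: Ck_on_fst. Qed.

Lemma smooth_snd2 : smooth_map (@std_atlas (R * R)%type) (@std_atlas R) snd.
Proof. by apply/smooth_std => k; exact: Ck_on_snd. Qed.

Lemma good0 : good 0.
Proof.
exists 1, 0, (fun=> 1%g); split => //; first exact: smooth_cst.
exact: derive_cst.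
Qed.

Lemma good_scale a y : good y -> good (a *: y).
Proof.
move=> [d [C [eta [d0 se e0 <- be]]]].
have [L cL LE] := scalel_packed (a : R^o).
have sL : smooth_map (@std_atlas R) (@std_atlas R) L.
  by apply/smooth_std => k; exact: Ck_on_linear.
have [oW sW] := smooth_precomp frame_R (std_atlas_ok R) sL (@open_disk d) se.
have na : 0 < `|a| + 1 by rewrite ltr_wpDl.
have sub : disk (d / (`|a| + 1)) `<=` L @^-1` disk d.
  move=> t; rewrite /disk /= LE => td; rewrite normrM.
  apply: le_lt_trans (_ : `|t| * (`|a| + 1) < _); first by rewrite ler_wpM2l // lerDl.
  by rewrite -ltr_pdivlMr.
have L0 : L 0 = 0 by exact: linear0.
exists (d / (`|a| + 1)), C, (eta \o L); split.
- by rewrite divr_gt0.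
- exact: smooth_sub sub sW.
- by rewrite /= L0.
- have [oS sS] := smooth_read (@open_disk d) se.
  have S0 : (disk d `&` eta @^-1` chart_dom c) 0 by split; [exact: disk0|rewrite /= e0].
  have := derive_linear_rV frame_R a 1 0 oS S0 (sS 1%N).
  rewrite derive0 !addr0 => <-; rewrite -derive_along.
  have E : (chart_to c \o (eta \o L)) = (fun t : R => (chart_to c \o eta) (t *: (a *: 1) + 0)).
    by apply/funext => t; rewrite /= LE addr0; congr (chart_to c (eta (_ *: _))); rewrite [RHS]mulr1.
  by rewrite /velocity E.
- by move=> t /sub; exact: be.
Qed.

(** The pointwise product of the two curves works: [derive_diagonal], applied to [eta t * sig s],
    shows that its velocity is the sum of the velocities, and [bd_mul] adds the bounds. *)
Lemma good_add y z : good y -> good z -> good (y + z).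
Proof.
move=> [d [C [eta [d0 se e0 <- be]]]] [d' [C' [sig [d0' ss s0 <- bs]]]].
have [oA sA] := smooth_precomp frame_R (std_atlas_ok _) smooth_fst2 (@open_disk d) se.
have [oB sB] := smooth_precomp frame_R (std_atlas_ok _) smooth_snd2 (@open_disk d') ss.
have oW := openI oA oB.
have sq := smooth_mul G_lie (std_atlas_ok _) oW
  (smooth_sub (@subIsetl _ _ _) sA) (smooth_sub (@subIsetr _ _ _) sB).
have [oS sS] := smooth_read oW sq.
exists (Num.min d d'), (C + C'), (fun t => eta t * sig t)%g; split.
- by rewrite lt_min d0.
- apply: smooth_mul => //; [exact: std_atlas_ok|exact: open_disk| |].
    by apply: smooth_sub se => t; rewrite /disk /= lt_min => /andP[].
  by apply: smooth_sub ss => t; rewrite /disk /= lt_min => /andP[].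
- by rewrite e0 s0 mulg1.
- have S0 : ((fst @^-1` disk d `&` snd @^-1` disk d') `&`
      (fun x => eta x.1 * sig x.2)%g @^-1` chart_dom c) (0, 0).
    by do 2?split; rewrite /= ?e0 ?s0 ?mulg1; do ?exact: disk0.
  have := derive_linear_rV b2 1 (1, 0) (0, 1) oS S0 (sS 1%N).
  rewrite !scale1r => /derive_diagonal E.
  have E1 : (fun t : R => (chart_to c \o (fun x => eta x.1 * sig x.2)%g) (t, 0)) = chart_to c \o eta.
    by apply/funext => t /=; rewrite s0 mulg1.
  have E2 : (fun t : R => (chart_to c \o (fun x => eta x.1 * sig x.2)%g) (0, t)) = chart_to c \o sig.
    by apply/funext => t /=; rewrite e0 mul1g.
  by rewrite E1 E2 in E.
- by move=> t; rewrite /disk /= lt_min => /andP[td td']; apply: bd_mul; [exact: be|exact: bs].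
Qed.

End good_directions.

(** * Brackets as derivatives of conjugated curves *)

Section brackets.
Context (R : realType) (n : nat) (G : groupTopologicalType)
  (AG : set (chart G 'rV[R]_n)) (G_lie : is_lie_group AG).
Context (c : chart G 'rV[R]_n) (Ac : AG c) (c1 : chart_dom c 1%g).
Context (bd : R -> G -> Prop).
Context (bd_mul : forall C C' g h, bd C g -> bd C' h -> bd (C + C') (g * h)%g)
  (bd_inv : forall C g, bd C g -> bd C g^-1%g) (bd_one : bd 0 1%g).

Let okG := lie_atlas_ok G_lie.
Let bn := @frame_rV R n.
Let b2 := frame_prod (@frame_R R) (@frame_R R).
Local Notation vel := (velocity c).
Local Notation lfield := (left_field c).
Local Notation is_good := (good AG c bd).

Lemma good_linear a v w : is_good v -> is_good w -> is_good (a *: v + w).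
Proof. by move=> gv gw; apply: good_add => //; apply: good_scale. Qed.

(* [good] is closed, being the kernel of a matrix. *)
Lemma good_derivative (W : set R) (w : R -> 'rV[R]_n) : open W -> W 0 ->
  (forall t, W t -> is_good (w t)) -> derivable w 0 1 -> is_good ('D_1 w 0).
Proof.
move=> oW W0 gw dw.
have [m [K KP]] := subspace_kernel (@good0 _ _ _ AG c bd bd_one) good_linear.
apply/KP/rowP => j; have [L cL LE] := mulmx_packed K j.
rewrite -LE mxE; have [_ <-] := is_derive_linear_comp cL dw.
transitivity ('D_1 (cst (0 : R^o)) (0 : R)); last exact: derive_cst.
apply: near_eq_derive; near=> t; rewrite /= LE (_ : w t *m K = 0) ?mxE //.
by apply/KP/gw; near: t; exact: open_nbhs_nbhs.
Unshelve. all: by end_near. Qed.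

Context (d d' : R) (eta sig : R -> G).
Context (d0 : 0 < d) (d0' : 0 < d').
Context (eta_smooth : smooth_map_on (@std_atlas R) AG (disk d) eta)
  (sig_smooth : smooth_map_on (@std_atlas R) AG (disk d') sig)
  (eta0 : eta 0 = 1%g) (sig0 : sig 0 = 1%g).

(** [w t] is Ad([eta t]) applied to the velocity of [sig]; its derivative at 0 will be the bracket
    of the two velocities. *)
Let K t s := (eta t * sig s * (eta t)^-1)%g.
Let w t := vel (K t).

Lemma conj_curve_smooth t : smooth_map_on (@std_atlas R) AG (disk d') (K t).
Proof.
have okR := std_atlas_ok R; have od := @open_disk R d'.
apply: (smooth_mul G_lie okR od); last exact: smooth_cst.
by apply: (smooth_mul G_lie okR od) => //; exact: smooth_cst.
Qed.

Lemma conj_curve0 t : K t 0 = 1%g.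
Proof. by rewrite /K sig0 mulg1 mulgV. Qed.

(** [w t] is the partial derivative in [s], at [(t, 0)], of the two-variable map [K] read in the
    chart; class 2 of that map is used to get class 1. *)
Lemma conj_velocity_Ck : Ck_on 1 (disk d) w.
Proof.
have [oA sA] := smooth_precomp G_lie frame_R (std_atlas_ok _) (@smooth_fst2 R) (@open_disk _ d) eta_smooth.
have [oB sB] := smooth_precomp G_lie frame_R (std_atlas_ok _) (@smooth_snd2 R) (@open_disk _ d') sig_smooth.
have oW := openI oA oB.
have sA' := smooth_sub (@subIsetl _ (fst @^-1` disk d) (snd @^-1` disk d')) sA.
have sB' := smooth_sub (@subIsetr _ (fst @^-1` disk d) (snd @^-1` disk d')) sB.
have ok2 := std_atlas_ok (R * R)%type.
have sq := smooth_mul G_lie ok2 oW (smooth_mul G_lie ok2 oW sA' sB') (smooth_inv G_lie ok2 oW sA').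
pose q (x : R * R) := K x.1 x.2.
pose S := (fst @^-1` disk d `&` snd @^-1` disk d') `&` q @^-1` chart_dom c.
have [oS sS] : open S /\ smooth_on S (chart_to c \o q) := smooth_read G_lie Ac c1 oW sq.
have CD : Ck_on 1 S ('D_(0, 1) (chart_to c \o q)) := ((sS 2%N).2 (0, 1)).2.
have pc : Ck_on 1 (disk d) (fun t : R => (t, 0 : R)).
  by apply: Ck_on_pair; [exact: open_disk|exact: Ck_on_id|exact: Ck_on_cst].
have sub t : disk d t -> S (t, 0).
  move=> dt; do 2?split => //; first exact: disk0.
  by rewrite /q /= conj_curve0.
have H := Ck_on_comp b2 bn (@open_disk _ d) oS sub CD pc.
apply: Ck_on_eq (@open_disk _ d) _ H => t dt.
by rewrite /= derive_snd.
Qed.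

(** The identity [eta t * sig s = K t s * eta t] gives two readings of the derivative in [s], at 0,
    of f(h eta(t) sig(s)). On the left, differentiating in [t] yields the first iterated field. On
    the right [t] occurs twice and the product rule yields two terms: varying it in [K] gives the
    field of ['D_1 w 0], varying it in the last factor gives the other iterated field, up to the
    order of differentiation. *)
Lemma bracket_left_field f h : smooth_fun AG f ->
  lfield (vel eta) (lfield (vel sig) f) h -
  lfield (vel sig) (lfield (vel eta) f) h =
  lfield ('D_1 w 0) f h.
Proof.
move=> sf; pose y := vel eta; pose z := vel sig.
have okR := std_atlas_ok R; have ok2 := std_atlas_ok (R * R)%type.
have ok3 := prod_atlas_ok b2 frame_R ok2 okR.
have od := @open_disk R d; have od' := @open_disk R d'.
have D0 := disk0 d0; have D0' := disk0 d0'.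
have sYf v : smooth_fun AG (lfield v f).
  exact: vfield_smooth (left_invariant_left_field G_lie Ac c1 v) _ sf.
(* The two occurrences of [t] become the independent variables [x.1.1] and [x.1.2]; [x.2] is [s]. *)
pose T (x : (R * R) * R) := f (h * (K x.1.1 x.2 * eta x.1.2))%g.
pose W : set (R * R) := disk d `*` disk d.
have oW : open W by exact: open_setX.
have oWV : open (W `*` disk d') by exact: open_setX.
have sfst : smooth_map (prod_atlas (@std_atlas (R * R)%type) (@std_atlas R)) (@std_atlas (R * R)%type) fst.
  exact: (@smooth_fst _ _ _ _ _ b2).
have ssnd : smooth_map (prod_atlas (@std_atlas (R * R)%type) (@std_atlas R)) (@std_atlas R) snd.
  exact: (@smooth_snd _ _ _ _ _ frame_R).
have s11 : smooth_map (prod_atlas (@std_atlas (R * R)%type) (@std_atlas R)) (@std_atlas R) (fst \o fst).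
  exact: (smooth_comp b2 frame_R ok3 ok2 okR openT openT (fun _ _ => I) sfst (@smooth_fst2 R)).
have s12 : smooth_map (prod_atlas (@std_atlas (R * R)%type) (@std_atlas R)) (@std_atlas R) (snd \o fst).
  exact: (smooth_comp b2 frame_R ok3 ok2 okR openT openT (fun _ _ => I) sfst (@smooth_snd2 R)).
have se1 : smooth_map_on (prod_atlas (@std_atlas (R * R)%type) (@std_atlas R)) AG (W `*` disk d') (eta \o (fst \o fst)).
  have [_] := smooth_precomp G_lie frame_R ok3 s11 od eta_smooth.
  by apply: smooth_sub => x [[? _] _].
have se2 : smooth_map_on (prod_atlas (@std_atlas (R * R)%type) (@std_atlas R)) AG (W `*` disk d') (eta \o (snd \o fst)).
  have [_] := smooth_precomp G_lie frame_R ok3 s12 od eta_smooth.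
  by apply: smooth_sub => x [[_ ?] _].
have ss : smooth_map_on (prod_atlas (@std_atlas (R * R)%type) (@std_atlas R)) AG (W `*` disk d') (sig \o snd).
  have [_] := smooth_precomp G_lie frame_R ok3 ssnd od' sig_smooth.
  by apply: smooth_sub => x [_ ?].
have sT : smooth_map_on (prod_atlas (@std_atlas (R * R)%type) (@std_atlas R)) (@std_atlas R) (W `*` disk d') T.
  have sK := smooth_mul G_lie ok3 oWV (smooth_mul G_lie ok3 oWV se1 ss) (smooth_inv G_lie ok3 oWV se1).
  have sP := smooth_mul G_lie ok3 oWV (smooth_cst _ _ _ h) (smooth_mul G_lie ok3 oWV sK se2).
  exact: (smooth_fun_comp G_lie ok3 oWV sf sP).
have /smooth_std/(_ 1%N) Cg := smooth_partial b2 frame_R 1 ok2 oW od' D0' sT.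
pose g := fun x : R * R => 'D_1 (fun s : R => T (x, s)) 0.
have W0 : W (0, 0) by split.
have := derive_linear b2 1 (1, 0) (0, 1) oW W0 Cg.
rewrite scale1r mul1r => /derive_diagonal; rewrite -/g.
have -> : (fun t : R => g (t, t)) = (fun t => lfield z f (h * eta t)%g).
  apply/funext => t; rewrite /g /T /=.
  have [_ <-] := left_field_curve G_lie Ac c1 (h * eta t)%g od' D0' sig0 sig_smooth sf.
  have E : (fun s : R => f (h * (K t s * eta t))%g) = (fun s => f (h * eta t * sig s)%g).
    by apply/funext => s; rewrite /K mulgVK mulgA.
  by rewrite E.
have [_ ->] := left_field_curve G_lie Ac c1 h od D0 eta0 eta_smooth (sYf z).
move=> ->.
have -> : 'D_1 (fun t : R => g (t, 0)) 0 = lfield ('D_1 w 0) f h.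
  have [_ oc cu0 eu0] := unit_chart G_lie Ac c1.
  have [_ DE] := C1_differentiable bn oc cu0 (left_field_Ck G_lie Ac c1 h 1 sf).
  have [L cL LE] := frame_linear (fun i => lfield (frame_vec bn i) f h).
  have dw : derivable w 0 1 by have [_ /(_ 1)[dw _]] := conj_velocity_Ck; exact: dw.
  have LY v : L v = lfield v f h by rewrite LE /left_field DE.
  rewrite -LY; have [_ <-] := is_derive_linear_comp cL dw.
  apply: near_eq_derive; near=> t; rewrite /= LY /g /T /=.
  have [_ <-] := left_field_curve G_lie Ac c1 h od' D0' (conj_curve0 t) (conj_curve_smooth t) sf.
  have E : (fun s : R => f (h * (K t s * eta 0))%g) = (fun s => f (h * K t s)%g).
    by apply/funext => s; rewrite eta0 mulg1.
  by rewrite E.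
have -> : 'D_1 (fun r : R => g (0, r)) 0 = lfield z (lfield y f) h.
  pose p (x : R * R) := f (h * (sig x.2 * eta x.1))%g.
  have oS : open (disk d `*` disk d') by exact: open_setX.
  have Cp : Ck_on 2 (disk d `*` disk d') p.
    have [oA sA] := smooth_precomp G_lie frame_R ok2 (@smooth_fst2 R) od eta_smooth.
    have [oB sB] := smooth_precomp G_lie frame_R ok2 (@smooth_snd2 R) od' sig_smooth.
    have sA' : smooth_map_on (@std_atlas (R * R)%type) AG (disk d `*` disk d') (eta \o fst).
      by apply: smooth_sub sA => x [].
    have sB' : smooth_map_on (@std_atlas (R * R)%type) AG (disk d `*` disk d') (sig \o snd).
      by apply: smooth_sub sB => x [].
    have sP := smooth_mul G_lie ok2 oS (smooth_cst _ _ _ h) (smooth_mul G_lie ok2 oS sB' sA').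
    by have /smooth_std/(_ 2%N) := smooth_fun_comp G_lie ok2 oS sf sP.
  have S0 : (disk d `*` disk d') (0, 0) by split.
  (* The term comes with the derivative in [s] innermost, whereas [lfield z (lfield y f)]
     differentiates along [eta] first. *)
  have := schwarz b2 (1, 0) (0, 1) oS S0 Cp; rewrite derive_fst derive_snd.
  have -> : (fun t : R => 'D_(0, 1) p (t, 0)) = (fun r : R => g (0, r)).
    apply/funext => r; rewrite derive_snd /g /T /p /=.
    have E : (fun s : R => f (h * (K 0 s * eta r))%g) = (fun s => f (h * (sig s * eta r))%g).
      by apply/funext => s; rewrite /K eta0 mul1g invg1 mulg1.
    by rewrite E.
  have -> : (fun s : R => 'D_(1, 0) p (0, s)) = (fun s => lfield y f (h * sig s)%g).
    apply/funext => s; rewrite derive_fst /p /=.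
    have [_ <-] := left_field_curve G_lie Ac c1 (h * sig s)%g od D0 eta0 eta_smooth sf.
    have E : (fun t : R => f (h * (sig s * eta t))%g) = (fun t => f (h * sig s * eta t)%g).
      by apply/funext => t; rewrite mulgA.
    by rewrite E.
  by have [_ ->] := left_field_curve G_lie Ac c1 h od' D0' sig0 sig_smooth (sYf y).
by rewrite addrK.
Unshelve. all: by end_near. Qed.

End brackets.

Section span.
Context (R : realType) (n : nat) (G : groupTopologicalType)
  (AG : set (chart G 'rV[R]_n)) (G_lie : is_lie_group AG).
Context (c : chart G 'rV[R]_n) (Ac : AG c) (c1 : chart_dom c 1%g).
Context (bd : R -> G -> Prop).
Context (bd_mul : forall C C' g h, bd C g -> bd C' h -> bd (C + C') (g * h)%g)
  (bd_inv : forall C g, bd C g -> bd C g^-1%g) (bd_one : bd 0 1%g).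

(** For each [t] the conjugated curve is bounded by [C + C' + C], so every [w t] is good, and
    [good_derivative] passes to the derivative at 0. *)
Lemma good_bracket y z : good AG c bd y -> good AG c bd z ->
  exists2 w, good AG c bd w & forall f h, smooth_fun AG f ->
    left_field c y (left_field c z f) h - left_field c z (left_field c y f) h =
    left_field c w f h.
Proof.
move=> [d [C [eta [d0 se e0 <- be]]]] [d' [C' [sig [d0' ss s0 <- bs]]]].
pose w t := velocity c (fun s => eta t * sig s * (eta t)^-1)%g.
exists ('D_1 w 0) => [|f h sf]; last exact: (bracket_left_field G_lie Ac c1 d0 d0').
apply: (good_derivative G_lie Ac c1 bd_mul bd_one (@open_disk _ d) (disk0 d0)); last first.
  by have [_ /(_ 1)[dw _]] := conj_velocity_Ck G_lie Ac c1 d0' se ss s0; apply: dw; exact: disk0.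
move=> t dt; exists d', (C + C' + C), (fun s => eta t * sig s * (eta t)^-1)%g; split => //.
- exact: conj_curve_smooth.
- by rewrite s0 mulg1 mulgV.
- by move=> s ds; do 2?apply: bd_mul; [exact: be|exact: bs|apply: bd_inv; exact: be].
Qed.

(** Fields are compared on smooth functions only, in accordance with [lie_span_ext]; the bracket
    case therefore needs that left-invariant fields preserve smoothness. *)
Lemma lie_span_good (d : nat) (A : 'I_d -> vfield R G) (gamma : 'I_d -> R -> G) :
  (forall i, left_invariant AG (A i)) -> (forall i, is_exp AG (A i) (gamma i)) ->
  (forall i, exists C, forall t, `|t| < 1 -> bd C (gamma i t)) ->
  forall Y, lie_span AG A Y ->
  exists2 y, good AG c bd y & forall f, smooth_fun AG f -> Y f = left_field c y f.
Proof.
move=> lA eA bA Y; elim.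
- move=> i; exists (velocity c (gamma i)).
    have [C bC] := bA i; exists 1, C, (gamma i); split => //.
      by apply: smooth_sub (exp_smooth (eA i)).
    exact: is_exp_unit (eA i).
  by move=> f sf; exact: (generator_left_field G_lie Ac c1 (lA i) (eA i) sf).
- exists 0; first exact: good0.
  by move=> f sf; apply/funext => h; rewrite /left_field derive0.
- move=> a X Z _ [x gx Xx] _ [z gz Zz]; exists (a *: x + z).
    exact: (good_linear G_lie Ac c1 bd_mul).
  move=> f sf; apply/funext => h.
  by rewrite (left_field_linear G_lie Ac c1) // Xx // Zz.
- move=> X Z _ [x gx Xx] _ [z gz Zz].
  have [w gw wP] := good_bracket gx gz.
  have sY v f : smooth_fun AG f -> smooth_fun AG (left_field c v f).
    by move=> sf; exact: vfield_smooth (left_invariant_left_field G_lie Ac c1 v) _ sf.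
  exists w => // f sf; apply/funext => h.
  by rewrite (Xx _ sf) (Zz _ sf) Xx ?Zz ?wP //; exact: sY.
- by move=> X Z XZ _ [x gx Xx]; exists x => // f sf; rewrite -XZ // Xx.
Qed.

End span.

(** * Bump functions *)

Section flat.
Context {R : realType}.

(** The functions P(1/x) exp(-1/x), extended by 0. The polynomial is a parameter so that the family
    is closed under differentiation; [flat 1] is the usual flat function. *)
Definition flat (P : {poly R}) (x : R) : R :=
  if 0 < x then P.[x^-1] * expR (- x^-1) else 0.

(** Each factor [y] is paid for by half of the exponent, through y <= (2/a) exp(a y / 2); hence the
    induction has to range over all positive [a]. *)
Lemma horner_expR_bound (P : {poly R}) (a : R) : 0 < a ->
  exists2 C, 0 <= C & forall y, 0 <= y -> `|P.[y]| <= C * expR (a * y).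
Proof.
elim/poly_ind: P a => [|P k IH] a a0.
  by exists 0 => // y _; rewrite horner0 normr0 mul0r.
have a20 : 0 < a / 2 by rewrite divr_gt0.
have [C C0 CP] := IH _ a20.
exists (C * (2 / a) + `|k|) => [|y y0].
  by rewrite addr_ge0 // mulr_ge0 // divr_ge0 // ltW.
rewrite hornerMXaddC mulrDl (le_trans (ler_normD _ _)) // lerD //; last first.
  by rewrite ler_peMr // -expR0 ler_expR mulr_ge0 // ltW.
rewrite normrM (ger0_norm y0).
have -> : a * y = a / 2 * y + a / 2 * y by field.
rewrite expRD.
have ye : y <= 2 / a * expR (a / 2 * y).
  rewrite [leLHS](_ : y = 2 / a * (a / 2 * y)); last by field; rewrite gt_eqF.
  by rewrite ler_wpM2l ?divr_ge0 ?(ltW a0) //; apply: le_trans (expR_ge1Dx _); rewrite lerDr.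
apply: le_trans (_ : (C * expR (a / 2 * y)) * (2 / a * expR (a / 2 * y)) <= _).
  by apply: ler_pM => //; exact: CP.
by rewrite le_eqVlt; apply/orP; left; apply/eqP; ring.
Qed.

(** Boundedness of (1/x) P(1/x) exp(-1/x), that is the previous lemma for ['X * P], becomes a bound
    linear in |x|, which is what makes difference quotients at 0 vanish in the limit. *)
Lemma flat_bound P : exists2 C, 0 <= C & forall x, `|flat P x| <= C * `|x|.
Proof.
have [C C0 CP] := horner_expR_bound ('X * P) ltr01.
exists C => // x; rewrite /flat; case: ltP => [x0|_]; last by rewrite normr0 mulr_ge0.
have xV : 0 < x^-1 by rewrite invr_gt0.
have := CP _ (ltW xV); rewrite mul1r hornerM hornerX normrM (gtr0_norm xV).
rewrite normrM (gtr0_norm (expR_gt0 _)) (gtr0_norm x0) expRN => H.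
rewrite ler_pdivrMr ?expR_gt0 //.
by move: H; rewrite ler_pdivrMl // [C * x * _]mulrAC [C * _ * x]mulrC.
Qed.

(** Away from 0 this is a computation; at 0 the difference quotient of [flat P] is [flat ('X * P)],
    which tends to 0 by [flat_bound]. *)
Lemma is_derive_flat (P : {poly R}) (x : R) :
  is_derive x (1 : R) (flat P) (flat ('X^2 * (P - P^`())) x).
Proof.
have [x0|x0|x0] := ltgtP 0 x; last (rewrite -x0 {x x0}).
- have xn : x != 0 by rewrite gt_eqF.
  have dV : is_derive x (1 : R) (fun y : R => y^-1) (- x ^- 2).
    have := @is_deriveV R id x 1 1 xn (is_derive_id _ _).
    by rewrite /= => H; apply: is_derive_eq H _; exact: mulr1.
  have dP : is_derive x (1 : R) (fun y => P.[y^-1]) (P^`().[x^-1] * - x ^- 2).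
    exact: (is_derive1_comp (is_derive_poly P _) dV).
  have dN : is_derive x (1 : R) (fun y : R => - y^-1) (- (- x ^- 2)) := is_deriveN dV.
  have dE : is_derive x (1 : R) (fun y : R => expR (- y^-1)) (expR (- x^-1) * - (- x ^- 2)).
    have H := @is_derive1_comp R expR (fun y => - y^-1) x _ _ (is_derive_expR (- x^-1)) dN.
    by apply: H.
  have := is_deriveM dP dE.
  rewrite /flat x0 !hornerE => H; apply: near_eq_is_derive (is_derive_eq H _).
    near=> y; have -> : 0 < y by near: y; exact: lt_nbhsr.
    by [].
  rewrite -[_ + _]/(P.[x^-1] * (expR (- x^-1) * - (- x ^- 2)) +
    expR (- x^-1) * (P^`().[x^-1] * - x ^- 2)).
  by rewrite exprVn opprK; ring.
- rewrite /flat (ltNge 0 x) (ltW x0) /=.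
  apply: near_eq_is_derive (is_derive_cst _ _ _).
  near=> y; rewrite ltNge ltW //.
  by near: y; exact: lt_nbhsl.
- have [C C0 CP] := flat_bound ('X * P).
  have cv : (fun h : R => h^-1 *: ((flat P \o shift 0) (h *: 1) - flat P 0)) h @[h --> 0^'] --> (0 : R).
    apply/cvgrPdist_le => e e0; near=> h.
    have hn : h != 0 by near: h; exact: nbhs_dnbhs_neq.
    rewrite sub0r normrN /= addr0 [X in flat P X](_ : _ = h); last exact: mulr1.
    have -> : h^-1 *: (flat P h - flat P 0) = flat ('X * P) h.
      rewrite /flat ltxx subr0; case: ltP => _; last by rewrite scaler0.
      by rewrite hornerM hornerX -mulrA.
    apply: le_trans (CP h) _; apply: le_trans (_ : (C + 1) * `|h| <= _).
      by rewrite ler_wpM2r // lerDl.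
    rewrite mulrC -ler_pdivlMr ?ltr_wpDl //.
    near: h; apply: dnbhs0_le; rewrite divr_gt0 // ltr_wpDl //.
  have -> : flat ('X^2 * (P - P^`())) 0 = 0 by rewrite /flat ltxx.
  apply: DeriveDef; first by apply/cvg_ex; exists 0.
  by rewrite /derive; exact: cvg_lim cv.
Unshelve. all: by end_near. Qed.

Lemma flat_Ck P k : Ck_on k setT (flat P).
Proof.
have dP Q (x : R) : differentiable (flat Q) x.
  by apply/derivable1_diffP; have [] := is_derive_flat Q x.
elim: k P => [|k IH] P.
  by split => // x _; exact: differentiable_continuous.
split; first by move=> x _; exact: differentiable_continuous.
move=> v; split; first by move=> x _; exact: diff_derivable.
have -> : 'D_v (flat P) = flat (v%:P * ('X^2 * (P - P^`()))); last exact: IH.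
apply/funext => x; rewrite deriveE //.
have -> : v = v *: (1 : R^o) by rewrite [RHS]mulr1.
rewrite linearZ /= -deriveE //; have [_ ->] := is_derive_flat P x.
rewrite /flat [_%:A](_ : _ = v); last exact: mulr1.
by case: ifP => _; [rewrite [in RHS]hornerM hornerC -[RHS]mulrA|rewrite scaler0].
Qed.

Lemma flat1_gt0 x : 0 < x -> 0 < flat 1 x /\ 0 < 'D_1 (flat 1) x.
Proof.
move=> x0; have [_ ->] := is_derive_flat 1 x; rewrite /flat x0; split.
  by rewrite hornerC mul1r expR_gt0.
by rewrite -polyC1 derivC subr0 !hornerE mulr_gt0 ?expR_gt0 // exprn_gt0 // invr_gt0.
Qed.

End flat.

Section bump.
Context {R : realType}.

(** [r] is a squared radius. A sum of squares is used since the norm of row vectors is the maximum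
    norm, which is not smooth. *)
Definition flat_bump n (q : 'rV[R]_n) (r : R) (u : 'rV[R]_n) : R :=
  flat 1 (r - \sum_i (u 0 i - q 0 i) ^+ 2).

Lemma sqdist_Ck n (q : 'rV[R]_n) (r : R) k :
  Ck_on k setT (fun u : 'rV[R]_n => r - \sum_i (u 0 i - q 0 i) ^+ 2).
Proof.
have oT := @openT 'rV[R]_n.
have Cc i : Ck_on k setT (fun u : 'rV[R]_n => u 0 i - q 0 i).
  apply: Ck_on_add => //; last exact: Ck_on_cst.
  exact: Ck_on_rV oT (Ck_on_id _ _).
have Cs : Ck_on k setT (fun u : 'rV[R]_n => \sum_i (u 0 i - q 0 i) ^+ 2).
  by apply: Ck_on_sum => // i; exact: Ck_on_mul.
have Cr : Ck_on k setT (fun _ : 'rV[R]_n => r) by exact: Ck_on_cst.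
have Cm : Ck_on k setT (fun _ : 'rV[R]_n => -1 : R) by exact: Ck_on_cst.
apply: Ck_on_eq oT _ (Ck_on_add oT Cr (Ck_on_mul oT Cm Cs)) => u _.
by rewrite mulN1r.
Qed.

Lemma flat_bump_Ck n (q : 'rV[R]_n) r k : Ck_on k setT (flat_bump q r).
Proof.
exact: (Ck_on_comp_real (frame_R) openT openT (fun _ _ => I) (flat_Ck 1 k) (sqdist_Ck q r k)).
Qed.

Lemma flat_bump_support n (q u : 'rV[R]_n) r : r < \sum_i (u 0 i - q 0 i) ^+ 2 -> flat_bump q r u = 0.
Proof. by move=> h; rewrite /flat_bump /flat ltNge subr_le0 ltW. Qed.

Lemma compact_sqball n (q : 'rV[R]_n) r :
  compact [set u : 'rV[R]_n | \sum_i (u 0 i - q 0 i) ^+ 2 <= r].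
Proof.
apply: bounded_closed_compact; last first.
  have -> : [set u : 'rV[R]_n | \sum_i (u 0 i - q 0 i) ^+ 2 <= r] =
      (fun u : 'rV[R]_n => r - \sum_i (u 0 i - q 0 i) ^+ 2) @^-1` [set x | 0 <= x].
    by apply/seteqP; split => u /=; rewrite subr_ge0.
  apply: preimage_closed; last exact: closed_ge.
  by move=> u _; have [cf _] := sqdist_Ck q r 0; exact: cf.
exists (`|q| + (r + 1)); split; first by rewrite num_real.
move=> x lex u /= ur; apply: le_trans (ltW lex).
rewrite -[u](subrK q) addrC (le_trans (ler_normD _ _)) // lerD2l.
have r0 : 0 <= r by apply: le_trans ur; apply: sumr_ge0 => i _; exact: sqr_ge0.
apply: rV_norm_le; first by rewrite addr_ge0.
move=> i; rewrite !mxE.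
have : (u 0 i - q 0 i) ^+ 2 <= r.
  apply: le_trans ur; rewrite (bigD1 i) //= lerDl sumr_ge0 // => j _.
  exact: sqr_ge0.
rewrite -real_normK ?num_real //; move: (`|_|) => a le1.
rewrite leNgt; apply/negP => lt2.
suff : r < a ^+ 2 by rewrite ltNge le1.
have a1 : 1 <= a by apply: le_trans (ltW lt2); rewrite lerDr.
apply: lt_le_trans (_ : a <= _); first by apply: lt_trans lt2; rewrite ltrDl.
by rewrite expr2 ler_peMr // (le_trans ler01).
Qed.

(** The centre [q = p + s *: v] is shifted off [p] along [v], so that the squared distance to [q]
    has derivative - 2 s N at [p] along [v]. The squared radius 2 s^2 N is twice the squared
    distance from [p] to [q]: hence [p] is interior to the support, where [flat 1] has positive
    derivative. *)
Lemma flat_bump_derivative n (p v : 'rV[R]_n) (d : R) : v != 0 -> 0 < d ->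
  exists q r, 'D_v (flat_bump q r) p != 0 /\
    forall u : 'rV[R]_n, \sum_i (u 0 i - q 0 i) ^+ 2 <= r -> `|u - p| < d.
Proof.
move=> v0 d0; pose N := \sum_i v 0 i ^+ 2.
have N0 : 0 < N.
  rewrite lt_neqAle sumr_ge0 ?andbT => [|i _]; last exact: sqr_ge0.
  apply: contra_neq v0 => /esym/eqP; rewrite psumr_eq0 => [/allP h|i _]; last exact: sqr_ge0.
  by apply/rowP => i; have := h i (mem_index_enum _); rewrite sqrf_eq0 mxE => /eqP.
have D0 : 0 < 1 + 2 * N + `|v| by rewrite ltr_pwDl // ltr_wpDr // mulr_ge0 // ltW.
(* The support lies within [s * (1 + 2 * N)] of [q], because the square root of 2N is at most 1 +
   2N, and [q] is at distance s |v| from [p]. *)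
have [s [s0 sd]] : exists s, 0 < s /\ s * (1 + 2 * N + `|v|) < d.
  exists (d / (2 * (1 + 2 * N + `|v|))); split; first by rewrite divr_gt0 // mulr_gt0.
  rewrite [ltLHS](_ : _ = d / 2); last by field; rewrite gt_eqF.
  by rewrite ltr_pdivrMr // ltr_pMr // ltr1n.
pose q := p + s *: v; pose r := 2 * s ^+ 2 * N.
exists q, r; split.
  have CS := sqdist_Ck q r 1.
  pose S (u : 'rV[R]_n) := r - \sum_i (u 0 i - q 0 i) ^+ 2.
  have dS : derivable S p v by exact: (CS.2 v).1.
  have df : differentiable (flat 1) (S p).
    by apply/derivable1_diffP; have [] := is_derive_flat 1 (S p).
  have [_ ->] := is_derive_comp df dS.
  have DSv : 'D_v S p = 2 * s * N.
    rewrite -derive_along.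
    have E : (fun t : R => S (t *: v + p)) = (fun t : R => r - (t - s) ^+ 2 * N).
      apply/funext => t; rewrite /S; congr (_ - _); rewrite /N mulr_sumr.
      by apply: eq_bigr => i _; rewrite !mxE; ring.
    rewrite E.
    have dX : is_derive (0 : R) 1 (fun t : R => t - s) (1 - 0).
      exact: is_deriveB.
    have dM := is_deriveM (is_deriveM dX dX) (is_derive_cst N (0 : R) 1).
    have := is_deriveB (is_derive_cst r (0 : R) 1) dM => -[_ DE].
    have -> : (fun t : R => r - (t - s) ^+ 2 * N) =
      cst r - (fun t : R => t - s) * (fun t : R => t - s) * cst N by apply/funext.
    rewrite DE /=.
    rewrite -[LHS]/(0 - (((0 - s) * (0 - s)) * 0 + N * ((0 - s) * (1 - 0) + (0 - s) * (1 - 0)))).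
    by ring.
  have Sp : 0 < S p.
    rewrite /S subr_gt0 /r; apply: le_lt_trans (_ : s ^+ 2 * N < _).
      by rewrite /N mulr_sumr; apply: ler_sum => i _; rewrite !mxE le_eqVlt; apply/orP; left; apply/eqP; ring.
    by rewrite -mulrA ltr_pMl ?ltr1n // mulr_gt0 // exprn_gt0.
  have -> : 'D_v S p = ('D_v S p) *: (1 : R^o) by rewrite [RHS]mulr1.
  rewrite linearZ /= -deriveE //.
  apply: lt0r_neq0; apply: mulr_gt0; last by case: (flat1_gt0 Sp).
  by rewrite DSv; apply: mulr_gt0 => //; exact: mulr_gt0.
move=> u ur.
have uq : `|u - q| <= s * (1 + 2 * N).
  apply: rV_norm_le; first by rewrite mulr_ge0 ?(ltW s0) // addr_ge0 // mulr_ge0 // ltW.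
  move=> i; rewrite !mxE.
  have : (u 0 i - (p 0 i + s * v 0 i)) ^+ 2 <= r.
    have := ur; rewrite (bigD1 i) //= !mxE; apply: le_trans.
    rewrite lerDl sumr_ge0 // => j _; exact: sqr_ge0.
  rewrite -real_normK ?num_real //; move: (`|_|) (normr_ge0 (u 0 i - (p 0 i + s * v 0 i))) => a a0 le1.
  rewrite leNgt; apply/negP => lt2.
  suff : r < a ^+ 2 by rewrite ltNge le1.
  apply: lt_trans (_ : (s * (1 + 2 * N)) ^+ 2 < _); last first.
    by rewrite ltr_pXn2r // nnegrE // mulr_ge0 ?(ltW s0) // addr_ge0 // mulr_ge0 // ltW.
  have -> : r = s ^+ 2 * (2 * N) by rewrite /r; ring.
  rewrite exprMn ltr_pM2l ?exprn_gt0 //.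
  have -> : (1 + 2 * N) ^+ 2 = 2 * N + (1 + 2 * N + 4 * N ^+ 2) by ring.
  by rewrite ltrDl !addr_gt0 ?mulr_gt0 ?exprn_gt0.
have -> : u - p = (u - q) + s *: v by rewrite /q opprD addrA subrK.
apply: le_lt_trans (ler_normD _ _) _; rewrite normrZ (gtr0_norm s0).
apply: le_lt_trans sd.
by rewrite [leRHS]mulrDr lerD2r.
Qed.

End bump.

(** * Separation of tangent vectors, and a neighbourhood of the unit *)

Section separation.
Context (R : realType) (n : nat) (G : groupTopologicalType)
  (AG : set (chart G 'rV[R]_n)) (G_lie : is_lie_group AG).
Context (c : chart G 'rV[R]_n) (Ac : AG c) (c1 : chart_dom c 1%g).

Let okG := lie_atlas_ok G_lie.
Let bn := @frame_rV R n.

(** A bump in the chart, extended by 0. The image of its supporting ball is compact, hence closed in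
    the Hausdorff space [G], so the extension vanishes on an open set that, with the chart domain,
    covers [G]. It follows that a tangent vector is determined by the action of its field on smooth
    functions. *)
Lemma smooth_separates v : v != 0 ->
  exists2 f, smooth_fun AG f & left_field c v f 1%g != 0.
Proof.
have [od oc cu0 eu0] := unit_chart G_lie Ac c1.
move=> v0; have /nbhs_normP[d /= d0 dP] : nbhs (chart_to c 1%g) (chart_cod c).
  exact: open_nbhs_nbhs.
have [q [r [Dn0 small]]] := flat_bump_derivative (chart_to c 1%g) v0 d0.
pose K := [set u : 'rV[R]_n | \sum_i (u 0 i - q 0 i) ^+ 2 <= r].
have Kc u : K u -> chart_cod c u.
  by move=> /small ud; apply: dP; rewrite /ball_ /= distrC.
have [_ _ tc fc] := atlas_chart okG Ac.
have cK : closed (chart_from c @` K).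
  apply: compact_closed; first exact: manifold_hausdorff (lie_group_manifold G_lie).
  apply: continuous_compact; last exact: compact_sqball.
  by apply: continuous_in_subspaceT => u /[!inE] /Kc /fc[].
pose f g := if `[< chart_dom c g >] then flat_bump q r (chart_to c g) else 0.
exists f.
  apply: smooth_cover => g _; have [cg|ncg] := pselect (chart_dom c g).
    exists (chart_dom c) => //.
    have sb : smooth_map (@std_atlas 'rV[R]_n) (@std_atlas R) (flat_bump q r).
      by apply/smooth_std => k; exact: flat_bump_Ck.
    apply: smooth_eq okG (std_atlas_ok _) od _ (smooth_comp bn (@frame_R R) okG
      (std_atlas_ok _) (std_atlas_ok _) od openT (fun _ _ => I) (smooth_chart_to okG Ac) sb).
    by move=> x cx; rewrite /f; case: asboolP.
  exists (~` (chart_from c @` K)).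
    by move=> [u /Kc /fc[h _ _]] /= ug; apply: ncg; rewrite -ug.
  apply: smooth_eq okG (std_atlas_ok _) _ _ (smooth_cst _ _ _ (0 : R)).
    exact: closed_openC.
  move=> x nx; rewrite /f; case: asboolP => // cx; rewrite flat_bump_support // ltNge.
  apply/negP => xK; apply: nx; exists (chart_to c x) => //.
  by have [_ ->] := tc _ cx.
rewrite /left_field (_ : 'D_v _ _ = 'D_v (flat_bump q r) (chart_to c 1%g)) //.
apply: near_eq_derive; near=> u; rewrite mul1g /f.
have cu : chart_cod c u by near: u; exact: open_nbhs_nbhs.
by have [h -> _] := fc _ cu; case: asboolP.
Unshelve. all: by end_near. Qed.

Context (bd : R -> G -> Prop).
Context (bd_mul : forall C C' g h, bd C g -> bd C' h -> bd (C + C') (g * h)%g)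
  (bd_inv : forall C g, bd C g -> bd C g^-1%g) (bd_one : bd 0 1%g).

(** The field of [v] is left invariant, hence in the span, hence acts on smooth functions as the
    field of some good [z]; separation forces [v = z]. *)
Lemma all_directions_good (d : nat) (A : 'I_d -> vfield R G) (gamma : 'I_d -> R -> G) :
  (forall i, left_invariant AG (A i)) -> (forall i, is_exp AG (A i) (gamma i)) ->
  (forall Y, left_invariant AG Y -> lie_span AG A Y) ->
  (forall i, exists C, forall t, `|t| < 1 -> bd C (gamma i t)) ->
  forall v, good AG c bd v.
Proof.
move=> lA eA gA bA v.
have [z gz zP] := lie_span_good G_lie Ac c1 bd_mul bd_inv bd_one lA eA bA
  (gA _ (left_invariant_left_field G_lie Ac c1 v)).
have [->//|nz] := eqVneq v z.
have : v - z != 0 by rewrite subr_eq0.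
move=> /smooth_separates[f sf]; have := left_field_linear G_lie Ac c1 1%g (-1) z v sf.
by rewrite scaleN1r addrC => ->; rewrite zP // mulN1r addNr eqxx.
Qed.

Let box d : set 'rV[R]_n := [set u | `|u| < d].

Lemma open_box d : open (box d).
Proof.
rewrite (_ : box d = (fun u : 'rV[R]_n => `|u|) @^-1` [set x | x < d]) //.
by apply: open_comp; [move=> u _; exact: norm_continuous|exact: open_lt].
Qed.

(** Coordinates of the second kind, with an arbitrary curve for each axis. *)
Definition curve_product (eta : 'I_n -> R -> G) (s : seq 'I_n) (u : 'rV[R]_n) : G :=
  foldr (fun i g => (eta i (u 0 i) * g)%g) 1%g s.

Lemma curve_product_smooth d eta s :
  (forall i, smooth_map_on (@std_atlas R) AG (disk d) (eta i)) ->
  smooth_map_on (@std_atlas 'rV[R]_n) AG (box d) (curve_product eta s).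
Proof.
move=> se; have okV := std_atlas_ok 'rV[R]_n; have oB := @open_box d.
elim: s => [|i s IH]; first exact: smooth_cst.
apply: (smooth_mul G_lie okV oB) IH.
have sc : smooth_map (@std_atlas 'rV[R]_n) (@std_atlas R) (fun u : 'rV[R]_n => u 0 i).
  by apply/smooth_std => k; apply: Ck_on_rV (Ck_on_id _ _); exact: openT.
have [_] := smooth_precomp G_lie (@frame_R R) okV sc (@open_disk R d) (se i).
by apply: smooth_sub => u ud; apply: le_lt_trans ud; exact: rV_coord_le.
Qed.

Lemma curve_product_axis eta s i (t : R) : (forall i, eta i 0 = 1%g) -> uniq s ->
  curve_product eta s (t *: 'e_i) = if i \in s then eta i t else 1%g.
Proof.
move=> e0; elim: s => //= j s IH /andP[js us].
rewrite !mxE in_cons eqxx /=; have [ij|ij] := eqVneq i j.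
  by subst i; rewrite /= mulr1 IH // (negPf js) mulg1.
by rewrite /= mulr0 e0 mul1g IH.
Qed.

Lemma curve_product_bd d C eta s u :
  (forall i t, disk d t -> bd (C i) (eta i t)) -> box d u ->
  bd (\sum_(i <- s) C i) (curve_product eta s u).
Proof.
move=> be ud; elim: s => [|i s IH]; first by rewrite big_nil.
rewrite big_cons; apply: bd_mul IH; apply: be.
by apply: le_lt_trans ud; exact: rV_coord_le.
Qed.

(** One good curve is chosen for each basis vector. Read in the chart, their product has the
    identity as derivative at 0, so by [local_surjectivity] its values fill a neighbourhood of 1, on
    which the sum of the individual bounds is valid. *)
Lemma nbhs_one_bd : (forall v, good AG c bd v) -> exists C, nbhs 1%g [set g | bd C g].
Proof.
have [od oc cu0 eu0] := unit_chart G_lie Ac c1.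
move=> gd.
have H (i : 'I_n) : exists x : R * R * (R -> G), [/\ 0 < x.1.1,
    smooth_map_on (@std_atlas R) AG (disk x.1.1) x.2, x.2 0 = 1%g,
    velocity c x.2 = 'e_i & forall t, disk x.1.1 t -> bd x.1.2 (x.2 t)].
  by have [d [C [eta [? ? ? ? ?]]]] := gd 'e_i; exists (d, C, eta).
have {H}[x xP] := choice H.
pose eta i := (x i).2; pose C i := (x i).1.2.
(* The default 1 keeps the radius positive when [n = 0]. *)
pose d := \big[Num.min/1]_i (x i).1.1.
have d0 : 0 < d by apply: lt_bigmin => // i _; case: (xP i).
have dle i : disk d `<=` disk (x i).1.1.
  by move=> t td; apply: lt_le_trans td _; exact: bigmin_le.
have se i : smooth_map_on (@std_atlas R) AG (disk d) (eta i).
  by case: (xP i) => _ s _ _ _; exact: smooth_sub s.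
have e0 i : eta i 0 = 1%g by case: (xP i).
have be i t : disk d t -> bd (C i) (eta i t).
  by move=> /(dle i) td; case: (xP i) => _ _ _ _ /(_ t td).
pose Phi := curve_product eta (enum 'I_n).
have sPhi := curve_product_smooth (enum 'I_n) se.
have Phi_axis i t : Phi (t *: 'e_i) = eta i t.
  by rewrite /Phi curve_product_axis ?enum_uniq // mem_enum.
have Phi0 : Phi 0 = 1%g.
  rewrite /Phi; elim: (enum _) => //= i s ->; by rewrite mxE e0 mulg1.
have [oS sS] := smooth_read G_lie Ac c1 (@open_box d) sPhi.
have S0 : (box d `&` Phi @^-1` chart_dom c) 0.
  by split; rewrite /box /= ?normr0 // Phi0.
have De i : 'D_('e_i) (chart_to c \o Phi) 0 = 'e_i.
  rewrite -derive_along.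
  have E : (fun t : R => (chart_to c \o Phi) (t *: 'e_i + 0)) = chart_to c \o eta i.
    by apply/funext => t; rewrite addr0 /= Phi_axis.
  by rewrite E; case: (xP i).
have /nbhs_normP[r /= r0 rP] : nbhs (0 : 'rV[R]_n) (box d `&` Phi @^-1` chart_dom c).
  exact: open_nbhs_nbhs.
have E0 : (chart_to c \o Phi) 0 = chart_to c 1%g by rewrite -Phi0.
have := local_surjectivity oS S0 (sS 1%N) De r0; rewrite E0 => nS.
exists (\sum_(i <- enum 'I_n) C i).
have [_ _ tc fc] := atlas_chart okG Ac.
have [_ _ ct] := tc _ c1.
near=> g => /=.
have cg : chart_dom c g by near: g; exact: open_nbhs_nbhs.
have [u /= ur ug] : ((chart_to c \o Phi) @` [set u | `|u - 0| < r]) (chart_to c g).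
  by near: g; exact: ct.
have [ud Pu] : (box d `&` Phi @^-1` chart_dom c) u.
  by apply: rP; rewrite /ball_ /= distrC.
have -> : g = Phi u.
  have [_ <- _] := tc _ cg; rewrite -ug.
  by have [_ -> _] := tc _ Pu.
exact: curve_product_bd be ud.
Unshelve. all: by end_near. Qed.

End separation.

(** * Compact subsets of the group *)

(** Compactness in its near-covering form, along the filter of finite index sequences ordered by
    inclusion. *)
Lemma compact_finite_cover (T : topologicalType) (I : eqType) (K : set T) (f : I -> set T) :
  compact K -> (forall x, K x -> exists i, nbhs x (f i)) ->
  exists s : seq I, forall x, K x -> exists2 i, i \in s & f i x.
Proof.
move=> /compact_near_coveringP cK cov.
pose F : set_system (seq I) := [set A | exists s0 : seq I, forall s : seq I, {subset s0 <= s} -> A s].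
have FF : Filter F.
  split.
  - by exists [::].
  - move=> A B [a aP] [b bP]; exists (a ++ b) => s sub; split.
      by apply: aP => i ia; apply: sub; rewrite mem_cat ia.
    by apply: bP => i ib; apply: sub; rewrite mem_cat ib orbT.
  - by move=> A B AB [a aP]; exists a => s /aP/AB.
have [x Kx|s0 /(_ s0 (fun _ => id)) sP] := cK (seq I) F (fun (s : seq I) x => exists2 i, i \in s & f i x) FF.
  have [i fi] := cov x Kx; exists (f i, [set s : seq I | i \in s]).
    by split => //; exists [:: i] => s; apply; rewrite inE.
  by move=> [x' s] /= [fx' si]; exists i.
by exists s0.
Qed.

Section translates.
Context (G : groupTopologicalType).
Context (mul_continuous : continuous (fun z : G * G => (z.1 * z.2)%g))
  (inv_continuous : continuous (fun g : G => (g^-1)%g)).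

Lemma left_mul_continuous (h : G) : continuous (fun g => (h * g)%g).
Proof.
move=> g; apply: (@continuous_comp _ _ _ (fun g => (h, g)) (fun z : G * G => (z.1 * z.2)%g)).
  by apply: cvg_pair; [exact: cst_continuous|exact: cvg_id].
exact: mul_continuous.
Qed.

Lemma right_mul_continuous (h : G) : continuous (fun g => (g * h)%g).
Proof.
move=> g; apply: (@continuous_comp _ _ _ (fun g => (g, h)) (fun z : G * G => (z.1 * z.2)%g)).
  by apply: cvg_pair; [exact: cvg_id|exact: cst_continuous].
exact: mul_continuous.
Qed.

Lemma nbhs_translate (N : set G) (g : G) : nbhs 1%g N -> nbhs g [set h | N (g^-1 * h)%g].
Proof. by move=> nN; have := @left_mul_continuous g^-1%g g; apply; rewrite /= mulVg. Qed.

Lemma compact_mul (K L : set G) : compact K -> compact L ->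
  compact [set x | exists g h, [/\ K g, L h & x = (g * h)%g]].
Proof.
move=> cK cL.
rewrite (_ : [set x | _] = (fun z : G * G => (z.1 * z.2)%g) @` (K `*` L)).
  apply: continuous_compact; last exact: compact_setX.
  by apply: continuous_subspaceT; exact: mul_continuous.
apply/seteqP; split => x /=.
  by move=> [g [h [Kg Lh ->]]]; exists (g, h).
by move=> [[g h] [/= Kg Lh] <-]; exists g, h.
Qed.

Lemma compact_inv (K : set G) : compact K -> compact [set x | K x^-1%g].
Proof.
move=> cK; rewrite (_ : [set x | _] = (fun g : G => g^-1%g) @` K).
  apply: continuous_compact cK.
  by apply: continuous_subspaceT; exact: inv_continuous.
apply/seteqP; split => x /=; first by move=> Kx; exists x^-1%g; rewrite ?invgK.
by move=> [g Kg <-]; rewrite invgK.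
Qed.

Context (R : realType) (bd : R -> G -> Prop).
Context (bd_mul : forall C C' g h, bd C g -> bd C' h -> bd (C + C') (g * h)%g)
  (bd_inv : forall C g, bd C g -> bd C g^-1%g) (bd_one : bd 0 1%g)
  (bd_mono : forall C C' g, C <= C' -> bd C g -> bd C' g).

(** The elements having some bound form a set [S] that is open, by translating the neighbourhood of
    1, and closed, since an element outside [S] has a whole translate outside; so [S] is all of [G].
    Finitely many translates cover [K], each with its own bound. *)
Lemma compact_bd (K : set G) : connected [set: G] -> compact K ->
  (exists C, nbhs 1%g [set g | bd C g]) -> exists C, forall g, K g -> bd C g.
Proof.
move=> conG cK [C nC].
pose S := [set g | exists C, bd C g].
have nS g h C' : bd C' g -> bd C (g^-1 * h)%g -> bd (C' + C) h.
  by move=> b1 b2; have := bd_mul b1 b2; rewrite mulVKg.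
have oS : open S.
  rewrite openE => g [C' bg]; have := nbhs_translate g nC.
  by apply: filterS => h /(nS _ _ _ bg) ?; exists (C' + C).
have cS : closed S.
  rewrite -openC openE => g nSg; have := nbhs_translate g nC.
  apply: filterS => h bh [C' bh']; apply: nSg; exists (C' + C).
  by have := bd_mul bh' (bd_inv bh); rewrite invgM invgK mulVKg.
have ST : S = setT.
  apply: conG; first by exists 1%g, 0.
    by exists S => //; rewrite setTI.
  by exists S => //; rewrite setTI.
have [s sP] : exists s : seq G, forall x, K x -> exists2 i, i \in s & bd C (i^-1 * x)%g.
  apply: compact_finite_cover cK _ => x _; exists x; exact: nbhs_translate.
have [B BP] : exists B, forall i, i \in s -> bd B i.
  elim: {sP} s => [|i s [B BP]]; first by exists 0.
  have [Ci bi] : S i by rewrite ST.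
  exists (Num.max Ci B) => j; rewrite in_cons => /predU1P[->|/BP].
    by apply: bd_mono bi; rewrite le_max lexx.
  by apply: bd_mono; rewrite le_max lexx orbT.
by exists (B + C) => g /sP[i /BP bi]; exact: nS.
Qed.

End translates.

(* A substitute for Haar measure: counting the points of a minimal family of left
   translates of a small neighbourhood [N] covering a compact set is left
   invariant up to a factor, the number [size T] of translates of [N] needed
   to cover [N * N]. *)
Section covers.
Context (G : groupType).

Definition covers (K N : set G) (J : seq G) : Prop :=
  forall g, K g -> exists2 j, j \in J & N (j^-1 * g)%g.

Definition minimal_cover (K N : set G) (J : seq G) : Prop :=
  covers K N J /\ forall J', covers K N J' -> (size J <= size J')%N.

Lemma exists_minimal_cover K N J0 : covers K N J0 -> exists J, minimal_cover K N J.
Proof.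
move=> cJ0; pose Q m := `[< exists2 J, covers K N J & size J = m >].
have exQ : exists m, Q m by exists (size J0); apply/asboolP; exists J0.
case: (ex_minnP exQ) => m /asboolP[J cJ <-] mmin; exists J; split => // J' cJ'.
by apply: mmin; apply/asboolP; exists J'.
Qed.

(** A translate that misses [K] could be dropped from the cover. This confines the centres to
    [K N^-1]. *)
Lemma minimal_cover_meets K N J j : minimal_cover K N J -> j \in J ->
  exists2 g, K g & N (j^-1 * g)%g.
Proof.
move=> [cJ mJ] Jj; apply: contrapT => nex.
have cJ' : covers K N [seq i <- J | i != j].
  move=> g Kg; have [i Ji Ni] := cJ g Kg; exists i => //.
  rewrite mem_filter Ji andbT; apply: contra_notN nex => /eqP ij.
  by exists g => //; rewrite -ij.
have := mJ _ cJ'; rewrite size_filter -(count_predC (pred1 j) J) -{1}[X in (_ <= X)%N]add0n leq_add2r leqn0.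
by rewrite -leqn0 leqNgt -has_count has_pred1 Jj.
Qed.

(** The members of [J] lying in [a N] could be replaced by the [size T] elements [a t], whose
    translates cover [a N N]; by minimality there are no more of them than that. *)
Lemma minimal_cover_count K N T J a : minimal_cover K N J ->
  (forall u v, N u -> N v -> exists2 t, t \in T & N (t^-1 * (u * v))%g) ->
  (count (fun j => `[< N (a^-1 * j)%g >]) J <= size T)%N.
Proof.
move=> [cJ mJ] NT; pose A j := `[< N (a^-1 * j)%g >].
have : covers K N ([seq j <- J | ~~ A j] ++ [seq (a * t)%g | t <- T]).
  move=> g Kg; have [j Jj Nj] := cJ g Kg; have [Aj|nAj] := boolP (A j).
    have [t Tt Nt] := NT _ _ (asboolW Aj) Nj.
    exists (a * t)%g; first by rewrite mem_cat map_f ?orbT.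
    by move: Nt; rewrite invgM !mulgA -(mulgA _ j) mulgV mulg1 -!mulgA.
  by exists j => //; rewrite mem_cat mem_filter nAj Jj.
move/mJ; rewrite size_cat size_map size_filter -(count_predC A J) addnC.
by rewrite leq_add2l.
Qed.

(** Translating the minimal cover of [K] by the elements of [I] covers [K']. *)
Lemma minimal_cover_size K K' N I J J' : covers K' K I ->
  minimal_cover K N J -> minimal_cover K' N J' -> (size J' <= size I * size J)%N.
Proof.
move=> cI [cJ _] [_ mJ']; rewrite -(size_allpairs (fun i j => (i * j)%g)).
apply: mJ' => g /cI[i Ii] /cJ[j Jj Nj]; exists (i * j)%g; first exact: allpairs_f.
by rewrite invgM -mulgA.
Qed.

(** Each [h j] lies in some [j' N] with [j'] in [J'], where [phi] is at most [psi j'], and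
    [minimal_cover_count] shows that a given [j'] is charged at most [size T] times. The right-hand
    side no longer contains [h]: this is the approximate left invariance. *)
Lemma minimal_cover_sum (R : realType) K K' N T J J' (h : G) (phi psi : G -> R) :
  minimal_cover K N J -> covers K' N J' ->
  (forall u v, N u -> N v -> exists2 t, t \in T & N (t^-1 * (u * v))%g) ->
  (forall j, j \in J -> K' (h * j)%g) ->
  (forall g, 0 <= phi g) -> (forall g, 0 <= psi g) ->
  (forall j n, N n -> phi (j * n)%g <= psi j) ->
  \sum_(j <- J) phi (h * j)%g <= (size T)%:R * \sum_(j <- J') psi j.
Proof.
move=> mJ cJ' NT hJ phi0 psi0 phipsi.
pose A j' j := `[< N ((h^-1 * j')^-1 * j)%g >].
apply: (@le_trans _ _ (\sum_(j <- J) \sum_(j' <- J') (A j' j)%:R * psi j')).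
  rewrite big_seq [leRHS]big_seq; apply: ler_sum => j Jj.
  have [j' J'j' Nj'] := cJ' _ (hJ _ Jj).
  have Aj : A j' j by apply/asboolP; rewrite invgM invgK -mulgA.
  rewrite (perm_big _ (perm_to_rem J'j')) big_cons Aj mul1r.
  apply: ler_wpDr; first by apply: sumr_ge0 => i _; rewrite mulr_ge0.
  by apply: le_trans (phipsi _ _ Nj'); rewrite mulVKg.
rewrite exchange_big mulr_sumr; apply: ler_sum => j' _ /=.
rewrite -mulr_suml ler_wpM2r // -natr_sum ler_nat.
apply: leq_trans (minimal_cover_count (h^-1 * j')%g mJ NT).
by rewrite -sum1_count [X in (_ <= X)%N]big_mkcond /=; apply: leq_sum => j _; rewrite /A; case: asboolP.
Qed.

End covers.

(** * Doubling neighbourhoods, compact neighbourhoods and Baire's theorem *)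

Section small_neighbourhoods.
Context (R : realType) (n : nat) (G : groupTopologicalType)
  (AG : set (chart G 'rV[R]_n)) (G_lie : is_lie_group AG).

Let okG := lie_atlas_ok G_lie.
Let bn := @frame_rV R n.

Lemma lie_mul_continuous : continuous (fun z : G * G => (z.1 * z.2)%g).
Proof. by move=> z; have [c _] := lie_group_mul G_lie; exact: c. Qed.

Lemma lie_inv_continuous : continuous (fun g : G => (g^-1)%g).
Proof. by move=> z; have [c _] := lie_group_inv G_lie; exact: c. Qed.

(** The bound on the number of grid points depends on [m] and [n] but not on the mesh [a]; this
    scale invariance keeps [P] fixed in [small_neighbourhoods]. *)
Lemma cube_net (m : nat) (a : R) (u0 : 'rV[R]_n) : 0 < a -> exists s : seq 'rV[R]_n,
  [/\ (size s <= (2 * m).+1 ^ n)%N, forall w, w \in s -> `|w - u0| <= a * m%:R &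
   forall v, `|v - u0| <= a * m%:R -> exists2 w, w \in s & `|w - v| <= a].
Proof.
move=> a0.
pose w (k : {ffun 'I_n -> 'I_(2 * m).+1}) : 'rV[R]_n := u0 + \row_i (a * ((k i)%:R - m%:R)).
exists [seq w k | k : {ffun 'I_n -> 'I_(2 * m).+1}]; split.
- by rewrite size_map -cardE card_ffun !card_ord.
- move=> _ /mapP[k _ ->]; rewrite /w addrC addKr.
  apply: rV_norm_le => [|i]; first by rewrite mulr_ge0 // ltW.
  rewrite mxE normrM (gtr0_norm a0) ler_wpM2l ?(ltW a0) // ler_norml.
  have := ltn_ord (k i); rewrite ltnS => km.
  rewrite lerBlDr -natrD lerNl opprB lerBlDr -natrD !ler_nat addnn -mul2n km.
  by rewrite leq_addr.
- move=> v vu.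
  pose x i := (v 0 i - u0 0 i) / a + m%:R.
  have xb i : 0 <= x i /\ x i <= (2 * m)%:R.
    have : `|v 0 i - u0 0 i| <= a * m%:R.
      by apply: le_trans vu; have := rV_coord_le (v - u0) i; rewrite !mxE.
    rewrite ler_norml => /andP[h1 h2]; split.
      by rewrite -lerBlDr sub0r ler_pdivlMr // mulNr mulrC.
    by rewrite /x mul2n -addnn natrD lerD2r ler_pdivrMr // mulrC.
  have kb i : (Num.truncn (x i) < (2 * m).+1)%N.
    have [x0 xm] := xb i; have /andP[t1 _] := truncn_itv x0.
    by rewrite ltnS -(ler_nat R) (le_trans t1).
  pose k : {ffun 'I_n -> 'I_(2 * m).+1} := [ffun i => Ordinal (kb i)].
  exists (w k); first by apply: map_f; rewrite mem_enum.
  apply: rV_norm_le => [|i]; first exact: ltW.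
  rewrite !mxE ffunE /=; have [x0 _] := xb i; have /andP[t1 t2] := truncn_itv x0.
  have -> : u0 0 i + a * ((Num.truncn (x i))%:R - m%:R) - v 0 i =
      a * ((Num.truncn (x i))%:R - x i).
    by rewrite /x; field; rewrite gt_eqF.
  rewrite normrM (gtr0_norm a0) ler_piMr ?(ltW a0) // distrC ger0_norm ?subr_ge0 //.
  by rewrite lerBlDr -natr1 addrC in t2 *; exact: ltW.
Qed.

Let sum3 (x a b y : R) : 0 < x -> 0 < a -> 0 < b -> x + a + b < y ->
  [/\ x < y, a < y & b < y].
Proof. by move=> *; split; lra. Qed.

(** A doubling property, uniform over small scales since [P] is chosen before [W]. [N] is a cube of
    radius [r] in the chart, and [N N] lies in the cube of radius [L * r]. The translate of [N]
    centred at [e w] contains the cube of radius [r / L] about [w], because the map sending a, b to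
    a^-1 b is Lipschitz and equals 1 on the diagonal. A grid of mesh [r / L], of cardinality
    independent of [r], therefore suffices. *)
Lemma small_neighbourhoods : exists P : nat, forall W, nbhs 1%g W ->
  exists N (T : seq G), [/\ nbhs 1%g N, N `<=` W, (size T <= P)%N &
    forall u v, N u -> N v -> exists2 t, t \in T & N (t^-1 * (u * v))%g].
Proof.
have [c Ac c1] := atlas_cover okG 1%g.
have [od oc cu0 eu0] := unit_chart G_lie Ac c1.
set u0 := chart_to c 1%g in cu0 eu0 *; set e := chart_from c in eu0 *.
have [_ _ tc fc] := atlas_chart okG Ac.
have b2 := frame_prod bn bn.
have ok2 := std_atlas_ok ('rV[R]_n * 'rV[R]_n)%type.
have oW : open (chart_cod c `*` chart_cod c) by exact: open_setX.
have s1 : smooth_map_on (@std_atlas ('rV[R]_n * 'rV[R]_n)%type) AG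
    (chart_cod c `*` chart_cod c) (e \o fst).
  have sf : smooth_map (@std_atlas ('rV[R]_n * 'rV[R]_n)%type) (@std_atlas 'rV[R]_n) fst.
    by apply/smooth_std => k; exact: Ck_on_fst.
  have [_] := smooth_precomp G_lie bn ok2 sf oc (smooth_chart_from okG Ac).
  by apply: smooth_sub => z [].
have s2 : smooth_map_on (@std_atlas ('rV[R]_n * 'rV[R]_n)%type) AG
    (chart_cod c `*` chart_cod c) (e \o snd).
  have sf : smooth_map (@std_atlas ('rV[R]_n * 'rV[R]_n)%type) (@std_atlas 'rV[R]_n) snd.
    by apply/smooth_std => k; exact: Ck_on_snd.
  have [_] := smooth_precomp G_lie bn ok2 sf oc (smooth_chart_from okG Ac).
  by apply: smooth_sub => z [].
pose F z := (e z.1 * e z.2)%g; pose H z := ((e z.1)^-1 * e z.2)%g.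
have [oF sF] : open ((chart_cod c `*` chart_cod c) `&` F @^-1` chart_dom c) /\
    smooth_on ((chart_cod c `*` chart_cod c) `&` F @^-1` chart_dom c) (chart_to c \o F) :=
  smooth_read G_lie Ac c1 oW (smooth_mul G_lie ok2 oW s1 s2).
have [oH sH] : open ((chart_cod c `*` chart_cod c) `&` H @^-1` chart_dom c) /\
    smooth_on ((chart_cod c `*` chart_cod c) `&` H @^-1` chart_dom c) (chart_to c \o H) :=
  smooth_read G_lie Ac c1 oW (smooth_mul G_lie ok2 oW (smooth_inv G_lie ok2 oW s1) s2).
have F0 : ((chart_cod c `*` chart_cod c) `&` F @^-1` chart_dom c) (u0, u0).
  by split => //; rewrite /F /= eu0 mulg1.
have H0 : ((chart_cod c `*` chart_cod c) `&` H @^-1` chart_dom c) (u0, u0).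
  by split => //; rewrite /H /= eu0 mulVg.
have [LF LF0 [dF dF0 LFP]] := C1_lipschitz b2 oF F0 (sF 1%N).
have [LH LH0 [dH dH0 LHP]] := C1_lipschitz b2 oH H0 (sH 1%N).
have /nbhs_normP[rF /= rF0 rFP] := open_nbhs_nbhs (conj oF F0).
have /nbhs_normP[rH /= rH0 rHP] := open_nbhs_nbhs (conj oH H0).
pose L := Num.max 1 (Num.max LF LH).
pose d := Num.min (Num.min dF dH) (Num.min rF rH).
have L1 : 1 <= L by rewrite /L le_max lexx.
have L0 : 0 < L by exact: lt_le_trans L1.
have d0 : 0 < d by rewrite /d !lt_min dF0 dH0 rF0.
have pairn (a b : 'rV[R]_n) (r : R) : `|a - u0| < r -> `|b - u0| < r ->
    `|((a, b) : 'rV[R]_n * 'rV[R]_n) - (u0, u0)| < r.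
  by move=> ar br; rewrite prod_normE gt_max /= ar.
have FP a b : `|a - u0| < d -> `|b - u0| < d -> chart_dom c (F (a, b)) /\
    `|chart_to c (F (a, b)) - u0| <= L * Num.max `|a - u0| `|b - u0|.
  move=> ad bd; have abd := pairn _ _ _ ad bd; have := abd.
  rewrite {1}/d !lt_min => /andP[/andP[l1 _] /andP[l3 _]].
  have [|_ Dab] := rFP (a, b); first by rewrite /ball_ /= distrC.
  split; first exact: Dab.
  have u00 : `|((u0, u0) : 'rV[R]_n * 'rV[R]_n) - (u0, u0)| < dF by rewrite subrr normr0.
  have := LFP _ _ l1 u00; rewrite {2}/comp {2}/F /= eu0 mulg1 => /le_trans; apply.
  by rewrite prod_normE /= ler_wpM2r ?le_max ?normr_ge0 // lexx ?orbT.
have HP a b : `|a - u0| < d -> `|b - u0| < d -> chart_dom c (H (a, b)) /\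
    `|chart_to c (H (a, b)) - u0| <= L * `|a - b|.
  move=> ad bd; have abd := pairn _ _ _ ad bd; have := abd.
  rewrite {1}/d !lt_min => /andP[/andP[_ l2] /andP[_ l4]].
  have := pairn _ _ _ bd bd; rewrite {1}/d !lt_min => /andP[/andP[_ l6] _].
  have [|_ Dab] := rHP (a, b); first by rewrite /ball_ /= distrC.
  split; first exact: Dab.
  have := LHP _ _ l2 l6; rewrite {2}/comp {2}/H /= mulVg => /le_trans; apply.
  rewrite prod_normE /= subrr normr0 max_l // ler_wpM2r // le_max le_max lexx ?orbT //.
(* A grid of mesh [r / L] with [m] steps reaches out to [r / L * m], which must be at least
   [L * r]. *)
have [m mL] : exists m : nat, L * L <= m%:R.
  by exists (Num.bound (L * L)); rewrite ltW // archi_boundP // mulr_ge0 // ltW.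
have m1 : 1 <= m%:R :> R by apply: le_trans mL; rewrite -[leLHS]mulr1 ler_pM.
exists ((2 * m).+1 ^ n)%N => W nW.
have /nbhs_normP[rW /= rW0 rWP] : nbhs u0 (e @^-1` W).
  by have [_ _ ce] := fc _ cu0; apply: ce; rewrite -/e eu0.
have [r r0 rlt] : exists2 r : R, 0 < r & r * (1 + L + m%:R) < Num.min d rW.
  have D0 : 0 < 1 + L + m%:R by rewrite !addr_gt0 //; exact: lt_le_trans m1.
  exists (Num.min d rW / (2 * (1 + L + m%:R))).
    by rewrite divr_gt0 ?mulr_gt0 // lt_min d0.
  rewrite [ltLHS](_ : _ = Num.min d rW / 2); last by field; rewrite gt_eqF.
  by rewrite ltr_pdivrMr // ltr_pMr ?ltr1n // lt_min d0.
have /andP[rd rrW] : (r * (1 + L + m%:R) < d) && (r * (1 + L + m%:R) < rW) by rewrite -lt_min.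
have rle : [/\ r < d, r < rW, L * r < d & r * m%:R < d].
  have rA : 0 < L * r by exact: mulr_gt0.
  have rB : 0 < r * m%:R by rewrite mulr_gt0 //; exact: lt_le_trans m1.
  move: rd rrW; rewrite !mulrDr mulr1 [r * L]mulrC => /(sum3 r0 rA rB)[? ? ?].
  by move=> /(sum3 r0 rA rB)[? ? ?].
have [rltd rltW Lrd mrd] := rle.
pose N := [set g | chart_dom c g /\ `|chart_to c g - u0| <= r].
have rL0 : 0 < r / L by exact: divr_gt0.
have [s [ssz sb sP]] := cube_net m u0 rL0.
have rLm : r / L * m%:R < d.
  apply: le_lt_trans mrd; rewrite ler_wpM2r // ler_pdivrMr // ler_peMr //; exact: ltW.
exists N, [seq e w | w <- s]; split.
- have [_ _ ct] := tc _ c1.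
  near=> g; split; first by near: g; exact: open_nbhs_nbhs.
  by rewrite ltW // distrC; near: g; have /cvgrPdist_lt/(_ r r0) := ct.
- move=> g [cg gr]; have [_ <- _] := tc _ cg; apply: rWP; rewrite /ball_ /= distrC.
  exact: le_lt_trans rltW.
- by rewrite size_map.
- move=> g h [cg gr] [ch hr].
  have gd : `|chart_to c g - u0| < d by exact: le_lt_trans rltd.
  have hd : `|chart_to c h - u0| < d by exact: le_lt_trans rltd.
  have [] := FP _ _ gd hd; rewrite /F /= /e.
  have [_ -> _] := tc _ cg; have [_ -> _] := tc _ ch => cgh ghn.
  have vn : `|chart_to c (g * h)%g - u0| <= L * r.
    by apply: le_trans ghn _; rewrite ler_wpM2l ?(ltW L0) // ge_max gr.
  have vd := le_lt_trans vn Lrd.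
  have vm : `|chart_to c (g * h)%g - u0| <= r / L * m%:R.
    apply: le_trans vn _; rewrite mulrAC ler_pdivlMr // [L * r]mulrC -mulrA.
    by rewrite ler_wpM2l // ltW.
  have [w ws wv] := sP _ vm.
  have wd := le_lt_trans (sb _ ws) rLm.
  have [] := HP _ _ wd vd; rewrite /H /= {2 4}/e.
  have [_ -> _] := tc _ cgh => cH Hn.
  exists (e w); first exact: map_f.
  split => //; apply: le_trans Hn _; rewrite mulrC -ler_pdivlMr //.
Unshelve. all: by end_near. Qed.

Lemma compact_neighbourhood : exists2 K : set G, compact K & nbhs 1%g K.
Proof.
have [c Ac c1] := atlas_cover okG 1%g.
have [od oc cu0 eu0] := unit_chart G_lie Ac c1.
have [_ _ tc fc] := atlas_chart okG Ac.
have /nbhs_normP[r /= r0 rP] := open_nbhs_nbhs (conj oc cu0).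
pose B := closed_ball_ Num.Def.normr (chart_to c 1%g) (r / 2).
have Bc : B `<=` chart_cod c.
  move=> u; rewrite /B /closed_ball_ /= => ur; apply: rP; rewrite /ball_ /=.
  by apply: le_lt_trans ur _; rewrite ltr_pdivrMr // ltr_pMr // ltr1n.
exists (chart_from c @` B).
  apply: continuous_compact.
    by apply: continuous_in_subspaceT => u /[!inE] /Bc /fc[].
  apply: bounded_closed_compact; last exact: closed_closed_ball_.
  exists (`|chart_to c 1%g| + r); split; first by rewrite num_real.
  move=> x lex u; rewrite /B /closed_ball_ /= distrC => ur; apply: le_trans (ltW lex).
  rewrite -[u](subrK (chart_to c 1%g)) addrC (le_trans (ler_normD _ _)) // lerD2l.
  by apply: le_trans ur _; rewrite ler_pdivrMr // ler_peMr ?(ltW r0) // ler1n.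
have [_ _ ct] := tc _ c1; have r20 : 0 < r / 2 by rewrite divr_gt0.
near=> g; have cg : chart_dom c g by near: g; exact: open_nbhs_nbhs.
exists (chart_to c g); last by have [_ -> _] := tc _ cg.
by rewrite /B /closed_ball_ /= ltW //; near: g; have /cvgrPdist_lt/(_ _ r20) := ct.
Unshelve. all: by end_near. Qed.

(** For each basic open set contained in some translate of [K] one such translate is chosen, with 1
    as default at the other indices; every point has a basic neighbourhood of this kind. *)
Lemma countable_translates (K : set G) : nbhs 1%g K ->
  exists x : nat -> G, forall g, exists k, K ((x k)^-1 * g)%g.
Proof.
move=> nK; have [B cB [Bo Bn]] := manifold_second_countable (lie_group_manifold G_lie).
have [f finj] := countable_injP _ cB.
have H k : exists g : G, forall b, B b -> f b = k ->
    (exists g', b `<=` [set h | K (g'^-1 * h)%g]) -> b `<=` [set h | K (g^-1 * h)%g].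
  have [[b [Bb fb [g' bg']]]|nb] := pselect (exists b, [/\ B b, f b = k &
    exists g', b `<=` [set h | K (g'^-1 * h)%g]]).
    exists g' => b' Bb' fb' _; suff -> : b' = b by [].
    by apply: finj; rewrite ?inE // fb.
  by exists 1%g => b Bb fb bg; case: nb; exists b.
have [x xP] := choice H; exists x => g.
have [b [Bb bg] bK] := Bn g _ (nbhs_translate lie_mul_continuous g nK).
by exists (f b); apply: (xP (f b) b) => //; exists g.
Qed.

End small_neighbourhoods.

(** The Baire theorem is applied to row vectors, inside a ball of one chart: were all [F k] without
    interior, the complements of their traces [D k] on the closed ball would be dense open sets with
    a common point in the open ball, which no [F k] could contain. *)
Lemma baire_manifold (R : realType) (m : nat) (M : topologicalType)
    (AM : set (chart M 'rV[R]_m)) (F : nat -> set M) (x0 : M) :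
  is_manifold AM -> (forall k, closed (F k)) -> (forall x, exists k, F k x) ->
  exists k O, [/\ open O, O !=set0 & O `<=` F k].
Proof.
move=> mM cF cov; apply: contrapT => nex.
have okM := manifold_atlas_ok mM.
have [c Ac cx0] := atlas_cover okM x0.
have [od oc tc fc] := atlas_chart okM Ac.
have [cu0 _ _] := tc _ cx0.
have /nbhs_normP[r /= r0 rP] := open_nbhs_nbhs (conj oc cu0).
pose B := closed_ball_ Num.Def.normr (chart_to c x0) (r / 2).
have Bc : B `<=` chart_cod c.
  move=> u; rewrite /B /closed_ball_ /= => ur; apply: rP; rewrite /ball_ /=.
  by apply: le_lt_trans ur _; rewrite ltr_pdivrMr // ltr_pMr // ltr1n.
have cB : closed B by exact: closed_closed_ball_.
pose D k := [set u | B u /\ F k (chart_from c u)].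
have od' k : open (~` D k) /\ dense (~` D k).
  split.
    rewrite openE => u nD; have [Bu|nBu] := pselect (B u); last first.
      have : nbhs u (~` B) by apply: open_nbhs_nbhs; split => //; exact: closed_openC.
      by apply: filterS => v nBv [].
    have [_ _ cf] := fc _ (Bc _ Bu).
    have : nbhs u (chart_from c @^-1` (~` F k)).
      apply: cf; apply: open_nbhs_nbhs; split; first exact: closed_openC.
      by move=> Fu; apply: nD.
    by apply: filterS => v nF [].
  move=> V V0 oV; apply: contrapT => Vn; apply: nex.
  have VD : V `<=` D k.
    by move=> v Vv; apply: contrapT => nD; apply: Vn; exists v.
  exists k, (chart_dom c `&` chart_to c @^-1` V); split.
  - by apply: open_preimage_on => // x /tc[].
  - have [v Vv] := V0; have [Bv _] := VD _ Vv; have [cv tv _] := fc _ (Bc _ Bv).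
    by exists (chart_from c v); split => //=; rewrite tv.
  - move=> x [cx Vx]; have [_ Fx] := VD _ Vx; have [_ E _] := tc _ cx.
    by move: Fx; rewrite E.
have r20 : 0 < r / 2 by rewrite divr_gt0.
have [|u [ur uD]] := Baire od' _ (ball_open (chart_to c x0) (r / 2)).
  by exists (chart_to c x0); exact: ballxx.
have [k Fk] := cov (chart_from c u).
by apply: (uD k I); split => //; rewrite /B /closed_ball_ /= ltW //; move: ur; rewrite -ball_normE.
Qed.

(** * Compact homogeneous spaces *)

Section homogeneous.
Context (R : realType) (n m : nat) (G : groupTopologicalType)
  (AG : set (chart G 'rV[R]_n)) (M : ptopologicalType) (AM : set (chart M 'rV[R]_m))
  (act : G -> M -> M) (G_lie : is_lie_group AG)
  (homM : is_homogeneous_space AG AM act) (M_compact : compact [set: M]).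

Lemma act_continuous : continuous (fun z : G * M => act z.1 z.2).
Proof. by move=> z; have [c _] := act_smooth homM; exact: c. Qed.

Lemma act_continuousl (x : M) : continuous (fun g => act g x).
Proof.
move=> g; apply: (@continuous_comp _ _ _ (fun g => (g, x)) (fun z : G * M => act z.1 z.2)).
  by apply: cvg_pair; [exact: cvg_id|exact: cst_continuous].
exact: act_continuous.
Qed.

Lemma act_continuousr (g : G) : continuous (act g).
Proof.
move=> x; apply: (@continuous_comp _ _ _ (fun x => (g, x)) (fun z : G * M => act z.1 z.2)).
  by apply: cvg_pair; [exact: cst_continuous|exact: cvg_id].
exact: act_continuous.
Qed.

Lemma actK g x : act g^-1%g (act g x) = x.
Proof. by rewrite -(act_mul homM) mulgV (act_one homM). Qed.

(* The orbit map is open: by Baire's theorem some translate of a compact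
   neighbourhood of [1] has an orbit with nonempty interior. *)
Lemma transitive_compact : exists2 Q : set G, compact Q &
  forall x z, exists2 h, Q h & z = act h x.
Proof.
have [K cK nK] := compact_neighbourhood G_lie.
have [y yP] := countable_translates G_lie nK.
have mc := lie_mul_continuous G_lie; have ic := lie_inv_continuous G_lie.
pose x0 : M := point.
pose F k := (fun h => act (y k * h)%g x0) @` K.
have cF k : closed (F k).
  apply: compact_closed; first exact: manifold_hausdorff (homogeneous_manifold homM).
  apply: continuous_compact cK; apply: continuous_subspaceT => h.
  apply: (@continuous_comp _ _ _ (fun h => (y k * h)%g) (fun g => act g x0)).
    exact: left_mul_continuous.
  exact: act_continuousl.
have covF z : exists k, F k z.
  have [g <-] := act_transitive homM x0 z; have [k kP] := yP g.
  by exists k, ((y k)^-1 * g)%g => //; rewrite mulVKg.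
have [k [V [oV [p Vp] VF]]] := baire_manifold x0 (homogeneous_manifold homM) cF covF.
(* By compactness of [M], finitely many group elements suffice to bring every point into [F k]. *)
have [s sP] : exists s : seq G, forall z, [set: M] z -> exists2 g, g \in s & F k (act g z).
  apply: (compact_finite_cover (f := fun g => [set z | F k (act g z)])) => // z _.
  have [g gz] := act_transitive homM z p; exists g.
  have : nbhs z (act g @^-1` V).
    by apply: act_continuousr; rewrite gz; exact: open_nbhs_nbhs.
  by apply: filterS => w /VF.
(* The elements [y k * h * g^-1] with [h] in [K] and [g] in [t]; those for [t = s] carry [x0] to
   every point. *)
pose Q0 (t : seq G) := [set q | exists2 g, g \in t & K ((y k)^-1 * q * g)%g].
have cQ0 t : compact (Q0 t).
  elim: t => [|g t IH].
    by rewrite (_ : Q0 [::] = set0); [exact: compact0|apply/seteqP; split => // q []].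
  rewrite (_ : Q0 (g :: t) = (fun h => y k * h * g^-1)%g @` K `|` Q0 t).
    apply: compactU => //; apply: continuous_compact cK; apply: continuous_subspaceT => h.
    apply: (@continuous_comp _ _ _ (fun h => (y k * h)%g) (fun h => (h * g^-1)%g)).
      exact: left_mul_continuous.
    exact: right_mul_continuous.
  apply/seteqP; split => q /=.
    move=> [g']; rewrite in_cons => /predU1P[->|g't] Kq; last by right; exists g'.
    left; exists ((y k)^-1 * q * g)%g => //.
    by rewrite -!mulgA mulgV mulg1 mulVKg.
  case=> [[h Kh <-]|[g' g't Kq]]; last by exists g' => //; rewrite in_cons g't orbT.
  by exists g; rewrite ?in_cons ?eqxx // -!mulgA mulKg mulVg mulg1.
have Q0P z : exists2 q, Q0 s q & z = act q x0.
  have [g gs [h Kh hz]] := sP z I; exists (y k * h * g^-1)%g.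
    by exists g => //; rewrite -!mulgA mulKg mulVg mulg1.
  by rewrite (act_mul homM) hz actK.
exists [set q | exists g h, [/\ [set q | Q0 s q^-1%g] g, Q0 s h & q = (g * h)%g]].
  by apply: compact_mul => //; exact: compact_inv.
move=> x z; have [q Qq ->] := Q0P x; have [q' Qq' ->] := Q0P z.
exists (q^-1 * q')%g; first by exists q^-1%g, q'; split => //=; rewrite invgK.
by rewrite (act_mul homM) actK.
Qed.

(** Continuity of [h (act g x)] at [g = 1], made uniform in [x] by compactness of [M]. *)
Lemma uniformly_continuous_act (h : M -> R) (e : R) : continuous h -> 0 < e ->
  nbhs 1%g [set g | forall x, `|h (act g x) - h x| <= e].
Proof.
move=> ch e0; have /compact_near_coveringP nc := M_compact.
have e20 : 0 < e / 2 by rewrite divr_gt0.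
suff H : \forall g \near (1%g : G), [set: M] `<=` (fun x => `|h (act g x) - h x| <= e).
  by apply: filterS H => g Hg x; exact: Hg.
apply: nc => x _.
have /cvgrPdist_le/(_ _ e20) H1 : {for ((1%g : G), x), continuous (fun z : G * M => h (act z.1 z.2))}.
  by apply: continuous_comp; [exact: act_continuous|exact: ch].
have /cvgrPdist_le/(_ _ e20) H2 := ch x.
move: H1 => [[A B] /= [nA nB] AB]; exists (B `&` [set x' | `|h x - h x'| <= e / 2], A).
  by split => //; apply: filterI.
move=> [x' g] /= [[Bx' hx'] Ag]; have := AB (g, x') (conj Ag Bx').
rewrite /= (act_one homM) => hg.
rewrite (splitr e) -[X in `|X|](subrKA (h x)) (le_trans (ler_normD _ _)) // lerD //.
by rewrite distrC.
Qed.

End homogeneous.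

(** * The Poincare inequality *)

Section integrals.
Context (R : realType) (M : ptopologicalType) (M_compact : compact [set: M])
  (mu : {measure set (borel M) -> \bar R}) (mu_finite : (mu setT < +oo)%E).

Lemma continuous_bounded (f : M -> R) : continuous f ->
  exists2 B, 0 <= B & forall x, `|f x| <= B.
Proof.
move=> cf; have cfM : compact (f @` [set: M]).
  by apply: continuous_compact M_compact; exact: continuous_subspaceT.
have [B [_ BP]] := compact_bounded cfM.
exists (`|B| + 1) => [|x]; first by rewrite addr_ge0.
by apply: (BP (`|B| + 1)); [rewrite ltr_pwDr // ler_norm|exists x].
Qed.

Lemma measurable_open (D : set M) : open D -> measurable (D : set (borel M)).
Proof. by move=> oD; exact: sub_sigma_algebra. Qed.

Lemma continuous_measurable_borel (f : M -> R) : continuous f ->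
  measurable_fun setT (f : borel M -> R).
Proof.
move=> cf; apply: (measurability _ (measurable_realfun.RGenOpens.measurableE R)).
move=> _ [_ [a [b ->] <-]]; rewrite setTI; apply: measurable_open.
by apply: open_comp; [move=> x _; exact: cf|exact: interval_open].
Qed.

Lemma continuous_measurable_self (phi : M -> M) : continuous phi ->
  measurable_fun setT (phi : borel M -> borel M).
Proof.
move=> cphi; apply: (@measurability _ _ (borel M) (borel M) setT phi (@open M) erefl).
move=> _ [D oD <-]; rewrite setTI; apply: measurable_open.
by apply: open_comp => // x _; exact: cphi.
Qed.

Lemma continuous_integrable (f : M -> R) : continuous f ->
  mu.-integrable setT (EFin \o (f : borel M -> R)).
Proof.
move=> cf; apply: measurable_bounded_integrable => //.
  exact: continuous_measurable_borel.
have [B B0 BP] := continuous_bounded cf.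
exists B; split; first by rewrite num_real.
by move=> y By x _ /=; apply: le_trans (BP x) (ltW By).
Qed.

Local Notation I f := (\int[mu]_x f x).

Lemma int_add (f g : M -> R) : continuous f -> continuous g ->
  I (fun x => f x + g x) = I f + I g.
Proof. by move=> cf cg; apply: RintegralD => //; exact: continuous_integrable. Qed.

Lemma int_scale a (f : M -> R) : continuous f -> I (fun x => a * f x) = a * I f.
Proof. by move=> cf; apply: RintegralZl => //; exact: continuous_integrable. Qed.

Lemma int_le (f g : M -> R) : continuous f -> continuous g -> (forall x, f x <= g x) ->
  I f <= I g.
Proof. by move=> cf cg fg; apply: le_Rintegral => //; exact: continuous_integrable. Qed.

Lemma int_cst (a : R) : I (fun=> a) = a * fine (mu setT).
Proof. by apply: Rintegral_cst. Qed.

Lemma int_ge0 (f : M -> R) : (forall x, 0 <= f x) -> 0 <= I f.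
Proof. by move=> f0; apply: Rintegral_ge0. Qed.

Lemma int_sum (J : Type) (s : seq J) (f : J -> M -> R) : (forall j, continuous (f j)) ->
  continuous (fun x => \sum_(j <- s) f j x) /\
  I (fun x => \sum_(j <- s) f j x) = \sum_(j <- s) I (f j).
Proof.
move=> cf; elim: s => [|j s [IHc IH]].
  have E : (fun x => \sum_(j <- [::]) f j x) = fun=> 0 by apply/funext => x; rewrite big_nil.
  by rewrite E big_nil int_cst mul0r; split => // x; exact: cst_continuous.
have E : (fun x => \sum_(i <- j :: s) f i x) = (fun x => f j x + \sum_(i <- s) f i x).
  by apply/funext => x; rewrite big_cons.
rewrite E big_cons -IH int_add //; split => // x.
by apply: continuousD; [exact: cf|exact: IHc].
Qed.

Lemma int_invariant (f : M -> R) (phi : M -> M) : continuous f -> continuous phi ->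
  (forall C : set (borel M), measurable C -> mu (phi @^-1` C) = mu C) ->
  I (fun x => f (phi x)) = I f.
Proof.
move=> cf cphi inv; rewrite /Rintegral; congr fine.
have mphi := continuous_measurable_self cphi.
have mf : measurable_fun (setT : set (borel M)) (fun x : borel M => (f x)%:E).
  by apply/measurable_EFinP; exact: continuous_measurable_borel.
have intf : mu.-integrable (phi @^-1` setT : set (borel M)) ((EFin \o f) \o phi).
  rewrite preimage_setT; apply: (continuous_integrable (f := f \o phi)) => x.
  by apply: continuous_comp; [exact: cphi|exact: cf].
have := integral_pushforward mphi mf intf measurableT.
rewrite preimage_setT => <-.
by apply: eq_measure_integral => C mC _; exact: inv.
Qed.

(** Minkowski's inequality, from (a + b)^2 <= (1 + B/A) a^2 + (1 + A/B) b^2, whose right-hand side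
    integrates to at most (A + B)^2. The cases [A = 0] and [B = 0] are reached by enlarging both
    constants slightly. *)
Lemma L2_triangle (a b : M -> R) (A B : R) : continuous a -> continuous b ->
  0 <= A -> 0 <= B -> I (fun x => a x ^+ 2) <= A ^+ 2 -> I (fun x => b x ^+ 2) <= B ^+ 2 ->
  I (fun x => (a x + b x) ^+ 2) <= (A + B) ^+ 2.
Proof.
move=> ca cb.
have sq (h : M -> R) : continuous h -> continuous (fun x => h x ^+ 2).
  by move=> ch x; apply: continuousM; exact: ch.
have sc (t : R) (h : M -> R) : continuous h -> continuous (fun x => t * h x).
  by move=> ch x; apply: continuousM; [exact: cst_continuous|exact: ch].
have cab : continuous (fun x => a x + b x).
  by move=> x; apply: continuousD; [exact: ca|exact: cb].
have pos A' B' : 0 < A' -> 0 < B' -> I (fun x => a x ^+ 2) <= A' ^+ 2 ->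
    I (fun x => b x ^+ 2) <= B' ^+ 2 -> I (fun x => (a x + b x) ^+ 2) <= (A' + B') ^+ 2.
  move=> A0 B0 Ia Ib.
  pose s := 1 + B' / A'; pose t := 1 + A' / B'.
  have s0 : 0 <= s by rewrite addr_ge0 // divr_ge0 // ltW.
  have t0 : 0 <= t by rewrite addr_ge0 // divr_ge0 // ltW.
  apply: (@le_trans _ _ (s * I (fun x => a x ^+ 2) + t * I (fun x => b x ^+ 2))).
    rewrite -!int_scale -?int_add; [|by apply: sc; exact: sq|by apply: sc; exact: sq|exact: sq|exact: sq].
    have cst2 : continuous (fun x : M => s * a x ^+ 2 + t * b x ^+ 2).
      by move=> x; exact: (continuousD (sc s _ (sq _ ca) x) (sc t _ (sq _ cb) x)).
    apply: int_le => [||x]; [exact: sq|exact: cst2|].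
    rewrite /s /t -subr_ge0.
    rewrite [leRHS](_ : _ = (B' * a x - A' * b x) ^+ 2 / (A' * B')).
      by rewrite divr_ge0 ?sqr_ge0 // mulr_ge0 // ltW.
    by field; rewrite !gt_eqF.
  apply: le_trans (_ : s * A' ^+ 2 + t * B' ^+ 2 <= _).
    by apply: lerD; rewrite ler_wpM2l.
  rewrite le_eqVlt; apply/orP; left; apply/eqP; rewrite /s /t.
  by field; rewrite !gt_eqF.
move=> A0 B0 Ia Ib; rewrite leNgt; apply/negP => lt.
pose X := I (fun x => (a x + b x) ^+ 2); rewrite -/X in lt; pose r := Num.sqrt X.
have X0 : 0 <= X by apply: le_trans (ltW lt); exact: sqr_ge0.
have rX : r ^+ 2 = X by exact: sqr_sqrtr.
have ltr : A + B < r.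
  by rewrite -(@ltr_pXn2r _ 2) ?nnegrE ?addr_ge0 ?sqrtr_ge0 // rX.
(* With a quarter of the gap, [A + d + (B + d)] is the midpoint of [A + B] and [r], still below
   [r]. *)
pose d := (r - (A + B)) / 4.
have d0 : 0 < d by rewrite divr_gt0 // subr_gt0.
have le1 (Y : R) : 0 <= Y -> Y ^+ 2 <= (Y + d) ^+ 2.
  by move=> Y0; rewrite ler_pXn2r ?nnegrE ?addr_ge0 ?(ltW d0) // lerDl ltW.
have := pos (A + d) (B + d) (ltr_wpDl A0 d0) (ltr_wpDl B0 d0)
  (le_trans Ia (le1 _ A0)) (le_trans Ib (le1 _ B0)).
rewrite -/X -rX ler_pXn2r ?nnegrE ?sqrtr_ge0 ?addr_ge0 ?(ltW d0) //.
rewrite /d leNgt => /negP; apply.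
rewrite [ltLHS](_ : _ = (A + B + r) / 2); last by field.
by rewrite ltr_pdivrMr // mulr_natr mulr2n ltrD2r.
Qed.

End integrals.

(** * Displacement of functions in L^2 *)

Section displacement.
Context (R : realType) (n m : nat) (G : groupTopologicalType)
  (AG : set (chart G 'rV[R]_n)) (M : ptopologicalType) (AM : set (chart M 'rV[R]_m))
  (act : G -> M -> M) (G_lie : is_lie_group AG)
  (homM : is_homogeneous_space AG AM act) (M_compact : compact [set: M])
  (mu : {measure set (borel M) -> \bar R}) (mu_invariant : invariant_measure act mu)
  (mu_finite : (mu setT < +oo)%E).

Let okG := lie_atlas_ok G_lie.
Let okM := manifold_atlas_ok (homogeneous_manifold homM).
Let bn := @frame_rV R n.
Let bm := @frame_rV R m.

Local Notation I f := (\int[mu]_x f x).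

Let act_cont g : continuous (act g).
Proof. exact: (act_continuousr homM). Qed.

Definition displacement (f : M -> R) (g : G) : R :=
  \int[mu]_x ((f (act g x) - f x) ^+ 2).

Lemma difference_continuous (f : M -> R) g : continuous f ->
  continuous (fun x => f (act g x) - f x).
Proof.
move=> cf x; apply: continuousB; last exact: cf.
by apply: continuous_comp; [exact: act_cont|exact: cf].
Qed.

Lemma continuous_sqr (f : M -> R) : continuous f -> continuous (fun x => f x ^+ 2).
Proof. by move=> cf x; apply: continuousM; exact: cf. Qed.

Lemma displacement_mul f g h A B : continuous f -> 0 <= A -> 0 <= B ->
  displacement f g <= A ^+ 2 -> displacement f h <= B ^+ 2 ->
  displacement f (g * h)%g <= (A + B) ^+ 2.
Proof.
move=> cf A0 B0 Ag Bh; rewrite addrC.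
have cg := @difference_continuous f g cf; have ch := @difference_continuous f h cf.
have cgh : continuous (fun x => f (act h (act g x)) - f (act g x)).
  move=> x; apply: (@continuous_comp _ _ _ (act g) (fun y => f (act h y) - f y)).
    exact: act_cont.
  exact: ch.
have Bgh : I (fun x => (f (act h (act g x)) - f (act g x)) ^+ 2) <= B ^+ 2.
  have -> := @int_invariant R M M_compact mu mu_finite (fun y => (f (act h y) - f y) ^+ 2)
    (act g) (continuous_sqr ch) (@act_cont g) (mu_invariant g).
  exact: Bh.
have := L2_triangle M_compact mu_finite cgh cg B0 A0 Bgh Ag.
rewrite /displacement.
have E : (fun x => (f (act h (act g x)) - f (act g x) + (f (act g x) - f x)) ^+ 2) =
    (fun x => (f (act (g * h)%g x) - f x) ^+ 2).
  by apply/funext => x; rewrite addrA subrK (act_mul homM).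
by rewrite E.
Qed.

Lemma displacement_inv f g : continuous f -> displacement f g^-1%g = displacement f g.
Proof.
move=> cf; rewrite /displacement.
have E : (fun x => (f (act g x) - f x) ^+ 2) =
    (fun x => (f (act g^-1%g (act g x)) - f (act g x)) ^+ 2).
  by apply/funext => x; rewrite (actK homM) -sqrrN opprB.
rewrite E; apply: esym.
exact: (@int_invariant R M M_compact mu mu_finite (fun y => (f (act g^-1%g y) - f y) ^+ 2)
  (act g) (continuous_sqr (difference_continuous cf)) (@act_cont g) (mu_invariant g)).
Qed.

Lemma displacement_one f : displacement f 1%g = 0.
Proof.
rewrite /displacement.
have E : (fun x => (f (act 1%g x) - f x) ^+ 2) = fun=> 0.
  by apply/funext => x; rewrite (act_one homM) subrr expr0n.
by rewrite E (int_cst mu) mul0r.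
Qed.

Lemma displacement_exp f g A k : continuous f -> 0 <= A ->
  displacement f g <= A ^+ 2 -> displacement f (g ^+ k)%g <= (k%:R * A) ^+ 2.
Proof.
move=> cf A0 Ag; elim: k => [|k IH]; first by rewrite expg0 displacement_one mul0r expr0n.
rewrite expgS -natr1 mulrDl mul1r addrC; apply: displacement_mul => //.
by rewrite mulr_ge0.
Qed.

Section one_parameter.
Context (X : vfield R G) (gamma : R -> G) (eX : is_exp AG X gamma).
Context (f : M -> R) (sf : smooth_fun AM f).

Local Notation V := (fundamental act gamma f).

Lemma flow_smooth : smooth_map (prod_atlas AM (@std_atlas R)) (@std_atlas R)
  (fun z => f (act (gamma z.2) z.1)).
Proof.
have okR := std_atlas_ok R; have okP := prod_atlas_ok bm (@frame_R R) okM okR.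
have s1 : smooth_map (prod_atlas AM (@std_atlas R)) AM fst by exact: (@smooth_fst _ _ _ _ _ bm).
have s2 : smooth_map (prod_atlas AM (@std_atlas R)) (@std_atlas R) snd.
  exact: (@smooth_snd _ _ _ _ _ (@frame_R R)).
have s3 := smooth_comp (@frame_R R) bn okP okR okG openT openT (fun _ _ => Logic.I) s2 (exp_smooth eX).
have s4 := smooth_pair okP okG okM openT s3 s1.
have s5 := smooth_comp (frame_prod bn bm) bm okP (prod_atlas_ok bn bm okG okM) okM openT openT
  (fun _ _ => Logic.I) s4 (act_smooth homM).
exact: (smooth_comp bm (@frame_R R) okP okM okR openT openT (fun _ _ => Logic.I) s5 sf).
Qed.

Lemma orbit_Ck x k : Ck_on k setT (fun s : R => f (act (gamma s) x)).
Proof.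
have okR := std_atlas_ok R; have okP := prod_atlas_ok bm (@frame_R R) okM okR.
move: k; apply/smooth_std.
have s1 : smooth_map (@std_atlas R) AM (fun=> x) by exact: smooth_cst.
have s2 : smooth_map (@std_atlas R) (@std_atlas R) id by exact: smooth_id.
have s3 := smooth_pair okR okM okR openT s1 s2.
exact: (smooth_comp (frame_prod bm (@frame_R R)) (@frame_R R) okR okP okR openT openT
  (fun _ _ => Logic.I) s3 flow_smooth).
Qed.

Lemma fundamental_continuous : continuous V.
Proof.
have okR := std_atlas_ok R.
have sfl : smooth_map_on (prod_atlas AM (@std_atlas R)) (@std_atlas R) (setT `*` setT)
    (fun z : M * R => f (act (gamma z.2) z.1)).
  exact: smooth_sub (@subsetT _ _) flow_smooth.
have [cV _] := smooth_partial bm (@frame_R R) 1 okM openT openT (Logic.I : setT (0 : R)) sfl.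
by move=> x; have := cV x Logic.I; rewrite (_ : (fun x => _) = V) //; apply/funext => y; rewrite /fundamental derive1E.
Qed.

Lemma fundamental_flow x t :
  is_derive t (1 : R) (fun s => f (act (gamma s) x)) (V (act (gamma t) x)).
Proof.
have d : derivable (fun s => f (act (gamma s) x)) t 1 by exact: ((orbit_Ck x 1).2 1).1.
apply: DeriveDef => //; rewrite /fundamental derive1E.
have E : (fun s => f (act (gamma s) (act (gamma t) x))) = (fun s => f (act (gamma (s + t)) x)).
  by apply/funext => s; rewrite addrC (exp_morph eX) (act_mul homM).
rewrite E; have d0 : derivable (fun s => f (act (gamma s) x)) (0 + t) 1 by rewrite add0r.
by have [_ ->] := is_derive_translate d0; rewrite add0r.
Qed.

Lemma gamma_pow s k : gamma (s *+ k) = (gamma s ^+ k)%g.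
Proof.
elim: k => [|k IH]; first by rewrite mulr0n expg0 (is_exp_unit eX).
by rewrite mulrS (exp_morph eX) IH expgS.
Qed.

(* Splitting [gamma s] into [k] factors [gamma (s / k)] and letting [k] tend to
   infinity replaces Minkowski's integral inequality. *)
Lemma displacement_gamma s : displacement f (gamma s) <= s ^+ 2 * I (fun x => V x ^+ 2).
Proof.
have cf : continuous f by move=> x; have [c _] := sf; exact: c.
have cV := fundamental_continuous.
have [B B0 BV] := continuous_bounded M_compact cV.
set E := I (fun x => V x ^+ 2).
have E0 : 0 <= E by apply: int_ge0 => x; exact: sqr_ge0.
have mass0 : 0 <= fine (mu setT) by exact: fine_ge0.
(* [eta] bounds the variation of [V] along short pieces of orbit, and (|V| + eta)^2 exceeds V^2 by
   at most [eta * (2 * B + eta)]. *)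
suff H : forall eta, 0 < eta -> displacement f (gamma s) <= s ^+ 2 * (E + eta * (2 * B + eta) * fine (mu setT)).
  apply/ler_addgt0Pr => e e0.
  pose D := s ^+ 2 * ((2 * B + 1) * fine (mu setT)) + 1.
  have B2 : 0 <= 2 * B by rewrite mulr_ge0.
  have D0 : 0 < D.
    by rewrite ltr_wpDl //; apply: mulr_ge0 (sqr_ge0 _) (mulr_ge0 (addr_ge0 B2 _) mass0).
  pose eta := Num.min 1 (e / D).
  have eta0 : 0 < eta by rewrite lt_min ltr01 divr_gt0.
  apply: le_trans (H _ eta0) _; rewrite mulrDr lerD2l.
  have e1 : eta <= 1 by rewrite ge_min lexx.
  have e2 : eta <= e / D by rewrite ge_min lexx orbT.
  apply: le_trans (_ : eta * D <= _); last by rewrite -ler_pdivlMr.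
  rewrite /D; have -> : s ^+ 2 * (eta * (2 * B + eta) * fine (mu setT)) =
    eta * (s ^+ 2 * ((2 * B + eta) * fine (mu setT))) by ring.
  rewrite ler_wpM2l ?(ltW eta0) // ler_wpDr // ler_wpM2l ?sqr_ge0 //.
  by rewrite ler_wpM2r // lerD2l.
move=> eta eta0.
have nV := uniformly_continuous_act homM M_compact cV eta0.
have cg : {for 0, continuous gamma} by have [c _] := exp_smooth eX; exact: c.
have /nbhs_normP[d /= d0 dP] : nbhs (0 : R) (gamma @^-1` [set g | forall x, `|V (act g x) - V x| <= eta]).
  by apply: cg; rewrite (is_exp_unit eX).
pose E' := E + eta * (2 * B + eta) * fine (mu setT).
have E'0 : 0 <= E'.
  have B2 : 0 <= 2 * B by rewrite mulr_ge0.
  exact: addr_ge0 E0 (mulr_ge0 (mulr_ge0 (ltW eta0) (addr_ge0 B2 (ltW eta0))) mass0).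
have small t : `|t| < d -> displacement f (gamma t) <= (`|t| * Num.sqrt E') ^+ 2.
  move=> td; rewrite exprMn sqr_sqrtr // real_normK ?num_real // /displacement.
  have cV2 := continuous_sqr cV.
  have ccst (a : R) : continuous (fun _ : M => a) by move=> x; exact: cst_continuous.
  have cst2 : continuous (fun x : M => V x ^+ 2 + eta * (2 * B + eta)).
    by move=> x; exact: (continuousD (cV2 x) (ccst _ x)).
  have cst3 : continuous (fun x : M => t ^+ 2 * (V x ^+ 2 + eta * (2 * B + eta))).
    by move=> x; exact: (continuousM (ccst _ x) (cst2 x)).
  have -> : t ^+ 2 * E' = I (fun x => t ^+ 2 * (V x ^+ 2 + eta * (2 * B + eta))).
    rewrite (int_scale M_compact mu_finite _ cst2) (int_add M_compact mu_finite cV2).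
      by rewrite (int_cst mu).
    by move=> x; exact: cst_continuous.
  apply: (int_le M_compact mu_finite) => //.
    exact: continuous_sqr (difference_continuous cf).
  move=> x.
  have := @line_mean_value R R (fun s => f (act (gamma s) x)) 1 0 t (V x) eta.
  rewrite addr0 (is_exp_unit eX) (act_one homM) [t *: 1]mulr1 => H.
  have {}H : `|f (act (gamma t) x) - f x - t * V x| <= eta * `|t|.
    apply: H => r rt; rewrite addr0 [r *: 1]mulr1; have [dr ->] := fundamental_flow x r.
    split => //; apply: dP; rewrite /ball_ /= sub0r normrN.
    exact: le_lt_trans td.
  have le1 : `|f (act (gamma t) x) - f x| <= `|t| * (`|V x| + eta).
    rewrite -[X in `|X|](subrK (t * V x)) (le_trans (ler_normD _ _)) //.
    by rewrite normrM mulrDr addrC lerD2l [leRHS]mulrC.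
  rewrite -[leLHS]real_normK ?num_real //.
  apply: le_trans (_ : (`|t| * (`|V x| + eta)) ^+ 2 <= _).
    by rewrite ler_pXn2r // nnegrE // mulr_ge0 // addr_ge0 // ltW.
  rewrite exprMn real_normK ?num_real // ler_wpM2l ?sqr_ge0 //.
  have -> : (`|V x| + eta) ^+ 2 = `|V x| ^+ 2 + eta * (2 * `|V x| + eta) by ring.
  by rewrite real_normK ?num_real // lerD2l ler_wpM2l ?(ltW eta0) // lerD2r ler_wpM2l.
have [k ks] : exists k : nat, `|s| / d < k%:R.
  by exists (Num.bound (`|s| / d)); rewrite archi_boundP // divr_ge0 // ltW.
have k0 : 0 < k%:R :> R by apply: le_lt_trans ks; rewrite divr_ge0 // ltW.
have sE : s = (s / k%:R) *+ k by rewrite -[RHS]mulr_natr divfK // gt_eqF.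
have skd : `|s / k%:R| < d.
  by rewrite normrM normfV (gtr0_norm k0) ltr_pdivrMr // mulrC -ltr_pdivrMr.
rewrite sE gamma_pow.
apply: le_trans (displacement_exp k cf _ (small _ skd)) _; first by rewrite mulr_ge0 // sqrtr_ge0.
rewrite -sE mulrA normrM normfV (gtr0_norm k0) [k%:R * _]mulrC divfK ?gt_eqF //.
by rewrite exprMn real_normK ?num_real // sqr_sqrtr.
Qed.

End one_parameter.
End displacement.

(** * From displacement to variance *)

Section averaging.
Context (R : realType) (n m : nat) (G : groupTopologicalType)
  (AG : set (chart G 'rV[R]_n)) (M : ptopologicalType) (AM : set (chart M 'rV[R]_m))
  (act : G -> M -> M) (G_lie : is_lie_group AG)
  (homM : is_homogeneous_space AG AM act) (M_compact : compact [set: M])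
  (mu : {measure set (borel M) -> \bar R}) (mu_invariant : invariant_measure act mu)
  (mu_finite : (mu setT < +oo)%E) (mu_pos : 0 < fine (mu setT)).

Local Notation I f := (\int[mu]_x f x).
Local Notation w := (fine (mu setT)).

(** The mean minimises the second moment: when (f - b)^2 is expanded around the mean [a], the cross
    term integrates to 0. The density [rho] serves both the normalised [mu] and the Gibbs
    measure. *)
Lemma weighted_variance_le (f rho : M -> R) (b : R) : continuous f -> continuous rho ->
  (forall x, 0 <= rho x) -> I rho = 1 ->
  I (fun x => (f x - I (fun y => f y * rho y)) ^+ 2 * rho x) <=
  I (fun x => (f x - b) ^+ 2 * rho x).
Proof.
move=> cf crho rho0 rho1; set a := I (fun y => f y * rho y).
have ccst (e : R) : continuous (fun _ : M => e) by move=> x; exact: cst_continuous.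
have cfb (e : R) : continuous (fun x : M => f x - e).
  by move=> x; exact: (continuousB (cf x) (ccst e x)).
have cM (g h : M -> R) : continuous g -> continuous h -> continuous (fun x => g x * h x).
  by move=> cg ch x; exact: (continuousM (cg x) (ch x)).
have c1 : continuous (fun x : M => (f x - a) ^+ 2 * rho x).
  by apply: (cM (fun x => (f x - a) ^+ 2)) crho; exact: (continuous_sqr (cfb a)).
have cr (e : R) : continuous (fun x : M => e * rho x) by exact: cM.
have cfr : continuous (fun x : M => f x * rho x) by exact: cM.
have c2 : continuous (fun x : M => f x * rho x + - a * rho x).
  by move=> x; exact: (continuousD (cfr x) (cr _ x)).
have c3 : continuous (fun x : M => 2 * (a - b) * (f x * rho x + - a * rho x)) by exact: cM.
have c4 : continuous (fun x : M => 2 * (a - b) * (f x * rho x + - a * rho x) + (a - b) ^+ 2 * rho x).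
  by move=> x; exact: (continuousD (c3 x) (cr _ x)).
have E : (fun x : M => (f x - b) ^+ 2 * rho x) = (fun x => (f x - a) ^+ 2 * rho x +
    (2 * (a - b) * (f x * rho x + - a * rho x) + (a - b) ^+ 2 * rho x)).
  by apply/funext => x; ring.
rewrite E (int_add M_compact mu_finite c1 c4) lerDl (int_add M_compact mu_finite c3 (cr _)).
rewrite (int_scale M_compact mu_finite _ c2) (int_add M_compact mu_finite cfr (cr _)).
rewrite !(int_scale M_compact mu_finite _ crho) rho1 mulr1 -/a subrr mulr0 add0r mulr1.
exact: sqr_ge0.
Qed.

Lemma variance_le (f : M -> R) (b : R) : continuous f ->
  I (fun x => (f x - I f / w) ^+ 2) <= I (fun x => (f x - b) ^+ 2).
Proof.
move=> cf.
have c1 : continuous (fun _ : M => w^-1) by move=> x; exact: cst_continuous.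
have w1 : I (fun=> w^-1) = 1 by rewrite int_cst mulVf // gt_eqF.
have w0 (x : M) : 0 <= w^-1 by rewrite invr_ge0 ltW.
have E (h : M -> R) : continuous h -> I (fun x => h x * w^-1) = I h / w.
  move=> ch; rewrite [RHS]mulrC -(int_scale M_compact mu_finite _ ch).
  have F : (fun x => h x * w^-1) = (fun x => w^-1 * h x) by apply/funext => x; exact: mulrC.
  by rewrite F.
have cfb (e : R) : continuous (fun x : M => f x - e).
  by move=> x; exact: (continuousB (cf x) (@cst_continuous M R e x)).
have := weighted_variance_le b cf c1 w0 w1.
have c2 (e : R) : continuous (fun x : M => (f x - e) ^+ 2) := continuous_sqr (cfb e).
have E2 (e : R) : I (fun x => (f x - e) ^+ 2 * w^-1) = I (fun x => (f x - e) ^+ 2) / w := E _ (c2 e).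
rewrite (E f cf) !E2.
by rewrite ler_pM2r // invr_gt0.
Qed.

Lemma compact_cover (K N : set G) : compact K -> nbhs 1%g N -> exists J : seq G, covers K N J.
Proof.
move=> cK nN; have mc := lie_mul_continuous G_lie.
have [J JP] := compact_finite_cover (f := fun g => [set h | N (g^-1 * h)%g]) cK
  (fun x _ => ex_intro _ x (nbhs_translate mc x nN)).
by exists J.
Qed.

(** For [z = act h x], [minimal_cover_sum] bounds the sum of (f(act j z) - f x)^2 over a minimal
    cover [J] by an expression in [x] alone. Integrating in [z] gives at least [size J] times the
    variance, by invariance of [mu]; integrating then in [x] produces displacements of elements of
    [L]. The factor [size J], which depends on the small neighbourhood, appears on both sides and
    cancels. *)
Lemma variance_displacement : exists (c : nat) (L : set G), compact L /\
  forall (f : M -> R) (D : R), continuous f -> 0 <= D ->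
    (forall g, L g -> displacement act mu f g <= D) ->
    I (fun x => (f x - I f / w) ^+ 2) <= c%:R * D.
Proof.
have mc := lie_mul_continuous G_lie; have ic := lie_inv_continuous G_lie.
have [Q cQ QP] := transitive_compact G_lie homM M_compact.
have [K0 cK0 nK0] := compact_neighbourhood G_lie.
have [P PP] := small_neighbourhoods G_lie.
(* [K0 K0^-1] contains the centres of a minimal cover of [K0] by translates of any [N] inside [K0];
   the set in [cK2] contains their images under left multiplication by [Q], and [L], its product
   with [K0^-1], contains the centres of a minimal cover of that set. *)
have cK1 := compact_mul mc cK0 (compact_inv ic cK0).
have cK2 := compact_mul mc cQ cK1; have cL := compact_mul mc cK2 (compact_inv ic cK0).
have [J0 J0P] := compact_cover cK2 nK0.
(* [P] bounds [size T], [size J0] bounds the ratio of [size J'] to [size J], and 2 comes from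
   squaring a sum; none of them depends on [eta]. *)
exists (2 * P * size J0)%N; eexists; split; first exact: cL.
move=> f D cf D0 fD.
suff H : forall eta, 0 < eta ->
    I (fun x => (f x - I f / w) ^+ 2) <= (2 * P * size J0)%:R * (D + eta ^+ 2 * w).
  set c : R := _%:R in H *; apply/ler_addgt0Pr => e e0.
  have c0 : 0 <= c by exact: ler0n.
  have d0 : 0 < c * w + 1 by rewrite ltr_wpDl // mulr_ge0 // ltW.
  have [eta [eta0 eta1 etae]] : exists eta : R, [/\ 0 < eta, eta <= 1 & eta <= e / (c * w + 1)].
    exists (Num.min 1 (e / (c * w + 1))).
    by rewrite lt_min ltr01 divr_gt0 // !ge_min !lexx orbT.
  apply: le_trans (H _ eta0) _; rewrite mulrDr lerD2l.
  apply: le_trans (_ : eta * (c * w + 1) <= _); last by rewrite -ler_pdivlMr.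
  apply: le_trans (_ : eta * (c * w) <= _); last by rewrite ler_wpM2l ?(ltW eta0) // lerDl.
  rewrite mulrCA ler_wpM2r ?mulr_ge0 ?(ltW mu_pos) //.
  by rewrite expr2 ler_piMl // ltW.
move=> eta eta0.
have [N [T [nN NW sT NT]]] := PP _ (filterI nK0 (uniformly_continuous_act homM M_compact cf eta0)).
have [J1 J1P] := compact_cover cK0 nN; have [J Jmin] := exists_minimal_cover J1P.
have [J2 J2P] := compact_cover cK2 nN; have [J' J'min] := exists_minimal_cover J2P.
have K01 : K0 1%g by exact: nbhs_singleton.
have J_gt0 : (0 < size J)%N.
  by have [j] := Jmin.1 _ K01; case: (J).
have sJ' := minimal_cover_size J0P Jmin J'min.
have J'L j : j \in J' -> displacement act mu f j <= D.
  move=> /(minimal_cover_meets J'min)[g K2g /NW[K0g _]]; apply: fD.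
  exists g, ((j^-1 * g)^-1)%g; split => //=; first by rewrite invgK.
  by rewrite invgM invgK mulVKg.
(* Bounds (f(act (g n) x) - f x)^2 for all [n] in [N], since [f] varies by at most [eta] under
   [N]. *)
pose psi x g : R := 2 * ((f (act g x) - f x) ^+ 2 + eta ^+ 2).
have key x z : \sum_(j <- J) (f (act j z) - f x) ^+ 2 <= P%:R * \sum_(j <- J') psi x j.
  have [h Qh ->] := QP x z.
  have hJ j : j \in J -> [set x | exists g h, [/\ Q g,
      [set x | exists g h, [/\ K0 g, [set x | K0 x^-1%g] h & x = (g * h)%g]] h &
      x = (g * h)%g]] (h * j)%g.
    move=> /(minimal_cover_meets Jmin)[g K0g /NW[K0j _]].
    exists h, j; split => //=; exists g, ((j^-1 * g)^-1)%g; split => //=; first by rewrite invgK.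
    by rewrite invgM invgK mulVKg.
  have psi0 g : 0 <= psi x g by rewrite mulr_ge0 // addr_ge0 ?sqr_ge0.
  have phipsi j nn : N nn -> (f (act (j * nn)%g x) - f x) ^+ 2 <= psi x j.
    move=> /NW[_ /(_ (act j x))]; rewrite -(act_mul homM) => le.
    set b := f (act j x) in le *; set b' := f (act (j * nn)%g x) in le *.
    have le2 : (b' - b) ^+ 2 <= eta ^+ 2.
      by rewrite -[leLHS]real_normK ?num_real // ler_pXn2r // nnegrE ltW.
    rewrite /psi -/b; apply: le_trans (_ : 2 * ((b - f x) ^+ 2 + (b' - b) ^+ 2) <= _).
      rewrite -subr_ge0 (_ : _ - _ = (b - f x - (b' - b)) ^+ 2) ?sqr_ge0 //; ring.
    by rewrite ler_wpM2l // lerD2l.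
  have := minimal_cover_sum Jmin J'min.1 NT hJ (phi := fun g => (f (act g x) - f x) ^+ 2)
    (fun g => sqr_ge0 _) psi0 phipsi.
  have E : \sum_(j <- J) (f (act (h * j)%g x) - f x) ^+ 2 = \sum_(j <- J) (f (act j (act h x)) - f x) ^+ 2.
    by apply: eq_bigr => j _; rewrite (act_mul homM).
  rewrite E => /le_trans; apply; rewrite ler_wpM2r ?ler_nat //.
  by apply: sumr_ge0.
set Vf := I (fun x => (f x - I f / w) ^+ 2).
have ccst (e : R) : continuous (fun _ : M => e) by move=> x; exact: cst_continuous.
have Jw (js : seq G) (e : R) : \sum_(j <- js) e = (size js)%:R * e.
  by rewrite big_const_seq count_predT iter_addr_0 mulr_natl.
(* Integration of [key] over [z]: by invariance each term becomes the second moment of [f] about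
   [f x], which is at least the variance. *)
have key2 x : (size J)%:R * Vf <= P%:R * w * \sum_(j <- J') psi x j.
  have cfx : continuous (fun z : M => f z - f x).
    by move=> z; exact: (continuousB (cf z) (ccst _ z)).
  have cfx2 := continuous_sqr cfx.
  have cj j : continuous (fun z : M => (f (act j z) - f x) ^+ 2).
    move=> z; apply: (@continuous_comp _ _ _ (act j) (fun y => (f y - f x) ^+ 2)).
      exact: act_continuousr homM _ _.
    exact: cfx2.
  have [cS IS] := @int_sum R M M_compact mu mu_finite G J
    (fun j z => (f (act j z) - f x) ^+ 2) cj.
  have := int_le M_compact mu_finite cS (ccst _) (key x).
  rewrite IS int_cst mulrAC => /(le_trans _); apply.
  rewrite -Jw; apply: ler_sum => j _.
  rewrite (@int_invariant R M M_compact mu mu_finite (fun y => (f y - f x) ^+ 2)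
    (act j) cfx2 (@act_continuousr _ _ _ _ _ _ _ _ homM j) (mu_invariant j)).
  exact: (variance_le (f x) cf).
have cpsi j : continuous (fun x : M => psi x j).
  have c1 := continuous_sqr (difference_continuous homM (g := j) cf).
  have c2 : continuous (fun x : M => (f (act j x) - f x) ^+ 2 + eta ^+ 2).
    by move=> x; exact: (continuousD (c1 x) (ccst _ x)).
  by move=> x; exact: (continuousM (ccst 2 x) (c2 x)).
have Ipsi j : j \in J' -> I (fun x => psi x j) <= 2 * (D + eta ^+ 2 * w).
  move=> J'j; have c1 := continuous_sqr (difference_continuous homM (g := j) cf).
  have c2 : continuous (fun x : M => (f (act j x) - f x) ^+ 2 + eta ^+ 2).
    by move=> x; exact: (continuousD (c1 x) (ccst _ x)).
  rewrite (int_scale M_compact mu_finite 2 c2) (int_add M_compact mu_finite c1 (ccst _)).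
  by rewrite int_cst ler_wpM2l // lerD2r; exact: J'L.
have [cS IS] := @int_sum R M M_compact mu mu_finite G J' (fun j x => psi x j) cpsi.
have cPS : continuous (fun x : M => P%:R * w * \sum_(j <- J') psi x j).
  by move=> x; exact: (continuousM (ccst _ x) (cS x)).
have := int_le M_compact mu_finite (ccst _) cPS key2.
rewrite int_cst (int_scale M_compact mu_finite _ cS) IS => key3.
have D1 : 0 <= 2 * (D + eta ^+ 2 * w).
  by rewrite mulr_ge0 // addr_ge0 // mulr_ge0 ?sqr_ge0 // ltW.
have key4 : (size J)%:R * Vf <= P%:R * ((size J0 * size J)%:R * (2 * (D + eta ^+ 2 * w))).
  rewrite -(ler_pM2r mu_pos) (le_trans key3) // mulrAC ler_wpM2r ?(ltW mu_pos) //.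
  rewrite ler_wpM2l //; apply: le_trans (_ : (size J')%:R * (2 * (D + eta ^+ 2 * w)) <= _).
    by rewrite -Jw big_seq [leRHS]big_seq; apply: ler_sum => j /Ipsi.
  by rewrite ler_wpM2r // ler_nat.
rewrite -(ler_pM2l (_ : 0 < (size J)%:R)) ?ltr0n // (le_trans key4) //.
by rewrite !natrM le_eqVlt; apply/orP; left; apply/eqP; ring.
Qed.
End averaging.

(** * Finiteness of the measure and passage to the Gibbs measure *)

Section compact_measure.
Context (R : realType) (M : ptopologicalType) (M_compact : compact [set: M])
  (mu : {measure set (borel M) -> \bar R}).

(** A positive continuous density on a compact space is bounded above and away from 0, so its total
    mass 1 bounds the mass of [mu] on both sides. *)
Lemma density_mass (q : M -> R) : continuous q -> (forall x, 0 < q x) ->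
  (\int[mu]_x (q x)%:E = 1)%E -> (mu setT < +oo)%E /\ 0 < fine (mu setT).
Proof.
move=> cq q0 q1.
have [B B0 qB] := continuous_bounded M_compact cq.
have cqV : continuous (fun x : M => (q x)^-1).
  by move=> x; exact: (continuousV (lt0r_neq0 (q0 x)) (cq x)).
have [B' B'0 qB'] := continuous_bounded M_compact cqV.
have mq : measurable_fun (setT : set (borel M)) (fun x : borel M => (q x)%:E).
  by apply/measurable_EFinP; exact: continuous_measurable_borel.
have mc (a : R) : measurable_fun (setT : set (borel M)) (fun _ : borel M => a%:E).
  exact: measurable_cst.
have B'1 : 0 < (B' + 1)^-1 by rewrite invr_gt0 ltr_wpDl.
have le1 : ((B' + 1)^-1%:E * mu setT <= 1)%E.
  rewrite -q1 -integral_cst //; apply: ge0_le_integral => //.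
    by move=> x _; rewrite lee_fin ltW.
  move=> x _ /=; rewrite lee_fin -[leRHS]invrK lef_pV2 ?posrE ?invr_gt0 ?ltr_wpDl //.
  by have := qB' x; rewrite ger0_norm ?invr_ge0 ?(ltW (q0 x)) // => /le_trans; apply; rewrite lerDl.
have le2 : (1 <= B%:E * mu setT)%E.
  rewrite -q1 -integral_cst //; apply: ge0_le_integral => //.
    by move=> x _; rewrite lee_fin ltW.
  by move=> x _ /=; rewrite lee_fin (le_trans (ler_norm _)).
have fin : (mu setT < +oo)%E.
  rewrite ltNge leye_eq; apply/negP => /eqP E.
  by move: le1; rewrite E gt0_muley ?lte_fin // leNgt ltry.
split => //; apply: fine_gt0; rewrite fin andbT.
rewrite lt0e measure_ge0 andbT; apply/eqP => E.
by move: le2; rewrite E mule0 leNgt lte01.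
Qed.

Context (mu_finite : (mu setT < +oo)%E) (mu_pos : 0 < fine (mu setT)).

Local Notation I f := (\int[mu]_x f x).

(** The Holley-Stroock perturbation argument. With k = exp(u / eps^2) the weight lies between 1/k
    and k, so each of the two changes of measure costs a factor [k], and the normalisations cancel.
    Centring at the mean under [mu] is allowed by [weighted_variance_le]. *)
Lemma gibbs_comparison (U : M -> R) (u eps C : R) (f g : M -> R) :
  continuous U -> (forall x, `|U x| <= u) -> continuous f -> continuous g ->
  (forall x, 0 <= g x) -> 0 <= C ->
  I (fun x => (f x - I f / fine (mu setT)) ^+ 2) <= C * I g ->
  gibbs_var mu U eps f <= C * expR (2 * u / eps ^+ 2) * gibbs_mean mu U eps g.
Proof.
move=> cU Uu cf cg g0 C0 var.
have ccst (a : R) : continuous (fun _ : M => a) by move=> x; exact: cst_continuous.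
have cM (h k : M -> R) : continuous h -> continuous k -> continuous (fun x => h x * k x).
  by move=> ch ck x; exact: (continuousM (ch x) (ck x)).
pose wt x : R := expR (- U x / eps ^+ 2).
have cwt : continuous wt.
  have cNU : continuous (fun x : M => - U x) by move=> x; exact: (continuousN (cU x)).
  have cV := cM _ _ cNU (ccst (eps ^+ 2)^-1).
  move=> x; apply: (continuous_comp (f := fun x : M => - U x * (eps ^+ 2)^-1)).
    exact: cV.
  exact: continuous_expR.
have e0 : 0 <= (eps ^+ 2)^-1 by rewrite invr_ge0 sqr_ge0.
have wt0 x : 0 < wt x by exact: expR_gt0.
have [k k0 kE] : exists2 k : R, 0 < k & k = expR (u / eps ^+ 2).
  by exists (expR (u / eps ^+ 2)) => //; exact: expR_gt0.
have wtk x : wt x <= k.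
  rewrite kE ler_expR ler_wpM2r //; have := Uu x.
  by rewrite ler_norml lerNl => /andP[].
have kwt x : 1 <= k * wt x.
  rewrite kE -expRD -expR0 ler_expR -mulrDl mulr_ge0 // subr_ge0.
  by apply: le_trans (Uu x); exact: ler_norm.
have [Z Z0 ZE] : exists2 Z : R, 0 < Z & Z = partition_function mu U eps.
  exists (I wt) => //.
  have : I (fun=> k^-1) <= I wt.
    apply: (int_le M_compact mu_finite (ccst _) cwt) => x.
    by rewrite -(ler_pM2l k0) mulfV ?gt_eqF.
  by rewrite int_cst; apply: lt_le_trans; rewrite mulr_gt0 // invr_gt0.
pose rho x := Z^-1 * wt x.
have rhoE : gibbs_density mu U eps = rho.
  by apply/funext => x; rewrite /gibbs_density -ZE.
have crho : continuous rho by exact: cM (ccst _) cwt.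
have Zi : 0 <= Z^-1 by rewrite invr_ge0 ltW.
have rho0 x : 0 <= rho x := mulr_ge0 Zi (ltW (wt0 x)).
have rho1 : I rho = 1.
  rewrite /rho (int_scale M_compact mu_finite _ cwt).
  have -> : I wt = Z by rewrite ZE.
  by rewrite mulVf // gt_eqF.
have meanE h : gibbs_mean mu U eps h = I (fun x => h x * rho x).
  by rewrite /gibbs_mean rhoE.
rewrite /gibbs_var !meanE.
set a := I f / _ in var.
apply: le_trans (weighted_variance_le M_compact mu_finite a cf crho rho0 rho1) _.
have cfa : continuous (fun x : M => f x - a).
  by move=> x; exact: (continuousB (cf x) (ccst a x)).
have c1 : continuous (fun x : M => (f x - a) ^+ 2) := continuous_sqr cfa.
have c2 : continuous (fun x : M => (f x - a) ^+ 2 * rho x) by exact: cM.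
have c3 : continuous (fun x : M => Z^-1 * k * (f x - a) ^+ 2) by exact: cM.
have cgr : continuous (fun x : M => g x * rho x) by exact: cM.
have c4 : continuous (fun x : M => k * Z * (g x * rho x)) by exact: cM.
have le1 : I (fun x => (f x - a) ^+ 2 * rho x) <= Z^-1 * k * I (fun x => (f x - a) ^+ 2).
  rewrite -(int_scale M_compact mu_finite _ c1).
  apply: (int_le M_compact mu_finite c2 c3) => x.
  by rewrite mulrC ler_wpM2r ?sqr_ge0 // /rho ler_wpM2l // invr_ge0 ltW.
have le2 : I g <= k * Z * I (fun x => g x * rho x).
  rewrite -(int_scale M_compact mu_finite _ cgr).
  apply: (int_le M_compact mu_finite cg c4) => x.
  rewrite /rho (_ : _ * _ = g x * (k * wt x)); last by field; rewrite gt_eqF.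
  by rewrite ler_peMr.
apply: (le_trans le1); apply: le_trans (_ : Z^-1 * k * (C * (k * Z * I (fun x => g x * rho x))) <= _).
  rewrite ler_wpM2l ?mulr_ge0 ?invr_ge0 ?(ltW k0) ?(ltW Z0) //.
  by apply: (le_trans var); rewrite ler_wpM2l.
rewrite (_ : expR _ = k * k).
  by rewrite le_eqVlt; apply/orP; left; apply/eqP; field; rewrite gt_eqF.
by rewrite kE -expRD; congr expR; ring.
Qed.

End compact_measure.

(** * The Poincare inequality for the invariant measure *)

Section poincare.
Context (R : realType) (n m : nat) (G : groupTopologicalType)
  (AG : set (chart G 'rV[R]_n)) (M : ptopologicalType) (AM : set (chart M 'rV[R]_m))
  (act : G -> M -> M) (G_lie : is_lie_group AG) (G_connected : connected [set: G])
  (homM : is_homogeneous_space AG AM act) (M_compact : compact [set: M])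
  (mu : {measure set (borel M) -> \bar R}) (mu_invariant : invariant_measure act mu)
  (mu_finite : (mu setT < +oo)%E) (mu_pos : 0 < fine (mu setT))
  (d : nat) (A : 'I_d -> vfield R G)
  (A_left_invariant : forall i, left_invariant AG (A i))
  (A_generate : forall Y, left_invariant AG Y -> lie_span AG A Y)
  (gamma : 'I_d -> R -> G) (gamma_exp : forall i, is_exp AG (A i) (gamma i)).

Local Notation I f := (\int[mu]_x f x).
Local Notation Gamma := (carre_du_champ (fun i => fundamental act (gamma i))).

Lemma carre_du_champ_ge0 f x : 0 <= Gamma f f x.
Proof. by apply: sumr_ge0 => i _; rewrite -expr2 sqr_ge0. Qed.

Lemma carre_du_champ_continuous f : smooth_fun AM f -> continuous (Gamma f f).
Proof.
move=> sf; have cV i := fundamental_continuous G_lie homM (gamma_exp i) sf.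
have cVV i : continuous (fun x => fundamental act (gamma i) f x * fundamental act (gamma i) f x).
  by move=> x; exact: (continuousM (cV i x) (cV i x)).
by have [c _] := int_sum M_compact mu_finite (index_enum 'I_d) cVV.
Qed.

(** The relation N(g) <= C. The sign of [C] is recorded because only [C ^+ 2] occurs in the
    inequality, while the constants themselves are added along products. *)
Definition displacement_bound (C : R) (g : G) : Prop :=
  0 <= C /\ forall f, smooth_fun AM f -> displacement act mu f g <= C ^+ 2 * I (Gamma f f).

Let E0 f : 0 <= I (Gamma f f).
Proof. by apply: int_ge0 => x; exact: carre_du_champ_ge0. Qed.

Let smooth_continuous f : smooth_fun AM f -> continuous f.
Proof. by move=> [c _] x; exact: c. Qed.

Lemma displacement_bound_mul C C' g h : displacement_bound C g -> displacement_bound C' h ->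
  displacement_bound (C + C') (g * h)%g.
Proof.
move=> [C0 Cg] [C'0 C'h]; split => [|f sf]; first exact: addr_ge0.
have sq a : a ^+ 2 * I (Gamma f f) = (a * Num.sqrt (I (Gamma f f))) ^+ 2.
  by rewrite exprMn sqr_sqrtr.
rewrite sq mulrDl; have cf := smooth_continuous sf.
by apply: (displacement_mul homM) => //; rewrite ?mulr_ge0 ?sqrtr_ge0 // -sq; [exact: Cg|exact: C'h].
Qed.

Lemma displacement_bound_inv C g : displacement_bound C g -> displacement_bound C g^-1%g.
Proof.
move=> [C0 Cg]; split => // f sf.
by rewrite (displacement_inv homM M_compact mu_invariant mu_finite _ (smooth_continuous sf)); exact: Cg.
Qed.

Lemma displacement_bound_one : displacement_bound 0 1%g.
Proof. by split => // f _; rewrite (displacement_one homM) expr0n mul0r. Qed.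

Lemma displacement_bound_mono C C' g : C <= C' -> displacement_bound C g ->
  displacement_bound C' g.
Proof.
move=> CC' [C0 Cg]; have C'0 := le_trans C0 CC'; split => // f sf.
by apply: le_trans (Cg f sf) _; rewrite ler_wpM2r // ler_pXn2r.
Qed.

Lemma displacement_bound_gamma i t : `|t| < 1 -> displacement_bound 1 (gamma i t).
Proof.
move=> t1; split => // f sf; rewrite expr1n mul1r.
have c := fundamental_continuous G_lie homM (gamma_exp i) sf.
have cVV := continuous_sqr c; have cG := carre_du_champ_continuous sf.
apply: le_trans (displacement_gamma G_lie homM M_compact mu_invariant mu_finite (gamma_exp i) sf t) _.
have le1 : I (fun x => fundamental act (gamma i) f x ^+ 2) <= I (Gamma f f).
  apply: (int_le M_compact mu_finite cVV cG) => x.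
  rewrite /carre_du_champ (bigD1 i) //= expr2 lerDl; apply: sumr_ge0 => j _.
  by rewrite -expr2 sqr_ge0.
apply: le_trans le1; rewrite ler_piMl //; first by apply: int_ge0 => x; exact: sqr_ge0.
by rewrite -real_normK ?num_real // exprn_ile1 // ltW.
Qed.

(** The compact set [L] given by the averaging does not depend on [f], so a single bound for N on
    [L] serves all functions. *)
Lemma poincare : exists2 C, 0 <= C & forall f, smooth_fun AM f ->
  I (fun x => (f x - I f / fine (mu setT)) ^+ 2) <= C * I (Gamma f f).
Proof.
have [c Ac c1] := atlas_cover (lie_atlas_ok G_lie) 1%g.
have gd := all_directions_good G_lie Ac c1 displacement_bound_mul displacement_bound_inv
  displacement_bound_one A_left_invariant gamma_exp A_generate
  (fun i => ex_intro _ 1 (@displacement_bound_gamma i)).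
have near1 := nbhs_one_bd G_lie Ac c1 displacement_bound_mul displacement_bound_one gd.
have [N [L [cL LP]]] := variance_displacement G_lie homM M_compact mu_invariant mu_finite mu_pos.
have [C CP] := compact_bd (lie_mul_continuous G_lie) displacement_bound_mul
  displacement_bound_inv displacement_bound_one displacement_bound_mono G_connected cL near1.
exists (N%:R * C ^+ 2) => [|f sf]; first by rewrite mulr_ge0 ?sqr_ge0.
rewrite -mulrA; apply: LP => [||g Lg]; first exact: smooth_continuous.
  by rewrite mulr_ge0 ?sqr_ge0.
by have [_] := CP g Lg; exact.
Qed.

End poincare.

Theorem theorem5p4 (R : realType)
  (n m : nat) (G : groupTopologicalType) (AG : set (chart G 'rV[R]_n))
  (M : ptopologicalType) (AM : set (chart M 'rV[R]_m)) (act : G -> M -> M)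
  (G_lie : is_lie_group AG) (G_connected : connected [set: G])
  (M_homogeneous : is_homogeneous_space AG AM act) (M_compact : compact [set: M])
  (mu : {measure set (borel M) -> \bar R}) (mu_invariant : invariant_measure act mu)
  (d : nat) (A : 'I_d -> vfield R G)
  (A_left_invariant : forall i, left_invariant AG (A i))
  (A_generate : forall Y, left_invariant AG Y -> lie_span AG A Y)
  (gamma : 'I_d -> R -> G) (gamma_exp : forall i, is_exp AG (A i) (gamma i))
  (disp : measure_display) (T : measurableType disp) (P : probability T R)
  (F : R -> set (set T)) (F_filtration : filtration F)
  (B : 'I_d -> R -> T -> R) (B_brownian : brownian_motion P F B)
  (X : M -> R -> T -> M)
  (X_solution : forall x,
    sde_solution P F AM (fun i => fundamental act (gamma i)) B x (X x))
  (p : R -> M -> M -> R) (p_kernel : heat_kernel P AM mu X p) :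
  let V := fun i => fundamental act (gamma i) in
  let Gamma := carre_du_champ V in
  let Pt := semigroup P X in
  forall K : R, 0 < K ->
  (forall f, smooth_fun AM f -> forall t x, 0 <= t -> t <= 1 ->
    Gamma (Pt t f) (Pt t f) x <= K * Pt t (Gamma f f) x) ->
  forall (U : M -> R) (D : R) (x0 : M), smooth_fun AM U ->
  (forall x (eps : R), 0 < eps -> eps <= 1 ->
    `|U x + eps ^+ 2 * ln (p (eps ^+ 2) x0 x)| <= D) ->
  exists r c : R, [/\ 1 < r, 0 < c &
    forall f, smooth_fun AM f -> forall t, 0 <= t ->
      let eps := c / Num.sqrt (ln (r + t)) in
      gibbs_var mu U eps f <=
        K * (r + t) * gibbs_mean mu U eps (fun x => 2^-1 * Gamma f f x)].
Proof.
move=> V Gamma Pt K K0 _ U D x0 sU _.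
have okM := manifold_atlas_ok (homogeneous_manifold M_homogeneous).
have [mu_finite mu_pos] : (mu setT < +oo)%E /\ 0 < fine (mu setT).
  (* The law at time 1 of the diffusion started from [point] has total mass 1 and density
     [p 1 point]. *)
  apply: (density_mass M_compact (q := p 1 point)) => [y|y|].
  - have [cp _] := kernel_smooth p_kernel.
    have cp1 := cp (1, (point, y)) (ltr01 : [set z : R * (M * M) | 0 < z.1] (1, (point, y))).
    have cy : {for y, continuous (fun y : M => (1 : R, (point : M, y)))}.
      have c2 : (fun y : M => (point : M, y)) @ y --> (point : M, y).
        by apply: cvg_pair; [exact: cst_continuous|exact: cvg_id].
      exact: (cvg_pair (@cst_continuous M R 1 y) c2).
    exact: (continuous_comp cy cp1).
  - by apply: (kernel_pos p_kernel).
  - by rewrite -(kernel_density p_kernel _ ltr01 measurableT) preimage_setT probability_setT.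
have [C C0 poinc] := poincare G_lie G_connected M_homogeneous M_compact mu_invariant
  mu_finite mu_pos A_left_invariant A_generate gamma_exp.
have cU : continuous U by move=> x; have [c _] := sU; exact: c.
have [u u0 Uu] := continuous_bounded M_compact cU.
have [c c0 cE] : exists2 c : R, 0 < c & c ^+ 2 = 4 * (u + 1).
  have u1 : 0 < 4 * (u + 1) by rewrite mulr_gt0 // ltr_wpDl.
  by exists (Num.sqrt (4 * (u + 1))); rewrite ?sqrtr_gt0 // sqr_sqrtr // ltW.
(* This choice gives 2C <= K (r + t)^(1/2) for all t >= 0; the [+ 2] in the witness secures
   [1 < r]. *)
have [r r1 rC] : exists2 r : R, 1 < r & (2 * C / K) ^+ 2 <= r.
  exists ((2 * C / K) ^+ 2 + 2); last by rewrite lerDl.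
  by rewrite ltr_wpDl ?sqr_ge0 // ltr1n.
exists r, c; split => // f sf t t0 /=; set eps := c / _.
have rt1 : 1 < r + t by rewrite (lt_le_trans r1) // lerDl.
have rt0 : 0 < r + t by rewrite (lt_trans _ rt1).
have L0 : 0 < ln (r + t) by rewrite ln_gt0.
have cG := carre_du_champ_continuous G_lie M_homogeneous M_compact mu_finite gamma_exp sf.
have cf : continuous f by move=> x; have [c' _] := sf; exact: c'.
have G0 x : 0 <= 2^-1 * Gamma f f x by rewrite mulr_ge0 ?invr_ge0 // carre_du_champ_ge0.
have chG : continuous (fun x : M => 2^-1 * Gamma f f x).
  by move=> x; exact: (continuousM (@cst_continuous M R 2^-1 x) (cG x)).
have var : \int[mu]_x (f x - (\int[mu]_x f x) / fine (mu setT)) ^+ 2 <=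
    2 * C * \int[mu]_x (2^-1 * Gamma f f x).
  rewrite (int_scale M_compact mu_finite _ cG); apply: le_trans (poinc f sf) _.
  by rewrite mulrAC mulrA mulfV // mul1r mulrC.
have C20 : 0 <= 2 * C by rewrite mulr_ge0.
apply: le_trans (gibbs_comparison M_compact mu_finite mu_pos eps cU Uu cf chG G0 C20 var) _.
have mean0 : 0 <= gibbs_mean mu U eps (fun x => 2^-1 * Gamma f f x).
  apply: int_ge0 => x; apply: mulr_ge0 (G0 x) (mulr_ge0 _ (expR_ge0 _)).
  by rewrite invr_ge0; apply: int_ge0 => z; exact: expR_ge0.
apply: ler_wpM2r => //.
have epsE : 2 * u / eps ^+ 2 <= ln (r + t) / 2.
  have -> : eps ^+ 2 = 4 * (u + 1) / ln (r + t).
    by rewrite /eps expr_div_n sqr_sqrtr ?(ltW L0) // cE.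
  have u1 : 0 < u + 1 by rewrite ltr_wpDl.
  have -> : 2 * u / (4 * (u + 1) / ln (r + t)) = u / (u + 1) * (ln (r + t) / 2).
    by field; rewrite !gt_eqF.
  by rewrite ler_piMl ?divr_ge0 ?(ltW L0) // ler_pdivrMr // mul1r lerDl.
(* [y] is the square root of [r + t]: one factor [y] absorbs the Gibbs weight, the other, together
   with [K], the constant [2 * C]. *)
have [y y0 yE] : exists2 y : R, 0 < y & y = expR (ln (r + t) / 2).
  by exists (expR (ln (r + t) / 2)) => //; exact: expR_gt0.
have y2 : r + t = y ^+ 2.
  by rewrite yE expr2 -expRD -splitr lnK // posrE.
have yC : 2 * C <= K * y.
  rewrite [leRHS]mulrC -ler_pdivrMr // -(@ler_pXn2r _ 2) ?nnegrE ?divr_ge0 ?(ltW y0) ?(ltW K0) //.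
  by rewrite -y2 (le_trans rC) // lerDl.
rewrite y2 expr2 [leRHS]mulrA; apply: (ler_pM C20 (expR_ge0 _) yC _).
by rewrite yE ler_expR.
Qed.
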